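(* (1) A PACS-structure of Kähler type of signature $(p,q)$ on a smooth manifold $M$ of real dimension $2(p+q)\geq4$ is equivalent to a conformal class of almost Hermitian metrics $(g,J)$ on $M$ (of signature $(p,q)$). (2) A PACS-structure of para-Kähler type on a smooth manifold $M$ of real dimension $2n\geq4$ is given by a conformal class of almost para-Hermitian metrics $(g,TM=E\oplus F)$ on $M$. (3) In both cases, the underlying almost conformally symplectic structure $\ell\subset\Lambda^2T^*M$ is spanned by the fundamental two-forms of the metrics in the class. In particular, the structure is PCS (i.e. $\ell$ is conformally symplectic) if and only if the conformal class locally contains almost Kähler metrics (respectively almost para-Kähler metrics), which then are (locally) unique up to a constant factor.
   Context: Almost conformally symplectic structure on an even-dimensional manifold $M$ (dimension $\ge4$): a smooth line subbundle $\ell\subset\Lambda^2T^*M$ all of whose non-zero elements are non-degenerate; it is conformally symplectic if around each $x\in M$ there is a local section of $\ell$ that is closed and non-zero at $x$. For a vector space $V$ with a one-dimensional space $\mathbb R b\subset\Lambda^2V^*$ spanned by a non-degenerate form, $CSp(V)=\{A\in GL(V):b(Av,Aw)=\lambda b(v,w)\text{ for some }\lambda\in\mathbb R\}$. A first order structure with group $G_0\subset GL(V)$ on $M$ ($\dim M=\dim V$) is a reduction of the structure group of the linear frame bundle of $M$ to $G_0$; for $G_0\subset CSp(V)$ the line $\mathbb R b$ induces an underlying almost conformally symplectic structure $\ell$ on $M$. PACS-structure of Kähler type of signature $(p,q)$: $V=\mathbb C^{p+q}$, $b$ is the imaginary part of a non-degenerate Hermitian form of signature $(p,q)$, and $G_0$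 is the subgroup of all complex linear maps in $CSp(V)$. (This arises from the contact grading of $\mathfrak{su}(p+1,q+1)$, with $V=\mathfrak g_{-1}$ and $b$ the Lie bracket.) PACS-structure of para-Kähler type: $V=\mathbb R^{2n}=V^E\oplus V^F$ with $V^E,V^F$ of dimension $n$ and both isotropic for the non-degenerate skew form $b$, and $G_0$ is the subgroup of all elements of $CSp(V)$ preserving both subspaces $V^E$ and $V^F$. (This arises from the contact grading of $\mathfrak{sl}(n+2,\mathbb R)$.) A PACS-structure is PCS if its underlying almost conformally symplectic structure is conformally symplectic. Almost Hermitian metric: an almost complex structure $J$ and a pseudo-Riemannian metric $g$ with $g(J\xi,J\eta)=g(\xi,\eta)$; its fundamental two-form is $\omega(\xi,\eta)=-g(\xi,J\eta)$; it is almost Kähler if $d\omega=0$. Almost para-Hermitian metric: a decomposition $TM=E\oplus F$ into rank $n$ subbundles and a pseudo-Riemannian metric $g$ for which $E$ and $F$ are isotropic; with $\mathcal J=\mathrm{id}$ on $E$ and $-\mathrm{id}$ on $F$, its fundamental two-form is $\omega(\xi,\eta)=-g(\xi,\mathcal J\eta)$; it is almost para-Kähler if $d\omega=0$. A conformal class of such metrics (for fixed $J$, respectively fixed decomposition $E\oplus F$) is understood as a smooth line subbundle of $S^2T^*M$ that is locally spanned by metrics of the given type (of real signature $(2p,2q)$ in the Hermitian case of signature $(p,q)$); the metrics in the class are its local nowhere vanishing sections. *)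

(* Defs.v *)
From HB Require Import structures.
From mathcomp Require Import all_boot all_order all_algebra.
From mathcomp Require Import all_classical all_reals all_analysis.
From mathcomp Require Import complex.

Set Implicit Arguments.
Unset Strict Implicit.
Unset Printing Implicit Defensive.

Import Order.TTheory GRing.Theory Num.Theory.
Import numFieldNormedType.Exports.

Local Open Scope classical_set_scope.
Local Open Scope ring_scope.

(* Vectors are row vectors: a linear map A sends v to v *m A, so "first A,
   then B" is A *m B.  Bilinear forms are given by their Gram matrices. *)

Section SmoothMaps.
Variables (R : realType) (V W : normedModType R).

(* For V finite-dimensional and U open, this is the usual C^k condition:
   iterated directional derivatives up to order k exist and are continuous. *)
Fixpoint Ck (k : nat) (U : set V) (f : V -> W) : Prop :=
  (forall x, U x -> {for x, continuous f}) /\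
  if k is k'.+1 then
    forall v, (forall x, U x -> derivable f x v) /\
              Ck k' U (fun x => 'D_v f x)
  else True.

Definition smooth (U : set V) (f : V -> W) : Prop := forall k, Ck k U f.

End SmoothMaps.

(* cinv is a total function, but only its values on cmap @` cdom matter. *)
Record chart (R : realType) (m : nat) (M : topologicalType) := Chart {
  cdom : set M;
  cmap : M -> 'rV[R]_m;
  cinv : 'rV[R]_m -> M;
  cdom_open : open cdom;
  cimg_open : open (cmap @` cdom);
  cmapK : forall x, cdom x -> cinv (cmap x) = x;
  cmap_continuous : {within cdom, continuous cmap};
  cinv_continuous : {within cmap @` cdom, continuous cinv} }.

(* The preferred chart chart_at x is used only to realise the tangent space
   T_x M as 'rV[R]_m, see dchart. *)
Record manifold (R : realType) (m : nat) := Manifold {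
  mcarrier :> topologicalType;
  atlas : set (chart R m mcarrier);
  chart_at : mcarrier -> chart R m mcarrier;
  chart_at_atlas : forall x, atlas (chart_at x);
  chart_at_dom : forall x, cdom (chart_at x) x;
  atlas_compatible : forall c d, atlas c -> atlas d ->
    smooth (cmap c @` (cdom c `&` cdom d)) (cmap d \o cinv c);
  manifold_hausdorff : hausdorff_space mcarrier;
  manifold_countable : @second_countable mcarrier }.

Section Tensors.
Variables (R : realType) (m : nat) (M : manifold R m).
Implicit Types (c : chart R m M) (U : set M) (x y : M).

(* A tangent vector at x is the row v of its components in the chart
   chart_at x; its components in the chart c are v *m dchart c x.  Tensors at
   x are likewise given by their components in chart_at x. *)
Definition dchart c x : 'M[R]_m :=
  'J (cmap c \o cinv (chart_at x)) (cmap (chart_at x) x).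

Definition rows_in_chart k c (s : M -> 'M[R]_(k, m)) (y : 'rV[R]_m) :=
  s (cinv c y) *m dchart c (cinv c y).

Definition endo_in_chart c (J : M -> 'M[R]_m) (y : 'rV[R]_m) :=
  let T := dchart c (cinv c y) in invmx T *m J (cinv c y) *m T.

Definition form_in_chart c (B : M -> 'M[R]_m) (y : 'rV[R]_m) :=
  let T := dchart c (cinv c y) in
  invmx T *m B (cinv c y) *m (invmx T)^T.

(* k-tuples of vector fields, stored as the rows of a k x m matrix *)
Definition smooth_rows k U (s : M -> 'M[R]_(k, m)) : Prop :=
  forall c, atlas c ->
    smooth (cmap c @` (cdom c `&` U)) (rows_in_chart c s).

Definition smooth_endo U (J : M -> 'M[R]_m) : Prop :=
  forall c, atlas c ->
    smooth (cmap c @` (cdom c `&` U)) (endo_in_chart c J).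

Definition smooth_form U (B : M -> 'M[R]_m) : Prop :=
  forall c, atlas c ->
    smooth (cmap c @` (cdom c `&` U)) (form_in_chart c B).

Definition subbundle k (E : M -> set 'rV[R]_m) : Prop :=
  forall x, exists (U : set M) (s : M -> 'M[R]_(k, m)),
    [/\ open U, U x, smooth_rows U s &
      forall y, U y -> row_free (s y) /\ E y = [set v | (v <= s y)%MS]].

End Tensors.

Section BilinearForms.
Variable R : realType.

Definition bil m (B : 'M[R]_m) (v w : 'rV[R]_m) : R :=
  (v *m B *m w^T) 0 0.

Definition skew m (B : 'M[R]_m) : Prop :=
  forall v w, bil B v w = - bil B w v.

Definition symmetric m (B : 'M[R]_m) : Prop :=
  forall v w, bil B v w = bil B w v.

Definition nondegenerate m (B : 'M[R]_m) : Prop :=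
  forall v, (forall w, bil B v w = 0) -> v = 0.

Definition isotropic m (B : 'M[R]_m) (E : set 'rV[R]_m) : Prop :=
  forall v w, E v -> E w -> bil B v w = 0.

Definition sign_mx (F : pzRingType) (m P : nat) : 'M[F]_m :=
  diag_mx (\row_i (-1) ^+ (P <= i)%N).

(* existence of a basis (the rows of A) which is orthonormal up to signs,
   with P signs +1 and Q signs -1 *)
Definition signature m (P Q : nat) (g : 'M[R]_m) : Prop :=
  (P + Q)%N = m /\
  exists2 A : 'M[R]_m, A \in unitmx & A *m g *m A^T = sign_mx R m P.

(* The two-form -g(., K .) *)
Definition fundamental_form m (g K : 'M[R]_m) : 'M[R]_m := - (g *m K^T).

Lemma fundamental_formE m (g K : 'M[R]_m) (v w : 'rV[R]_m) :
  bil (fundamental_form g K) v w = - bil g v (w *m K).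
Proof.
by rewrite /bil /fundamental_form mulmxN mulNmx mxE trmx_mul !mulmxA.
Qed.

Definition direct_sum m (E F : set 'rV[R]_m) : Prop :=
  forall v, exists! ef : 'rV[R]_m * 'rV[R]_m,
    [/\ E ef.1, F ef.2 & v = ef.1 + ef.2].

(* The linear map which is id on E and - id on F (it exists and is unique
   when the ambient space is the direct sum of the subspaces E and F) *)
Definition para_complex m (E F : set 'rV[R]_m) : 'M[R]_m :=
  xget 0 [set K | (forall v, E v -> v *m K = v) /\
                  (forall v, F v -> v *m K = - v)].

Definition row_space k m (A : 'M[R]_(k, m)) : set 'rV[R]_m :=
  [set v | (v <= A)%MS].

Lemma para_complexP k l m (A : 'M[R]_(k, m)) (B : 'M[R]_(l, m)) :
  direct_sum (row_space A) (row_space B) ->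
  let K := para_complex (row_space A) (row_space B) in
  (forall v, row_space A v -> v *m K = v) /\
  (forall v, row_space B v -> v *m K = - v).
Proof.
move=> dAB K; rewrite /K /para_complex.
have capAB : (A :&: B)%MS = 0.
  apply/eqP/rowV0P => v; rewrite sub_capmx => /andP[vA vB].
  have [ef [_ uniq_ef]] := dAB v.
  have := uniq_ef (v, 0); have := uniq_ef (0, v).
  rewrite /row_space /= sub0mx addr0 add0r => H1 H2.
  by have [] : (v, 0) = (0, v) :> 'rV[R]_m * 'rV[R]_m;
    [rewrite -H1 ?sub0mx// -H2 ?sub0mx|].
have addA : forall v : 'rV[R]_m, (v <= A + B)%MS.
  move=> v; have [[e f] [[/= eA fB ->] _]] := dAB v.
  by rewrite addmx_sub_adds.
pose P0 := proj_mx <<A>>%MS <<B>>%MS - proj_mx <<B>>%MS <<A>>%MS.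
have cap' : (<<A>> :&: <<B>> = 0)%MS.
  by apply/eqP; rewrite -submx0 -capAB capmxS ?genmxE.
have cap'' : (<<B>> :&: <<A>> = 0)%MS by rewrite capmxC.
case: xgetP => [K1 _ //|/(_ P0)[]]; split => v; rewrite /row_space/= => vA.
- rewrite mulmxBr proj_mx_id ?genmxE// proj_mx_0 ?genmxE//.
  by rewrite subr0.
- rewrite mulmxBr proj_mx_0 ?genmxE// proj_mx_id ?genmxE//.
  by rewrite sub0r.
Qed.

End BilinearForms.

Section LineSubbundles.
Variables (R : realType) (m : nat) (M : manifold R m).
Implicit Types (U : set M) (x y : M) (L : M -> set 'M[R]_m).
Implicit Types (B g : M -> 'M[R]_m).

(* L is a line subbundle of the bundle of bilinear forms that is locally
   spanned by smooth sections with values in Q. *)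
Definition line_subbundle_spanned_by (Q : M -> 'M[R]_m -> Prop) L : Prop :=
  forall x, exists U B,
    [/\ open U, U x, smooth_form U B &
      forall y, U y -> [/\ Q y (B y), B y != 0 &
                          L y = [set t *: B y | t in [set: R]]]].

Definition line_subbundle L : Prop :=
  line_subbundle_spanned_by (fun _ _ => True) L.

Definition local_section L U B : Prop :=
  [/\ open U, smooth_form U B & forall y, U y -> L y (B y)].

Definition nonvanishing_section L U B : Prop :=
  local_section L U B /\ forall y, U y -> B y != 0.

(* d B (u, v, w) at the point y of R^m, for constant vector fields u, v, w *)
Definition extd (B : 'rV[R]_m -> 'M[R]_m) (y u v w : 'rV[R]_m) : R :=
  'D_u (fun z => bil (B z) v w) y - 'D_v (fun z => bil (B z) u w) y
  + 'D_w (fun z => bil (B z) u v) y.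

Definition closed_form U B : Prop :=
  forall c x, atlas c -> cdom c x -> U x ->
    forall u v w, extd (form_in_chart c B) (cmap c x) u v w = 0.

Definition almost_conformally_symplectic L : Prop :=
  line_subbundle L /\
  forall x (B : 'M[R]_m), L x B -> skew B /\ (B != 0 -> nondegenerate B).

Definition conformally_symplectic L : Prop :=
  forall x, exists U B,
    [/\ local_section L U B, U x, closed_form U B & B x != 0].

End LineSubbundles.

Section Structures.
Variables (R : realType) (m : nat).

Definition CSp (b : 'rV[R]_m -> 'rV[R]_m -> R) : set 'M[R]_m :=
  [set A | A \in unitmx /\
     exists lambda : R, forall v w, b (v *m A) (w *m A) = lambda * b v w].

Variable M : manifold R m.

(* A frame at x is a linear isomorphism R^m -> T_x M, v |-> v *m u. *)
Definition G_structure (G0 : set 'M[R]_m) (P : M -> set 'M[R]_m) : Prop :=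
  [/\ forall x u, P x u -> u \in unitmx,
      forall x u u', P x u ->
        (P x u' <-> exists2 A, G0 A & u' = A *m u) &
      forall x, exists (U : set M) (s : M -> 'M[R]_m),
        [/\ open U, U x, smooth_rows U s & forall y, U y -> P y (s y)]].

(* The line spanned by the model form b, carried to T_x M by the frames in P;
   well defined if the structure group preserves b up to scale. *)
Definition induced_line (P : M -> set 'M[R]_m)
    (b : 'rV[R]_m -> 'rV[R]_m -> R) (x : M) : set 'M[R]_m :=
  [set B | exists (u : 'M[R]_m) (t : R), P x u /\
     forall v w, bil B (v *m u) (w *m u) = t * b v w].

Definition almost_complex (J : M -> 'M[R]_m) : Prop :=
  smooth_endo setT J /\ forall x, J x *m J x = - 1%:M.

Definition almost_hermitian (J g : 'M[R]_m) : Prop :=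
  [/\ symmetric g, nondegenerate g &
      forall v w, bil g (v *m J) (w *m J) = bil g v w].

Definition conformal_hermitian_class (p q : nat)
    (J : M -> 'M[R]_m) (c : M -> set 'M[R]_m) : Prop :=
  almost_complex J /\
  line_subbundle_spanned_by
    (fun x g => almost_hermitian (J x) g /\ signature (2 * p) (2 * q) g) c.

Definition almost_para_hermitian (E F : set 'rV[R]_m) (g : 'M[R]_m) : Prop :=
  [/\ symmetric g, nondegenerate g, isotropic g E & isotropic g F].

Definition conformal_para_hermitian_class (n : nat)
    (E F : M -> set 'rV[R]_m) (c : M -> set 'M[R]_m) : Prop :=
  [/\ subbundle n E, subbundle n F, forall x, direct_sum (E x) (F x) &
      line_subbundle_spanned_by
        (fun x g => almost_para_hermitian (E x) (F x) g) c].

Section Kahler.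
(* K is J, respectively the para-complex structure of E (+) F *)
Variables (c : M -> set 'M[R]_m) (K : M -> 'M[R]_m).

Definition fundamental (g : M -> 'M[R]_m) (x : M) : 'M[R]_m :=
  fundamental_form (g x) (K x).

Definition kahler_metric_in_class (U : set M) (g : M -> 'M[R]_m) : Prop :=
  nonvanishing_section c U g /\ closed_form U (fundamental g).

Definition spanned_by_fundamental_forms (l : M -> set 'M[R]_m) : Prop :=
  forall U g, nonvanishing_section c U g ->
    forall x, U x -> l x = [set t *: fundamental g x | t in [set: R]].

Definition locally_contains_kahler : Prop :=
  forall x, exists U g, U x /\ kahler_metric_in_class U g.

Definition kahler_locally_unique : Prop :=
  forall U g g', kahler_metric_in_class U g -> kahler_metric_in_class U g' ->
    forall x, U x -> exists (W : set M) (k : R),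
      [/\ open W, W x, W `<=` U, k != 0 & forall y, W y -> g' y = k *: g y].

End Kahler.

End Structures.

Section KahlerModel.
Variables (R : realType) (n : nat).

(* C^n as a real vector space: x + i y is the row (x, y) of R^(n + n). *)
Definition cvec (v : 'rV[R]_(n + n)) : 'rV[R[i]]_n :=
  \row_j Complex (lsubmx v 0 j) (rsubmx v 0 j).

Definition rvec (z : 'rV[R[i]]_n) : 'rV[R]_(n + n) :=
  row_mx (map_mx (@complex.Re R) z) (map_mx (@complex.Im R) z).

Definition cscale (a : R[i]) (v : 'rV[R]_(n + n)) : 'rV[R]_(n + n) :=
  rvec (a *: cvec v).

(* conjugate linear in z, linear in w *)
Definition hform (h : 'M[R[i]]_n) (z w : 'rV[R[i]]_n) : R[i] :=
  (map_mx (@conjc R) z *m h *m w^T) 0 0.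

Definition hermitian_form (p q : nat) (h : 'M[R[i]]_n) : Prop :=
  [/\ forall z w, hform h w z = conjc (hform h z w), (p + q)%N = n &
      exists2 A : 'M[R[i]]_n, A \in unitmx &
        map_mx (@conjc R) A *m h *m A^T = sign_mx R[i] n p].

Definition re_form (h : 'M[R[i]]_n) (v w : 'rV[R]_(n + n)) : R :=
  complex.Re (hform h (cvec v) (cvec w)).

Definition im_form (h : 'M[R[i]]_n) (v w : 'rV[R]_(n + n)) : R :=
  complex.Im (hform h (cvec v) (cvec w)).

Definition kahler_group (h : 'M[R[i]]_n) : set 'M[R]_(n + n) :=
  [set A | CSp (im_form h) A /\
     forall (a : R[i]) v, cscale a v *m A = cscale a (v *m A)].

Variable M : manifold R (n + n).

(* The frames in P carry multiplication by i to J and the real part of the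
   Hermitian form h to the metrics in c. *)
Definition kahler_correspondence (h : 'M[R[i]]_n)
    (P : M -> set 'M[R]_(n + n))
    (Jc : (M -> 'M[R]_(n + n)) * (M -> set 'M[R]_(n + n))) : Prop :=
  (forall x u, P x u ->
     forall v, cscale (Complex 0 1) v *m u = v *m u *m Jc.1 x) /\
  (forall x, Jc.2 x = induced_line P (re_form h) x).

End KahlerModel.

Section ParaKahlerModel.
Variables (R : realType) (n : nat).
Implicit Types (b : 'M[R]_(n + n)) (VE VF : 'M[R]_(n, n + n)).

(* V^E and V^F are the row spaces of VE and VF. *)
Definition para_kahler_model b VE VF : Prop :=
  [/\ skew b, nondegenerate b, row_free VE /\ row_free VF,
      direct_sum (row_space VE) (row_space VF) &
      isotropic b (row_space VE) /\ isotropic b (row_space VF)].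

Definition para_kahler_group b VE VF : set 'M[R]_(n + n) :=
  [set A | [/\ CSp (bil b) A, stablemx VE A & stablemx VF A]].

(* The metric on V whose fundamental two-form is b: if K is id on V^E and
   - id on V^F, then g = - b(., K .) is equivalent to b = - g(., K .). *)
Definition para_model_metric b VE VF (v w : 'rV[R]_(n + n)) : R :=
  - bil b v (w *m para_complex (row_space VE) (row_space VF)).

Variable M : manifold R (n + n).

(* The frames in P carry V^E to E, V^F to F and the model metric to the
   metrics in c. *)
Definition para_kahler_correspondence b VE VF
    (P : M -> set 'M[R]_(n + n))
    (EFc : (M -> set 'rV[R]_(n + n)) * (M -> set 'rV[R]_(n + n)) *
           (M -> set 'M[R]_(n + n))) : Prop :=
  (forall x u, P x u -> EFc.1.1 x = row_space (VE *m u) /\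
                        EFc.1.2 x = row_space (VF *m u)) /\
  (forall x, EFc.2 x = induced_line P (para_model_metric b VE VF) x).

End ParaKahlerModel.

(* Main.v *)
Require Import Defs.
From mathcomp Require Import all_boot all_order all_algebra.
From mathcomp Require Import all_classical all_reals all_analysis.
From mathcomp Require Import complex ring zify.

(** The two types of structure are instances of one situation. The model
    space carries an endomorphism [K0] with [K0 ^ 2 = eps], where [eps] is -1
    in the Hermitian and 1 in the para-Hermitian case, and a symmetric form
    [G0] with [K0 G0 K0^T = - eps G0]; the structure group consists of the
    automorphisms that commute with [K0] and preserve [G0] up to scale. Since
    [b = - G0 (., K0 .)] and [K0] is invertible, preserving [b] up to scale
    is the same condition.

    A frame carries [K0] to an endomorphism of the tangent space and [G0] to
    a bilinear form. Changing the frame by an element of the group fixes the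
    former and rescales the latter, so a structure induces a tensor [K] and a
    conformal class [c] ([pacs_tensor], [pacs_metric_line]). Conversely, the
    frames that carry [K0] to [K] and [G0] into [c] form a torsor under the
    group, hence a structure as soon as such frames exist locally and depend
    smoothly on the point ([pacs_structure_exists]). In the Hermitian case
    the latter is the Gram-Schmidt process over the complex numbers, started
    from a unitary basis at one point ([smooth_herm_orth]); that this basis
    has the prescribed signs is Sylvester's law of inertia
    ([exists_herm_basis]). In the para-Hermitian case it suffices to
    normalise the pairing between a frame of [E] and a frame of [F]
    ([para_local_frame]).

    Tangent vectors are given by components in a chart that may vary wildly
    with the point, so smoothness has to be read off in all charts. This
    rests on the chain rule for transition functions: the matrices [dchart]
    are invertible and every chart has a smooth coordinate frame
    ([coordinate_frame]). The chain rule in turn requires that continuity of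
    the directional derivatives implies differentiability
    ([C1_differentiable]).

    For the last part, frames carry [b] to [- g (., K .)], so the underlying
    line [l] is spanned by the fundamental forms, and [B] is the fundamental
    form of [- eps B (., K .)]; closed nowhere vanishing sections of [l]
    therefore correspond to the Kaehler metrics in the class. If [omega] and [f omega] are both
    closed, then [df /\ omega = 0]; evaluating on [u, v, w] with [v, w]
    orthogonal to [u] and [omega (v, w) <> 0], which exist in dimension
    greater than 2, gives [df (u) = 0] ([conformal_closed_derive]). *)

Set Implicit Arguments.
Unset Strict Implicit.
Unset Printing Implicit Defensive.

Import Order.TTheory GRing.Theory Num.Theory.
Import numFieldNormedType.Exports.

Local Open Scope classical_set_scope.
Local Open Scope ring_scope.

(** * Iterated directional derivatives *)

Section CkCalculus.
Variables (R : realType) (V : normedModType R).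
Implicit Types U : set V.

Lemma Ck_continuous (W : normedModType R) k U (f : V -> W) :
  Ck k U f -> forall x, U x -> {for x, continuous f}.
Proof. by case: k => [|k] []. Qed.

Lemma Ck_derivable (W : normedModType R) k U (f : V -> W) :
  Ck k.+1 U f -> forall v x, U x -> derivable f x v.
Proof. by move=> [_ /=] fU v x Ux; exact: (fU v).1. Qed.

Lemma Ck_derive (W : normedModType R) k U (f : V -> W) v :
  Ck k.+1 U f -> Ck k U (fun x => 'D_v f x).
Proof. by move=> [_ /=] fU; exact: (fU v).2. Qed.

Lemma CkS (W : normedModType R) k U (f : V -> W) : Ck k.+1 U f -> Ck k U f.
Proof.
elim: k f => [|k IH] f fU; first by split => //; exact: Ck_continuous fU.
split; first exact: Ck_continuous fU.
move=> v; split; first exact: Ck_derivable fU v.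
exact/IH/Ck_derive.
Qed.

Lemma Ck_subset (W : normedModType R) k U U' (f : V -> W) :
  U' `<=` U -> Ck k U f -> Ck k U' f.
Proof.
move=> sub; elim: k f => [|k IH] f [fc fd]; split => //.
- by move=> x /sub; exact: fc.
- by move=> x /sub; exact: fc.
- move=> v; have [fv1 fv2] := fd v; split; first by move=> x /sub; exact: fv1.
  exact: IH.
Qed.

(** Openness matters: a derivative at a point sees a whole neighbourhood. *)
Lemma Ck_ext (W : normedModType R) k U (f g : V -> W) :
  open U -> (forall x, U x -> f x = g x) -> Ck k U f -> Ck k U g.
Proof.
move: f g => f1 g1 oU.
have nE (f g : V -> W) x :
    (forall x, U x -> f x = g x) -> U x -> {near x, f =1 g}.
  move=> fg Ux; have : nbhs x U by apply: open_nbhs_nbhs.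
  by apply: filterS => y /fg.
have cE (f g : V -> W) : (forall x, U x -> f x = g x) ->
    (forall x, U x -> {for x, continuous f}) ->
    forall x, U x -> {for x, continuous g}.
  move=> fg fc x Ux; suff : g @ x --> g x by [].
  rewrite -(fg _ Ux).
  by apply: cvg_trans (fc _ Ux); apply: near_eq_cvg; exact: nE.
elim: k f1 g1 => [|k IH] f g fg [fc fd].
  by split => //; exact: cE fc.
split; first exact: cE fc.
move=> v; have [fv1 fv2] := fd v; split.
  by move=> x Ux; apply: (@near_eq_derivable _ _ _ f); [exact: nE|exact: fv1].
apply: IH fv2 => x Ux; apply: near_eq_derive. exact: (nE f).
Qed.

Lemma Ck_cst (W : normedModType R) k U (a : W) : Ck k U (fun=> a).
Proof.
elim: k a => [|k IH] a; split => //; try by move=> x _; exact: cvg_cst.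
move=> v; split; first by move=> x _; exact: derivable_cst.
suff -> : (fun x => 'D_v (fun=> a) x) = fun=> 0 by exact: IH.
by apply/funext => x; exact: derive_cst.
Qed.

Lemma CkD k U (f g : V -> R) : open U ->
  Ck k U f -> Ck k U g -> Ck k U (fun x => f x + g x).
Proof.
move=> oU; elim: k f g => [|k IH] f g Hf Hg.
  by split=> // x Ux; apply: cvgD; [exact: Ck_continuous Hf _ _|
                                    exact: Ck_continuous Hg _ _].
split.
  by move=> x Ux; apply: cvgD; [exact: Ck_continuous Hf _ _|
                                 exact: Ck_continuous Hg _ _].
move=> v; split.
  by move=> x Ux; apply: derivableD; [exact: Ck_derivable Hf _ _ _|
                                 exact: Ck_derivable Hg _ _ _].
apply: (@Ck_ext _ k U (fun x => 'D_v f x + 'D_v g x)) => //.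
  by move=> x Ux; rewrite deriveD //; [exact: Ck_derivable Hf _ _ _|
                                 exact: Ck_derivable Hg _ _ _].
by apply: IH; exact: Ck_derive.
Qed.

Lemma CkM k U (f g : V -> R) : open U ->
  Ck k U f -> Ck k U g -> Ck k U (fun x => f x * g x).
Proof.
move=> oU; elim: k f g => [|k IH] f g Hf Hg.
  by split=> // x Ux; apply: cvgM; [exact: Ck_continuous Hf _ _|
                                    exact: Ck_continuous Hg _ _].
split.
  by move=> x Ux; apply: cvgM; [exact: Ck_continuous Hf _ _|
                                 exact: Ck_continuous Hg _ _].
move=> v; split.
  by move=> x Ux; apply: derivableM; [exact: Ck_derivable Hf _ _ _|
                                 exact: Ck_derivable Hg _ _ _].
apply: (@Ck_ext _ k U (fun x => f x * 'D_v g x + g x * 'D_v f x)) => //.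
  by move=> x Ux; rewrite deriveM //; [exact: Ck_derivable Hf _ _ _|
                                 exact: Ck_derivable Hg _ _ _].
by apply: CkD => //; apply: IH; (try exact: Ck_derive); exact: CkS.
Qed.

Lemma CkV k U (f : V -> R) : open U -> (forall x, U x -> f x != 0) ->
  Ck k U f -> Ck k U (fun x => (f x)^-1).
Proof.
move=> oU f0; elim: k f f0 => [|k IH] f f0 Hf.
  by split=> // x Ux; apply: cvgV; [exact: f0|exact: Ck_continuous Hf _ _].
have Hf' := Ck_continuous Hf; have Hd := Ck_derivable Hf.
split; first by move=> x Ux; apply: cvgV; [exact: f0|exact: Hf'].
move=> v; split.
  by move=> x Ux; apply: derivableV; [exact: f0|exact: Hd].
apply: (@Ck_ext _ k U (fun x => -1 * ((f x)^-1 * (f x)^-1 * 'D_v f x))) => //.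
  move=> x Ux; rewrite deriveV; [|exact: f0|exact: Hd].
  by rewrite mulN1r scaleNr -exprVn expr2.
have CV := IH _ f0 (CkS Hf).
apply: CkM => //; first exact: Ck_cst.
by apply: CkM => //; [exact: CkM|exact: Ck_derive].
Qed.

(** Reduces directional derivatives to calculus in one variable. *)
Lemma is_derive_line (f : V -> R) x v (t : R) :
  derivable f (t *: v + x) v ->
  is_derive t 1 (fun h : R => f (h *: v + x)) ('D_v f (t *: v + x)).
Proof.
have E : (fun h : R => h^-1 *: (((fun h : R => f (h *: v + x)) \o shift t)
                                  (h *: 1) - f (t *: v + x))) =
    (fun h : R => h^-1 *: ((f \o shift (t *: v + x)) (h *: v)
                             - f (t *: v + x))).
  by apply/funext => h /=; rewrite [h *: 1]mulr1 scalerDl addrA.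
by move=> df; split; rewrite /derivable /derive E.
Qed.

Lemma derivable_sqrt (f : V -> R) x v : 0 < f x -> derivable f x v ->
  derivable (fun y => Num.sqrt (f y)) x v /\
  'D_v (fun y => Num.sqrt (f y)) x = (2 * Num.sqrt (f x))^-1 * 'D_v f x.
Proof.
move=> fx0 df.
pose F h := f (h *: v + x).
have x0 : 0 *: v + x = x by rewrite scale0r add0r.
have F0 : F 0 = f x by rewrite /F x0.
have dF : is_derive (0 : R) 1 F ('D_v f x).
  by rewrite -[X in 'D_v f X]x0; apply: is_derive_line; rewrite x0.
have s0 : is_derive (F 0) 1 Num.sqrt (2 * Num.sqrt (F 0))^-1.
  by rewrite F0; exact: is_derive1_sqrt.
have ds := @ex_derive _ _ _ _ _ _ _ s0.
have dF0 := @ex_derive _ _ _ _ _ _ _ dF.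
have dc : derivable (Num.sqrt \o F) 0 1.
  apply/derivable1_diffP; apply: differentiable_comp.
    exact: (derivable1_diffP _ _).1 dF0.
  exact: (derivable1_diffP _ _).1 ds.
have dsf : derivable (fun y => Num.sqrt (f y)) x v.
  exact/(derivable1P _ x v).2.
split=> //.
have := @is_derive_line (fun y => Num.sqrt (f y)) x v 0.
rewrite x0 => /(_ dsf) /(@derive_val _ _ _ _ _ _ _) <-.
rewrite -derive1E (_ : (fun h : R => _) = Num.sqrt \o F) //.
rewrite (derive1_comp dF0 ds) !derive1E F0.
by rewrite (@derive_val _ _ _ _ _ _ _ dF) derive_sqrt.
Qed.

Lemma Ck_sqrt k U (f : V -> R) : open U -> (forall x, U x -> 0 < f x) ->
  Ck k U f -> Ck k U (fun x => Num.sqrt (f x)).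
Proof.
move=> oU f0; elim: k f f0 => [|k IH] f f0 Hf.
  split=> // x Ux; apply: (@continuous_comp _ _ _ f Num.sqrt).
    exact: Ck_continuous Hf _ _.
  exact: sqrt_continuous.
have Hf' := Ck_continuous Hf; have Hd := Ck_derivable Hf.
split.
  move=> x Ux; apply: (@continuous_comp _ _ _ f Num.sqrt); first exact: Hf'.
  exact: sqrt_continuous.
move=> v; split.
  by move=> x Ux; have [] := derivable_sqrt (f0 _ Ux) (Hd v _ Ux).
apply: (@Ck_ext _ k U (fun x => (2 * Num.sqrt (f x))^-1 * 'D_v f x)) => //.
  by move=> x Ux; have [_ ->] := derivable_sqrt (f0 _ Ux) (Hd v _ Ux).
apply: CkM => //; last exact: Ck_derive.
apply: CkV => //.
  by move=> x Ux; rewrite mulf_neq0 // gt_eqF // sqrtr_gt0 f0.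
by apply: CkM => //; [exact: Ck_cst|exact: IH f0 (CkS Hf)].
Qed.

Lemma continuous_mxP m n (f : V -> 'M[R]_(m, n)) x :
  {for x, continuous f} <-> forall i j, {for x, continuous (fun y => f y i j)}.
Proof.
split=> [fc i j|fc].
  apply: (@continuous_comp _ _ _ f (fun M : 'M[R]_(m, n) => M i j)) => //.
  exact: coord_continuous.
apply/cvgrPdist_lt => e e0.
have H : \forall y \near x, forall ij : 'I_m * 'I_n,
    `|f x ij.1 ij.2 - f y ij.1 ij.2| < e.
  apply: filter_forall => -[i j] /=.
  by have /cvgrPdist_lt := fc i j; exact.
apply: filterS H => y H.
rewrite /Num.Def.normr/= mx_normrE; apply: bigmax_lt => // ij _.
by rewrite !mxE; exact: H.
Qed.

(** Reduces closure properties of matrix valued maps to those of scalar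
    functions. *)
Lemma Ck_mxP k U m n (f : V -> 'M[R]_(m, n)) : open U ->
  Ck k U f <-> forall i j, Ck k U (fun x => f x i j).
Proof.
move=> oU; elim: k f => [|k IH] f.
  split=> [[fc _] i j|fc].
    by split=> // x Ux; have /continuous_mxP := fc _ Ux; exact.
  split=> // x Ux; apply/continuous_mxP => i j.
  exact: (fc i j).1.
have D v x : derivable f x v -> forall i j,
    ('D_v f x) i j = 'D_v (fun y => f y i j) x.
  by move=> df i j; rewrite (derive_mx df) mxE.
split=> [Hf i j|Hf].
  split.
    by move=> x Ux; have /continuous_mxP := Ck_continuous Hf Ux; exact.
  move=> v; split.
    by move=> x Ux; have /derivable_mxP := Ck_derivable Hf (v := v) Ux; exact.
  have /IH/(_ i j) := Ck_derive v Hf.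
  apply: Ck_ext => // x Ux; apply: D; exact: Ck_derivable Hf _ _ _.
have dfx x v : U x -> derivable f x v.
  by move=> Ux; apply/derivable_mxP => i j; exact: Ck_derivable (Hf i j) _ _ _.
split.
  by move=> x Ux; apply/continuous_mxP => i j; exact: Ck_continuous (Hf i j) _ _.
move=> v; split; first by move=> x Ux; exact: dfx.
apply/IH => i j.
have := Ck_derive v (Hf i j).
by apply: Ck_ext => // x Ux; rewrite (D _ _ (dfx _ v Ux)).
Qed.

End CkCalculus.

Section SmoothCalculus.
Variables (R : realType) (V : normedModType R) (U : set V).
Hypothesis oU : open U.

Lemma smooth_ext (W : normedModType R) (f g : V -> W) :
  (forall x, U x -> f x = g x) -> smooth U f -> smooth U g.
Proof. by move=> fg Hf k; apply: Ck_ext (Hf k). Qed.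

Lemma smooth_cst (W : normedModType R) (a : W) : smooth U (fun=> a).
Proof. by move=> k; exact: Ck_cst. Qed.

Lemma smoothD (f g : V -> R) :
  smooth U f -> smooth U g -> smooth U (fun x => f x + g x).
Proof. by move=> Hf Hg k; exact: CkD. Qed.

Lemma smoothM (f g : V -> R) :
  smooth U f -> smooth U g -> smooth U (fun x => f x * g x).
Proof. by move=> Hf Hg k; exact: CkM. Qed.

Lemma smoothV (f : V -> R) : (forall x, U x -> f x != 0) ->
  smooth U f -> smooth U (fun x => (f x)^-1).
Proof. by move=> f0 Hf k; exact: CkV. Qed.

Lemma smooth_sqrt (f : V -> R) : (forall x, U x -> 0 < f x) ->
  smooth U f -> smooth U (fun x => Num.sqrt (f x)).
Proof. by move=> f0 Hf k; exact: Ck_sqrt. Qed.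

Lemma smooth_sum (I : Type) (r : seq I) (P : pred I) (f : I -> V -> R) :
  (forall i, smooth U (f i)) -> smooth U (fun x => \sum_(i <- r | P i) f i x).
Proof.
move=> Hf; elim: r => [|i r IH].
  by apply: (smooth_ext _ (@smooth_cst R 0)) => x _; rewrite big_nil.
case Pi : (P i); last first.
  by apply: smooth_ext IH => x _; rewrite big_cons Pi.
by apply: smooth_ext (smoothD (Hf i) IH) => x _; rewrite big_cons Pi.
Qed.

Lemma smooth_prod (I : Type) (r : seq I) (P : pred I) (f : I -> V -> R) :
  (forall i, smooth U (f i)) -> smooth U (fun x => \prod_(i <- r | P i) f i x).
Proof.
move=> Hf; elim: r => [|i r IH].
  by apply: (smooth_ext _ (@smooth_cst R 1)) => x _; rewrite big_nil.
case Pi : (P i); last first.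
  by apply: smooth_ext IH => x _; rewrite big_cons Pi.
by apply: smooth_ext (smoothM (Hf i) IH) => x _; rewrite big_cons Pi.
Qed.

Lemma smooth_mxP m n (f : V -> 'M[R]_(m, n)) :
  smooth U f <-> forall i j, smooth U (fun x => f x i j).
Proof.
split=> [Hf i j k|Hf k]; last by apply/Ck_mxP => // i j; exact: Hf.
by have /Ck_mxP := Hf k; exact.
Qed.

Lemma smooth_mulmx m n p (f : V -> 'M[R]_(m, n)) (g : V -> 'M[R]_(n, p)) :
  smooth U f -> smooth U g -> smooth U (fun x => f x *m g x).
Proof.
move=> /smooth_mxP Hf /smooth_mxP Hg; apply/smooth_mxP => i j.
apply: (@smooth_ext _ (fun x => \sum_k f x i k * g x k j)).
  by move=> x _; rewrite mxE.
by apply: smooth_sum => k; exact: smoothM.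
Qed.

Lemma smooth_addmx m n (f g : V -> 'M[R]_(m, n)) :
  smooth U f -> smooth U g -> smooth U (fun x => f x + g x).
Proof.
move=> /smooth_mxP Hf /smooth_mxP Hg; apply/smooth_mxP => i j.
apply: (@smooth_ext _ (fun x => f x i j + g x i j)).
  by move=> x _; rewrite mxE.
exact: smoothD.
Qed.

Lemma smooth_scalemx m n (t : V -> R) (f : V -> 'M[R]_(m, n)) :
  smooth U t -> smooth U f -> smooth U (fun x => t x *: f x).
Proof.
move=> Ht /smooth_mxP Hf; apply/smooth_mxP => i j.
apply: (@smooth_ext _ (fun x => t x * f x i j)).
  by move=> x _; rewrite mxE.
exact: smoothM.
Qed.

Lemma smooth_oppmx m n (f : V -> 'M[R]_(m, n)) :
  smooth U f -> smooth U (fun x => - f x).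
Proof.
move=> Hf; have := smooth_scalemx (@smooth_cst R^o (-1)) Hf.
by apply: smooth_ext => x _; rewrite scaleN1r.
Qed.

Lemma smooth_trmx m n (f : V -> 'M[R]_(m, n)) :
  smooth U f -> smooth U (fun x => (f x)^T).
Proof.
move=> /smooth_mxP Hf; apply/smooth_mxP => i j.
by apply: smooth_ext (Hf j i) => x _; rewrite mxE.
Qed.

Lemma smooth_det n (f : V -> 'M[R]_n) :
  smooth U f -> smooth U (fun x => \det (f x)).
Proof.
move=> /smooth_mxP Hf; rewrite /determinant; apply: smooth_sum => s.
by apply: smoothM; [exact: smooth_cst|exact: smooth_prod].
Qed.

(** By Cramer's rule, the entries are polynomials divided by the determinant. *)
Lemma smooth_invmx n (f : V -> 'M[R]_n) : (forall x, U x -> f x \in unitmx) ->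
  smooth U f -> smooth U (fun x => invmx (f x)).
Proof.
move=> fu Hf.
apply: (@smooth_ext _ (fun x => (\det (f x))^-1 *: \adj (f x))).
  by move=> x Ux; rewrite /invmx fu.
apply: smooth_scalemx.
  apply: smoothV; last exact: smooth_det.
  by move=> x Ux; rewrite -unitfE -unitmxE fu.
apply/smooth_mxP => i j.
apply: (@smooth_ext _ (fun x => (-1) ^+ (j + i) * \det (row' j (col' i (f x))))).
  by move=> x _; rewrite mxE.
apply: smoothM; first exact: smooth_cst.
apply: smooth_det; apply/smooth_mxP => k l; move/smooth_mxP: Hf => Hf.
by apply: smooth_ext (Hf (lift j k) (lift i l)) => x _; rewrite !mxE.
Qed.

End SmoothCalculus.

Lemma smooth_subset (R : realType) (V W : normedModType R) (U U' : set V)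
  (f : V -> W) : U' `<=` U -> smooth U f -> smooth U' f.
Proof. by move=> sub Hf k; exact: Ck_subset (Hf k). Qed.

Lemma smooth_derive (R : realType) (V W : normedModType R) (U : set V)
  (f : V -> W) v : smooth U f -> smooth U (fun x => 'D_v f x).
Proof. by move=> Hf k; exact: Ck_derive (Hf k.+1). Qed.

(** * The mean value theorem and differentiability *)

Section MeanValue.
Variables (R : realType) (V : normedModType R).

(** Allowing a negative [c] is what [C1_increment] calls for, where [c] is a
    coordinate of the increment. *)
Lemma MVT_line (f : V -> R) x v (c : R) :
  (forall t : R, `|t| <= `|c| -> derivable f (t *: v + x) v) ->
  exists2 t : R, `|t| <= `|c| &
    f (c *: v + x) - f x = 'D_v f (t *: v + x) * c.
Proof.
move=> df; pose F (h : R) := f (h *: v + x).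
have F0 : F 0 = f x by rewrite /F scale0r add0r.
have dF (t : R) : `|t| <= `|c| -> is_derive t 1 F ('D_v f (t *: v + x)).
  by move=> tc; apply: is_derive_line; exact: df.
have key (a b : R) : a < b ->
    (forall t : R, a <= t <= b -> `|t| <= `|c|) ->
    exists2 t : R, `|t| <= `|c| & F b - F a = 'D_v f (t *: v + x) * (b - a).
  move=> ab H; have [||t tab ->] := @MVT R F (fun t => 'D_v f (t *: v + x)) a b ab.
  - by move=> t; rewrite in_itv /= => /andP[at_ tb]; apply: dF; rewrite H // !ltW.
  - apply: derivable_within_continuous => t; rewrite in_itv /= => tab.
    exact: (@ex_derive _ _ _ _ _ _ _ (dF t (H _ tab))).
  - exists t => //; apply: H; move: tab; rewrite in_itv /= => /andP[at_ tb].
    by rewrite !ltW.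
rewrite -F0 -/(F c); have [c0|c0|->] := ltgtP c 0.
- have [|t tc E] := key c 0 c0; last first.
    by exists t => //; rewrite -opprB E; ring.
  by move=> t /andP[ct t0]; rewrite ler0_norm // ltr0_norm // lerN2.
- have [|t tc E] := key 0 c c0; last by exists t => //; rewrite E subr0.
  by move=> t /andP[t0 tc]; rewrite ger0_norm // gtr0_norm.
- by exists 0; rewrite ?normr0 // subrr mulr0.
Qed.

End MeanValue.

Section ContinuouslyDifferentiable.
Variable R : realType.

Lemma ler_mx_norm m n (v : 'M[R]_(m, n)) (c : R) : 0 <= c ->
  (forall i j, `|v i j| <= c) -> `|v| <= c.
Proof.
move=> c0 H; rewrite /Num.Def.normr/= mx_normrE; apply: bigmax_le => // ij _.
Qed.

Lemma ler_norm_entry m n (v : 'M[R]_(m, n)) i j : `|v i j| <= `|v|.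
Proof.
rewrite [leRHS]/Num.Def.normr/= mx_normrE.
exact: (le_bigmax _ (fun ij : 'I_m * 'I_n => `|v ij.1 ij.2|) (i, j)).
Qed.

Lemma differentiable_increment (V W : normedModType R) (f : V -> W)
    (df : {linear V -> W}) x : continuous df ->
  (forall e, 0 < e ->
     \forall h \near (0 : V), `|f (h + x) - f x - df h| <= e * `|h|) ->
  differentiable f x.
Proof.
move=> dfc H; have fE : f \o shift x = cst (f x) + df +o_ 0 id.
  apply/eqaddoP => e e0; apply: filterS (H e e0) => h.
  have -> // : (f \o shift x - (cst (f x) + df)) h = f (h + x) - f x - df h.
  by rewrite -addrA -opprD.
by apply/diff_locallyP; rewrite (diff_unique dfc fE).
Qed.

(** The increment is made one coordinate at a time, through the truncations
    [hk k] of [h]. Each step is an instance of the mean value theorem for a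
    partial derivative, which is almost constant near x. *)
Lemma C1_increment m (f : 'rV[R]_m -> R) (U : set 'rV[R]_m) x :
  open U -> U x -> Ck 1 U f -> forall e, 0 < e ->
  \forall h \near (0 : 'rV[R]_m),
    `|f (h + x) - f x - \sum_i h 0 i * 'D_(delta_mx 0 i) f x| <= e * `|h|.
Proof.
move=> oU Ux f1 e e0.
(* the error allowed in each of the m steps *)
pose e1 := e / m.+1%:R.
have e10 : 0 < e1 by rewrite divr_gt0.
have nU : nbhs x U by exact: open_nbhs_nbhs.
have nD : \forall y \near x, forall i,
    `|'D_(delta_mx 0 i) f x - 'D_(delta_mx 0 i) f y| < e1.
  have H := @filter_forall _ _ (fun (i : 'I_m) (y : 'rV[R]_m) =>
    `|'D_(delta_mx 0 i) f x - 'D_(delta_mx 0 i) f y| < e1) (nbhs x) _.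
  apply: H => i.
  have /= := Ck_continuous (Ck_derive (delta_mx 0 i) f1) Ux.
  by move/cvgrPdist_lt; exact.
have [d /= d0 Hd] := (nbhs_ballP _ _).1 (filterI nU nD).
have {}Hd k : `|k| < d -> U (k + x) /\ forall i,
    `|'D_(delta_mx 0 i) f x - 'D_(delta_mx 0 i) f (k + x)| < e1.
  move=> kd; apply: Hd; rewrite -ball_normE /= /ball_.
  by rewrite opprD addrA addrAC subrr add0r normrN.
apply/nbhs_ballP; exists d => //= h.
rewrite -ball_normE /= /ball_ sub0r normrN => hd.
pose hk k : 'rV[R]_m := \row_i (if (i < k)%N then h 0 i else 0).
have hkm : hk m = h by apply/rowP => i; rewrite mxE ltn_ord.
suff H k : (k <= m)%N ->
    `|f (hk k + x) - f x - \sum_(i < m | (i < k)%N) h 0 i * 'D_(delta_mx 0 i) f x|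
      <= k%:R * e1 * `|h|.
  have H' := H m (leqnn m); rewrite hkm in H'.
  rewrite (eq_bigl (fun i : 'I_m => (i < m)%N)) => [|i]; last by rewrite ltn_ord.
  apply: le_trans H' _; rewrite ler_wpM2r // /e1 mulrCA ler_piMr ?(ltW e0) //.
  by rewrite ler_pdivrMr // mul1r ler_nat.
elim: k => [_|k IH km].
  rewrite big_pred0 // !mul0r.
  have -> : hk 0 = 0 by apply/rowP => i; rewrite !mxE.
  by rewrite add0r !subrr normr0.
pose ik := Ordinal km.
have hkS : hk k.+1 = h 0 ik *: delta_mx 0 ik + hk k.
  apply/rowP => i; rewrite !mxE eqxx /= ltnS leq_eqVlt -[i == ik]/(nat_of_ord i == k).
  case: (eqVneq (nat_of_ord i) k) => [ek|nk] /=.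
    by rewrite ek ltnn mulr1 addr0; congr (h 0 _); apply: val_inj.
  by rewrite mulr0 add0r.
have small t : `|t| <= `|h 0 ik| -> `|t *: delta_mx 0 ik + hk k| < d.
  move=> tk; apply: le_lt_trans hd; apply: ler_mx_norm => // i j.
  rewrite !mxE !ord1 eqxx /= -[j == ik]/(nat_of_ord j == k).
  case: (eqVneq (nat_of_ord j) k) => [ek|nk] /=.
    rewrite ek ltnn mulr1 addr0.
    by apply: le_trans tk (ler_norm_entry _ _ _).
  rewrite mulr0 add0r; case: ifP => _; last by rewrite normr0.
  exact: ler_norm_entry.
have [|t tk E] := @MVT_line R _ f (hk k + x) (delta_mx 0 ik) (h 0 ik).
  move=> t tk; apply: (Ck_derivable f1); rewrite addrA.
  by have [] := Hd _ (small _ tk).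
rewrite (bigD1 ik) //= hkS -(addrA _ _ x).
rewrite (eq_bigl (fun i : 'I_m => (i < k)%N)) => [|i]; last first.
  rewrite -(inj_eq val_inj) /= ltnS leq_eqVlt.
  by case: (eqVneq (nat_of_ord i) k) => [->|_] /=; rewrite ?ltnn ?andbT ?andbF.
set S := \sum_(_ < _ | _) _ in IH *.
set a := f (_ + (hk k + x)) in E *.
have -> : a - f x - (h 0 ik * 'D_(delta_mx 0 ik) f x + S) =
    (f (hk k + x) - f x - S) + (a - f (hk k + x) - h 0 ik * 'D_(delta_mx 0 ik) f x).
  by ring.
apply: le_trans (ler_normD _ _) _.
rewrite -[k.+1]addn1 natrD !mulrDl mul1r; apply: lerD; first exact: IH (ltnW km).
rewrite E mulrC -mulrBr normrM mulrC; apply: ler_pM => //.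
  rewrite distrC addrA; apply: ltW.
  by have [_] := Hd _ (small _ tk); exact.
exact: ler_norm_entry.
Qed.

Lemma smooth_id (V : normedModType R) (U : set V) : smooth U id.
Proof.
case=> [|k]; first by split => // x _; exact: cvg_id.
split; first by move=> x _; exact: cvg_id.
move=> v; split; first by move=> x _; exact: derivable_id.
suff -> : (fun x : V => 'D_v id x) = fun=> v by exact: Ck_cst.
by apply/funext => x; exact: derive_id.
Qed.

(** The candidate for the differential is the matrix of partial derivatives;
    [C1_increment] for each component is the required estimate. *)
Lemma C1_differentiable m n (f : 'rV[R]_m -> 'rV[R]_n) (U : set 'rV[R]_m) x :
  open U -> U x -> Ck 1 U f -> differentiable f x.
Proof.
move=> oU Ux f1; pose J := \matrix_(i < m) 'D_(delta_mx 0 i) f x.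
pose df : {linear 'rV[R]_m -> 'rV[R]_n} := mulmxr J.
have dfc : continuous df.
  move=> y; have : smooth setT (fun h : 'rV[R]_m => h *m J).
    by apply: smooth_mulmx; [exact: openT|exact: smooth_id|exact: smooth_cst].
  by move=> /(_ 0%N)/Ck_continuous; exact.
apply: (differentiable_increment dfc) => e e0.
have H : \forall h \near (0 : 'rV[R]_m), forall j : 'I_n,
   `|f (h + x) 0 j - f x 0 j
     - \sum_i h 0 i * 'D_(delta_mx 0 i) (fun y => f y 0 j) x| <= e * `|h|.
  have H' := @filter_forall _ _ (fun (j : 'I_n) (h : 'rV[R]_m) =>
    `|f (h + x) 0 j - f x 0 j
     - \sum_i h 0 i * 'D_(delta_mx 0 i) (fun y => f y 0 j) x| <= e * `|h|)
    (nbhs (0 : 'rV[R]_m)) _.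
  apply: H' => j; apply: (@C1_increment _ (fun y => f y 0 j) U) => //.
  by have /Ck_mxP := f1; exact.
apply: filterS H => h H; apply: ler_mx_norm; first by rewrite mulr_ge0 // ltW.
move=> i j; rewrite !ord1.
have -> : (f (h + x) - f x - df h) 0 j = f (h + x) 0 j - f x 0 j
     - \sum_i h 0 i * 'D_(delta_mx 0 i) (fun y => f y 0 j) x.
  rewrite !mxE; congr (_ - _); apply: eq_bigr => k _; rewrite mxE derive_mx ?mxE //.
  exact: Ck_derivable f1 _ _ _.
exact: H.
Qed.

Lemma jacobianE m n (f : 'rV[R]_m -> 'rV[R]_n) U x (v : 'rV[R]_m) :
  open U -> U x -> smooth U f -> v *m 'J f x = 'D_v f x.
Proof.
move=> oU Ux fs; rewrite deriveEjacobian //; exact: C1_differentiable Ux (fs 1%N).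
Qed.

(** Where f is differentiable, the rows of the Jacobian are directional
    derivatives. *)
Lemma smooth_jacobian m n (f : 'rV[R]_m -> 'rV[R]_n) U :
  open U -> smooth U f -> smooth U (fun x => 'J f x).
Proof.
move=> oU fs; apply/smooth_mxP => // i j.
have /smooth_mxP := smooth_derive (delta_mx 0 i) fs => /(_ oU 0 j).
apply: smooth_ext => // x Ux.
by rewrite -(jacobianE _ oU Ux fs) -rowE mxE.
Qed.

Lemma jacobian_comp m n p (f : 'rV[R]_m -> 'rV[R]_n) (g : 'rV[R]_n -> 'rV[R]_p)
    U U' x : open U -> U x -> smooth U f -> open U' -> U' (f x) ->
  smooth U' g -> 'J (g \o f) x = 'J f x *m 'J g (f x).
Proof.
move=> oU Ux fs oU' Ufx gs.
have df := C1_differentiable oU Ux (fs 1%N).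
have dg := C1_differentiable oU' Ufx (gs 1%N).
apply/row_matrixP => i; rewrite !rowE mulmxA.
have dgf : differentiable (g \o f) x by exact: differentiable_comp.
rewrite -(deriveEjacobian _ dgf) -(deriveEjacobian _ df) -(deriveEjacobian _ dg).
by rewrite (deriveE _ dgf) (deriveE _ df) (deriveE _ dg) diff_comp.
Qed.

Lemma jacobian_near m n (f g : 'rV[R]_m -> 'rV[R]_n) U x :
  open U -> U x -> (forall y, U y -> f y = g y) -> smooth U f ->
  'J f x = 'J g x.
Proof.
move=> oU Ux fg fs; have gs : smooth U g by apply: smooth_ext fs.
have H (v : 'rV[R]_m) : v *m 'J f x = v *m 'J g x.
  have Ef := jacobianE v oU Ux fs.
  have Eg := jacobianE v oU Ux gs.
  have nE : {near x, f =1 g}.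
    have : nbhs x U by exact: open_nbhs_nbhs.
    by apply: filterS => y /fg.
  exact: etrans Ef (etrans (near_eq_derive v nE) (esym Eg)).
apply/row_matrixP => i.
exact: etrans (rowE _ _) (etrans (H _) (esym (rowE _ _))).
Qed.

Lemma jacobian_id m (x : 'rV[R]_m) : 'J (id : 'rV[R]_m -> 'rV[R]_m) x = 1%:M.
Proof.
apply/row_matrixP => i; rewrite row1; apply: etrans (rowE _ _) _.
apply: etrans (jacobianE _ openT _ _) (derive_id _ _) => //; exact: smooth_id.
Qed.

End ContinuouslyDifferentiable.

(** * Charts, coordinate frames and smooth tensors *)

Lemma invmx_mul (F : comUnitRingType) n (A B : 'M[F]_n) :
  A \in unitmx -> B \in unitmx -> invmx (A *m B) = invmx B *m invmx A.
Proof.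
move=> Au Bu; have ABu : A *m B \in unitmx by rewrite unitmx_mul Au.
by rewrite -[RHS](mulmxK ABu) mulmxA mulmxKV // mulVmx // mul1mx.
Qed.

Section Manifold.
Variables (R : realType) (m : nat) (M : manifold R m).
Implicit Types (c d : chart R m M) (U : set M) (x y : M).

Lemma cmap_continuous_at c x : cdom c x -> {for x, continuous (cmap c)}.
Proof.
move=> cx; have := @cmap_continuous _ _ _ c.
rewrite continuous_open_subspace; last exact: cdom_open.
by move/(_ x); apply; rewrite inE.
Qed.

Lemma cinv_continuous_at c z : (cmap c @` cdom c) z ->
  {for z, continuous (cinv c)}.
Proof.
move=> cz; have := @cinv_continuous _ _ _ c.
rewrite continuous_open_subspace; last exact: cimg_open.
by move/(_ z); apply; rewrite inE.
Qed.

Lemma open_chart_image c U : open U -> open (cmap c @` (cdom c `&` U)).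
Proof.
move=> oU; rewrite openE => _ [x [cx Ux] <-]; rewrite /interior /=.
have cz : (cmap c @` cdom c) (cmap c x) by exists x.
have nD : nbhs (cmap c x) (cmap c @` cdom c).
  by apply: open_nbhs_nbhs; split=> //; exact: cimg_open.
have nU : nbhs (cmap c x) (cinv c @^-1` U).
  apply: (cinv_continuous_at cz); rewrite cmapK //.
  by apply: open_nbhs_nbhs; split.
apply: filterS (filterI nD nU) => _ [[y cy <-] /=]; rewrite cmapK // => Uy.
by exists y.
Qed.

Lemma nbhs_chart_preimage c x W : cdom c x -> nbhs (cmap c x) W ->
  nbhs x (cdom c `&` cmap c @^-1` W).
Proof.
move=> cx nW; apply: filterI; last exact: (cmap_continuous_at cx).
by apply: open_nbhs_nbhs; split=> //; exact: cdom_open.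
Qed.

(** The chain rule, on the open set where all three charts are defined. *)
Lemma jacobian_transition_comp c d e x : atlas c -> atlas d -> atlas e ->
  cdom c x -> cdom d x -> cdom e x ->
  'J (cmap d \o cinv c) (cmap c x) *m 'J (cmap e \o cinv d) (cmap d x) =
  'J (cmap e \o cinv c) (cmap c x).
Proof.
move=> ac ad ae cx dx ex.
have oO : open (cmap c @` (cdom c `&` (cdom d `&` cdom e))).
  by apply: open_chart_image; apply: openI; exact: cdom_open.
have Ox : (cmap c @` (cdom c `&` (cdom d `&` cdom e))) (cmap c x) by exists x.
have scd : smooth (cmap c @` (cdom c `&` (cdom d `&` cdom e))) (cmap d \o cinv c).
  apply: smooth_subset (atlas_compatible ac ad).
  by move=> _ [y [cy [dy ey]] <-]; exists y.
have sce : smooth (cmap c @` (cdom c `&` (cdom d `&` cdom e))) (cmap e \o cinv c).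
  apply: smooth_subset (atlas_compatible ac ae).
  by move=> _ [y [cy [dy ey]] <-]; exists y.
have E : (cmap d \o cinv c) (cmap c x) = cmap d x by rewrite /= cmapK.
rewrite -E -(jacobian_comp oO Ox scd _ _ (atlas_compatible ad ae)).
- apply/esym/(jacobian_near oO Ox) => //.
  by move=> _ [y [cy [dy ey]] <-] /=; rewrite !cmapK.
- by apply: open_chart_image; exact: cdom_open.
- by rewrite E; exists x.
Qed.

Lemma jacobian_transition_id c x : cdom c x ->
  'J (cmap c \o cinv c) (cmap c x) = 1%:M.
Proof.
move=> cx; rewrite -(jacobian_id (cmap c x)); apply/esym.
apply: (@jacobian_near _ _ _ _ _ (cmap c @` cdom c)).
- exact: cimg_open.
- by exists x.
- by move=> _ [y cy <-] /=; rewrite cmapK.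
- exact: smooth_id.
Qed.

Lemma dchart_transition c d x : atlas c -> atlas d -> cdom c x -> cdom d x ->
  dchart d x = dchart c x *m 'J (cmap d \o cinv c) (cmap c x).
Proof.
move=> ac ad cx dx; rewrite /dchart jacobian_transition_comp //.
- exact: chart_at_atlas.
- exact: chart_at_dom.
Qed.

(** In the preferred chart itself the Jacobian is the identity, so the
    transition from c to that chart provides an inverse. *)
Lemma dchart_unit c x : atlas c -> cdom c x -> dchart c x \in unitmx.
Proof.
move=> ac cx.
have H := dchart_transition ac (chart_at_atlas x) cx (chart_at_dom x).
have E : dchart (chart_at x) x = 1%:M := jacobian_transition_id (chart_at_dom x).
exact: (mulmx1_unit (etrans (esym H) E)).1.
Qed.

(** Values of f do not refer to the tangent spaces, so [dchart] does not enter. *)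
Definition smooth_map (W : normedModType R) U (f : M -> W) : Prop :=
  forall c, atlas c -> smooth (cmap c @` (cdom c `&` U)) (f \o cinv c).

Section SmoothMaps.
Variable U : set M.
Hypothesis oU : open U.
Let oO c : open (cmap c @` (cdom c `&` U)) := @open_chart_image c U oU.

Lemma smooth_map_cst (W : normedModType R) (a : W) : smooth_map U (fun=> a).
Proof. by move=> c ac; exact: smooth_cst. Qed.

Lemma smooth_map_subset (W : normedModType R) U' (f : M -> W) :
  U `<=` U' -> smooth_map U' f -> smooth_map U f.
Proof.
move=> sub Hf c ac; apply: smooth_subset (Hf c ac).
by move=> _ [y [cy /sub Uy] <-]; exists y.
Qed.

Lemma smooth_map_mulmx k l p (f : M -> 'M[R]_(k, l)) (g : M -> 'M[R]_(l, p)) :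
  smooth_map U f -> smooth_map U g -> smooth_map U (fun x => f x *m g x).
Proof.
move=> Hf Hg c ac; apply: (@smooth_mulmx _ _ _ (@oO c) _ _ _ (f \o cinv c) (g \o cinv c)).
- exact: Hf.
- exact: Hg.
Qed.

Lemma smooth_map_trmx k l (f : M -> 'M[R]_(k, l)) :
  smooth_map U f -> smooth_map U (fun x => (f x)^T).
Proof.
move=> Hf c ac; apply: (@smooth_trmx _ _ _ (@oO c) _ _ (f \o cinv c)).
exact: Hf.
Qed.

Lemma smooth_map_addmx k l (f g : M -> 'M[R]_(k, l)) :
  smooth_map U f -> smooth_map U g -> smooth_map U (fun x => f x + g x).
Proof.
move=> Hf Hg c ac; apply: (@smooth_addmx _ _ _ (@oO c) _ _ (f \o cinv c) (g \o cinv c)).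
- exact: Hf.
- exact: Hg.
Qed.

Lemma smooth_map_oppmx k l (f : M -> 'M[R]_(k, l)) :
  smooth_map U f -> smooth_map U (fun x => - f x).
Proof.
move=> Hf c ac; apply: (@smooth_oppmx _ _ _ (@oO c) _ _ (f \o cinv c)).
exact: Hf.
Qed.

Lemma smooth_map_scalemx k l (t : M -> R) (f : M -> 'M[R]_(k, l)) :
  smooth_map U t -> smooth_map U f -> smooth_map U (fun x => t x *: f x).
Proof.
move=> Hf Hg c ac; apply: (@smooth_scalemx _ _ _ (@oO c) _ _ (t \o cinv c) (f \o cinv c)).
- exact: Hf.
- exact: Hg.
Qed.

Lemma smooth_map_invmx n (f : M -> 'M[R]_n) :
  (forall x, U x -> f x \in unitmx) ->
  smooth_map U f -> smooth_map U (fun x => invmx (f x)).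
Proof.
move=> fu Hf c ac; apply: (@smooth_invmx _ _ _ (@oO c) _ (f \o cinv c)); last exact: Hf.
by move=> _ [y [cy Uy] <-] /=; rewrite cmapK // fu.
Qed.

Lemma smooth_map_entry k l (f : M -> 'M[R]_(k, l)) i j :
  smooth_map U f -> smooth_map U (fun x => f x i j).
Proof.
move=> Hf c ac; have /smooth_mxP := Hf c ac; apply.
exact: open_chart_image.
Qed.

Lemma smooth_mapM (f g : M -> R) :
  smooth_map U f -> smooth_map U g -> smooth_map U (fun x => f x * g x).
Proof.
move=> Hf Hg c ac; apply: (@smoothM _ _ _ (@oO c) (f \o cinv c) (g \o cinv c)).
- exact: Hf.
- exact: Hg.
Qed.

Lemma smooth_map_invsqrt (f : M -> R) : (forall x, U x -> 0 < f x) ->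
  smooth_map U f -> smooth_map U (fun x => (Num.sqrt (f x))^-1).
Proof.
move=> f0 Hf c ac; apply: (@smoothV _ _ _ (@oO c) (Num.sqrt \o (f \o cinv c))).
  by move=> _ [y [cy Uy] <-] /=; rewrite cmapK // gt_eqF // sqrtr_gt0 f0.
apply: (@smooth_sqrt _ _ _ (@oO c) (f \o cinv c)); last exact: Hf.
by move=> _ [y [cy Uy] <-] /=; rewrite cmapK // f0.
Qed.

(** Used to remain in the domain of square roots and inverses: a sign at a
    point persists nearby. *)
Lemma smooth_map_pos (f : M -> R) x : smooth_map U f -> U x -> 0 < f x ->
  exists U', [/\ open U', U' x, U' `<=` U & forall y, U' y -> 0 < f y].
Proof.
move=> Hf Ux fx; pose c := chart_at x; have cx : cdom c x := chart_at_dom x.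
have nP : nbhs x [set y | 0 < f y].
  have Hc := Hf c (chart_at_atlas x) 0%N.
  have Ox : (cmap c @` (cdom c `&` U)) (cmap c x) by exists x.
  have cf := Ck_continuous Hc Ox.
  have : nbhs (cmap c x) [set z | 0 < f (cinv c z)].
    apply: (cf [set t | 0 < t]); rewrite /= cmapK //.
    by apply: open_nbhs_nbhs; split; [exact: open_gt|].
  move=> /(nbhs_chart_preimage cx); apply: filterS => y [cy] /=.
  by rewrite cmapK.
have nU : nbhs x U by exact: open_nbhs_nbhs.
exists (interior ([set y | 0 < f y] `&` U)); split.
- exact: open_interior.
- exact: filterI.
- by move=> y /interior_subset[].
- by move=> y /interior_subset[].
Qed.

End SmoothMaps.

Section Tensors.
Variable U : set M.
Hypothesis oU : open U.

Let in_chart c z : atlas c -> (cmap c @` (cdom c `&` U)) z ->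
  dchart c (cinv c z) \in unitmx.
Proof. by move=> ac [y [cy Uy] <-]; rewrite cmapK // dchart_unit. Qed.

Lemma smooth_rows_subset k U' (s : M -> 'M[R]_(k, m)) :
  U `<=` U' -> smooth_rows U' s -> smooth_rows U s.
Proof.
move=> sub Hf c ac; apply: smooth_subset (Hf c ac).
by move=> _ [y [cy /sub Uy] <-]; exists y.
Qed.

Lemma smooth_form_subset U' (B : M -> 'M[R]_m) :
  U `<=` U' -> smooth_form U' B -> smooth_form U B.
Proof.
move=> sub Hf c ac; apply: smooth_subset (Hf c ac).
by move=> _ [y [cy /sub Uy] <-]; exists y.
Qed.

Lemma smooth_endo_subset U' (B : M -> 'M[R]_m) :
  U `<=` U' -> smooth_endo U' B -> smooth_endo U B.
Proof.
move=> sub Hf c ac; apply: smooth_subset (Hf c ac).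
by move=> _ [y [cy /sub Uy] <-]; exists y.
Qed.

Lemma smooth_rows_mul k l (A : M -> 'M[R]_(k, l)) (s : M -> 'M[R]_(l, m)) :
  smooth_map U A -> smooth_rows U s -> smooth_rows U (fun x => A x *m s x).
Proof.
move=> HA Hs c ac; have oO := open_chart_image (c := c) oU.
apply: smooth_ext (smooth_mulmx oO (HA _ ac) (Hs _ ac)) => // z _.
by rewrite /rows_in_chart /= mulmxA.
Qed.

Lemma smooth_rows_add k (s t : M -> 'M[R]_(k, m)) :
  smooth_rows U s -> smooth_rows U t -> smooth_rows U (fun x => s x + t x).
Proof.
move=> Hs Ht c ac; have oO := open_chart_image (c := c) oU.
apply: smooth_ext (smooth_addmx oO (Hs _ ac) (Ht _ ac)) => // z _.
by rewrite /rows_in_chart /= mulmxDl.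
Qed.

(** Here and in the next lemmas the matrices [dchart] cancel between objects
    of opposite variance, so that smoothness in charts of the given objects
    passes to the resulting one. *)
Lemma smooth_pairing k l (s : M -> 'M[R]_(k, m)) (t : M -> 'M[R]_(l, m))
    (B : M -> 'M[R]_m) :
  smooth_rows U s -> smooth_rows U t -> smooth_form U B ->
  smooth_map U (fun x => s x *m B x *m (t x)^T).
Proof.
move=> Hs Ht HB c ac; have oO := open_chart_image (c := c) oU.
have := smooth_mulmx oO (smooth_mulmx oO (Hs _ ac) (HB _ ac))
                        (smooth_trmx oO (Ht _ ac)).
apply: smooth_ext => // z Oz; rewrite /rows_in_chart /form_in_chart /=.
have Tu := in_chart ac Oz; set T := dchart c _ in Tu *.
have Tt : (invmx T)^T *m T^T = 1%:M by rewrite -trmx_mul mulmxV // trmx1.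
by rewrite trmx_mul !mulmxA mulmxK // -[_ *m _^T *m T^T]mulmxA Tt mulmx1.
Qed.

Lemma smooth_endo_in_frame (s K : M -> 'M[R]_m) :
  (forall x, U x -> s x \in unitmx) -> smooth_rows U s -> smooth_endo U K ->
  smooth_map U (fun x => s x *m K x *m invmx (s x)).
Proof.
move=> su Hs HK c ac; have oO := open_chart_image (c := c) oU.
have rT z : (cmap c @` (cdom c `&` U)) z -> rows_in_chart c s z \in unitmx.
  move=> Oz; rewrite unitmx_mul (in_chart ac Oz) andbT.
  by case: Oz => y [cy Uy] <-; rewrite cmapK // su.
have := smooth_mulmx oO (smooth_mulmx oO (Hs _ ac) (HK _ ac))
                        (smooth_invmx oO rT (Hs _ ac)).
apply: smooth_ext => // z Oz; rewrite /rows_in_chart /endo_in_chart /=.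
have Tu := in_chart ac Oz; set T := dchart c _ in Tu *.
have suz : s (cinv c z) \in unitmx.
  by case: Oz => y [cy Uy] <-; rewrite cmapK // su.
by rewrite invmx_mul // !mulmxA !mulmxK.
Qed.

Lemma smooth_endo_of_frame (s : M -> 'M[R]_m) (K : 'M[R]_m) :
  (forall x, U x -> s x \in unitmx) -> smooth_rows U s ->
  smooth_endo U (fun x => invmx (s x) *m K *m s x).
Proof.
move=> su Hs c ac; have oO := open_chart_image (c := c) oU.
have rT z : (cmap c @` (cdom c `&` U)) z -> rows_in_chart c s z \in unitmx.
  move=> Oz; rewrite unitmx_mul (in_chart ac Oz) andbT.
  by case: Oz => y [cy Uy] <-; rewrite cmapK // su.
have := smooth_mulmx oO (smooth_mulmx oO (smooth_invmx oO rT (Hs _ ac))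
          (@smooth_cst _ _ _ _ K)) (Hs _ ac).
apply: smooth_ext => // z Oz; rewrite /rows_in_chart /endo_in_chart /=.
have Tu := in_chart ac Oz; set T := dchart c _ in Tu *.
have suz : s (cinv c z) \in unitmx.
  by case: Oz => y [cy Uy] <-; rewrite cmapK // su.
by rewrite invmx_mul // !mulmxA.
Qed.

Lemma smooth_form_of_frame (s : M -> 'M[R]_m) (B : 'M[R]_m) :
  (forall x, U x -> s x \in unitmx) -> smooth_rows U s ->
  smooth_form U (fun x => invmx (s x) *m B *m (invmx (s x))^T).
Proof.
move=> su Hs c ac; have oO := open_chart_image (c := c) oU.
have rT z : (cmap c @` (cdom c `&` U)) z -> rows_in_chart c s z \in unitmx.
  move=> Oz; rewrite unitmx_mul (in_chart ac Oz) andbT.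
  by case: Oz => y [cy Uy] <-; rewrite cmapK // su.
have sI := smooth_invmx oO rT (Hs _ ac).
have := smooth_mulmx oO (smooth_mulmx oO sI (@smooth_cst _ _ _ _ B))
          (smooth_trmx oO sI).
apply: smooth_ext => // z Oz; rewrite /rows_in_chart /form_in_chart /=.
have Tu := in_chart ac Oz; set T := dchart c _ in Tu *.
have suz : s (cinv c z) \in unitmx.
  by case: Oz => y [cy Uy] <-; rewrite cmapK // su.
by rewrite invmx_mul // trmx_mul !mulmxA.
Qed.

Lemma smooth_form_endo (B K : M -> 'M[R]_m) (t : R) :
  smooth_form U B -> smooth_endo U K ->
  smooth_form U (fun x => t *: (B x *m (K x)^T)).
Proof.
move=> HB HK c ac; have oO := open_chart_image (c := c) oU.
have := smooth_scalemx oO (@smooth_cst _ _ _ R^o t)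
          (smooth_mulmx oO (HB _ ac) (smooth_trmx oO (HK _ ac))).
apply: smooth_ext => // z Oz; rewrite /endo_in_chart /form_in_chart /=.
have Tu := in_chart ac Oz; set T := dchart c _ in Tu *.
rewrite -scalemxAr -scalemxAl; congr (_ *: _).
rewrite !trmx_mul -!mulmxA; congr (_ *m (_ *m _)).
by rewrite !mulmxA -trmx_mul mulmxV // trmx1 mul1mx.
Qed.

End Tensors.

(** The rows of [invmx (dchart c y)] are the coordinate vector fields of the
    chart c at y. In another chart d they become the inverse Jacobian of the
    transition from d to c, which is smooth. *)
Lemma coordinate_frame x : exists (U : set M) (s : M -> 'M[R]_m),
  [/\ open U, U x, smooth_rows U s & forall y, U y -> s y \in unitmx].
Proof.
pose c := chart_at x; have ac : atlas c := chart_at_atlas x.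
exists (cdom c), (fun y => invmx (dchart c y)); split.
- exact: cdom_open.
- exact: chart_at_dom.
- move=> d ad.
  have oO : open (cmap d @` (cdom d `&` cdom c)).
    by apply: open_chart_image; exact: cdom_open.
  have sJ := smooth_jacobian oO (atlas_compatible ad ac).
  have Ju y : cdom d y -> cdom c y ->
      'J (cmap c \o cinv d) (cmap d y) \in unitmx.
    move=> dy cy; have := dchart_unit ac cy.
    by rewrite (dchart_transition ad ac dy cy) unitmx_mul => /andP[].
  apply: smooth_ext (smooth_invmx oO _ sJ) => //.
    move=> _ [y [dy cy] <-]; rewrite /rows_in_chart cmapK //.
    rewrite (dchart_transition ad ac dy cy) invmx_mul ?mulmxKV //.
    + exact: dchart_unit.
    + exact: dchart_unit.
    + exact: Ju.
  by move=> _ [y [dy cy] <-]; exact: Ju.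
- by move=> y cy; rewrite unitmx_inv dchart_unit.
Qed.

End Manifold.

Section Locality.
Variables (R : realType) (m : nat) (M : manifold R m).

(** The conditions in [Ck] are pointwise and concern derivatives of the total
    function f, so they can be checked on a cover. *)
Lemma Ck_local (V W : normedModType R) k (D : set V) (f : V -> W) :
  (forall x, D x -> exists2 O, O x & Ck k O f) -> Ck k D f.
Proof.
elim: k f => [|k IH] f H.
  by split=> // x /H[Q Qx Qf]; exact: Ck_continuous Qf _ _.
split; first by move=> x /H[Q Qx Qf]; exact: Ck_continuous Qf _ _.
move=> v; split; first by move=> x /H[Q Qx Qf]; exact: Ck_derivable Qf _ _ _.
by apply: IH => x /H[Q Qx Qf]; exists Q => //; exact: Ck_derive.
Qed.

Lemma smooth_endo_local (K : M -> 'M[R]_m) :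
  (forall x, exists2 U : set M, U x & smooth_endo U K) -> smooth_endo setT K.
Proof.
move=> H c ac k; apply: Ck_local => _ [x [cx _] <-].
have [U Ux sK] := H x; exists (cmap c @` (cdom c `&` U)); last exact: sK.
by exists x.
Qed.

Lemma smooth_endo_ext (U : set M) (K K' : M -> 'M[R]_m) : open U ->
  (forall x, U x -> K x = K' x) -> smooth_endo U K -> smooth_endo U K'.
Proof.
move=> oU E H c ac; apply: smooth_ext (H c ac); first exact: open_chart_image.
by move=> _ [x [cx Ux] <-]; rewrite /endo_in_chart /= cmapK // E.
Qed.

Lemma smooth_form_ext (U : set M) (B B' : M -> 'M[R]_m) : open U ->
  (forall x, U x -> B x = B' x) -> smooth_form U B -> smooth_form U B'.
Proof.
move=> oU E H c ac; apply: smooth_ext (H c ac); first exact: open_chart_image.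
by move=> _ [x [cx Ux] <-]; rewrite /form_in_chart /= cmapK // E.
Qed.

End Locality.

(** * Inertia and Hermitian bases *)

Section Inertia.
Variable R : realFieldType.

Lemma mx11_sqr_sum k (w : 'rV[R]_k) : (w *m w^T) 0 0 = \sum_i w 0 i ^+ 2.
Proof. by rewrite mxE; apply: eq_bigr => i _; rewrite mxE expr2. Qed.

Lemma mx11_sqr_ge0 k (w : 'rV[R]_k) : 0 <= (w *m w^T) 0 0.
Proof. by rewrite mx11_sqr_sum; apply: sumr_ge0 => i _; exact: sqr_ge0. Qed.

Lemma mx11_sqr_eq0 k (w : 'rV[R]_k) : (w *m w^T) 0 0 = 0 -> w = 0.
Proof.
rewrite mx11_sqr_sum => /eqP; rewrite psumr_eq0 => [/allP H|i _]; last first.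
  exact: sqr_ge0.
apply/rowP => i; rewrite mxE; apply/eqP.
by have := H i; rewrite mem_index_enum sqrf_eq0 => /(_ isT).
Qed.

(** The row spaces of U and V are positive and negative definite, hence meet
    only in 0. *)
Lemma inertia_bound m k l (G : 'M[R]_m) (U : 'M[R]_(k, m)) (V : 'M[R]_(l, m)) :
  U *m G *m U^T = 1%:M -> V *m G *m V^T = - 1%:M -> (k + l <= m)%N.
Proof.
move=> HU HV.
have rU : \rank U = k.
  apply/eqP; rewrite eqn_leq rank_leq_row /= -{1}(mxrank1 R k) -HU -mulmxA.
  exact: mxrankM_maxl.
have rV : \rank V = l.
  apply/eqP; rewrite eqn_leq rank_leq_row /= -{1}(mxrank1 R l).
  by rewrite -[1%:M]opprK -HV mxrank_opp -mulmxA mxrankM_maxl.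
have UV : (U :&: V)%MS = 0.
  apply/eqP/rowV0P => v; rewrite sub_capmx => /andP[/submxP[a ->] /submxP[b E]].
  suff -> : a = 0 by rewrite mul0mx.
  apply: mx11_sqr_eq0; apply/eqP; rewrite eq_le mx11_sqr_ge0 andbT.
  have -> : a *m a^T = (a *m U) *m G *m (a *m U)^T.
    by rewrite trmx_mul -!mulmxA (mulmxA G) (mulmxA U) (mulmxA U) HU mul1mx.
  rewrite E.
  have -> : (b *m V) *m G *m (b *m V)^T = - (b *m b^T).
    rewrite trmx_mul -!mulmxA (mulmxA G) (mulmxA V) (mulmxA V) HV.
    by rewrite mulNmx mul1mx mulmxN.
  by rewrite mxE oppr_le0 mx11_sqr_ge0.
by have := mxrank_sum_cap U V; rewrite UV mxrank0 addn0 rU rV => <-;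
  exact: rank_leq_col.
Qed.

End Inertia.

Section HermitianFrames.
Variable R : rcfType.

(** The rows of e are orthonormal up to the factors in D for the Hermitian
    form with real part G, multiplication by i being K. *)
Definition herm_orth k m (G K : 'M[R]_m) (D : 'M[R]_k) (e : 'M[R]_(k, m)) :=
  e *m G *m e^T = D /\ e *m G *m (e *m K)^T = 0.

Definition herm_frame k m (K : 'M[R]_m) (e : 'M[R]_(k, m)) : 'M[R]_(k + k, m) :=
  col_mx e (e *m K).

(** G is the real part of a Hermitian form for the complex structure K. *)
Definition herm_pair m (G K : 'M[R]_m) : Prop :=
  [/\ G^T = G, K *m K = - 1%:M & K *m G *m K^T = G].

Lemma herm_pair_anti m (G K : 'M[R]_m) : herm_pair G K ->
  G *m K^T = - (K *m G).
Proof.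
case=> _ KK KGK; rewrite -{1}KGK -mulmxA -trmx_mul KK.
by rewrite linearN /= trmx1 mulmxN mulmx1.
Qed.

Lemma gram_tr k l m (G : 'M[R]_m) (A : 'M[R]_(k, m)) (B : 'M[R]_(l, m)) :
  G^T = G -> (A *m G *m B^T)^T = B *m G *m A^T.
Proof. by move=> Gs; rewrite !trmx_mul trmxK Gs mulmxA. Qed.

Lemma herm_frame_gram k m (G K : 'M[R]_m) (D : 'M[R]_k) e : herm_pair G K ->
  herm_orth G K D e ->
  herm_frame K e *m G *m (herm_frame K e)^T = block_mx D 0 0 D.
Proof.
move=> HGK [eD e0]; have [Gs KK KGK] := HGK.
rewrite /herm_frame tr_col_mx mul_col_mx mul_col_row eD e0; congr block_mx.
  by rewrite -[LHS]trmxK (gram_tr _ _ Gs) e0 trmx0.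
by rewrite -eD -[in RHS]KGK trmx_mul !mulmxA.
Qed.

Lemma gram_rowsub k l k' l' m (G : 'M[R]_m) (A : 'M[R]_(k, m))
    (B : 'M[R]_(l, m)) (f : 'I_k' -> 'I_k) (g : 'I_l' -> 'I_l) :
  rowsub f A *m G *m (rowsub g B)^T = mxsub f g (A *m G *m B^T).
Proof.
apply/matrixP => i j; rewrite !mxE; apply: eq_bigr => r _; rewrite !mxE.
by congr (_ * _); apply: eq_bigr => t _; rewrite !mxE.
Qed.

Lemma herm_orth_rowsub k l m (G K : 'M[R]_m) (D : 'M[R]_k) e (f : 'I_l -> 'I_k) :
  herm_orth G K D e -> herm_orth G K (mxsub f f D) (rowsub f e).
Proof.
move=> [eD e0]; split; first by rewrite gram_rowsub eD.
have -> : rowsub f e *m K = rowsub f (e *m K).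
  by apply/matrixP => i j; rewrite !mxE; apply: eq_bigr => r _; rewrite !mxE.
by rewrite gram_rowsub e0 mxsub_const.
Qed.

(** A vector f is automatically orthogonal to i f, as [G K^T] is skew. *)
Lemma herm_orth_col k m (G K : 'M[R]_m) (D : 'M[R]_k) e (f : 'rV[R]_m) t :
  herm_pair G K -> herm_orth G K D e ->
  f *m G *m (herm_frame K e)^T = 0 -> f *m G *m f^T = t%:M ->
  herm_orth G K (block_mx t%:M 0 0 D : 'M[R]_(1 + k)) (col_mx f e).
Proof.
move=> HGK [eD e0] fF ft; have [Gs KK KGK] := HGK.
have GK := herm_pair_anti HGK.
move: fF; rewrite /herm_frame tr_col_mx mul_mx_row -[0]row_mx0.
move=> /eq_row_mx[fe feK].
have ef : e *m G *m f^T = 0.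
  by rewrite -[LHS]trmxK (gram_tr _ _ Gs) fe trmx0.
split.
  by rewrite tr_col_mx mul_col_mx mul_col_row ft eD fe ef.
rewrite (mul_col_mx f e K) (mul_col_mx f e G) tr_col_mx mul_col_row e0 feK.
have -> : f *m G *m (f *m K)^T = 0.
  have H : f *m G *m (f *m K)^T = - (f *m G *m (f *m K)^T)^T.
    rewrite (gram_tr _ _ Gs) trmx_mul -!mulmxA (mulmxA G) GK mulNmx mulmxN.
    by rewrite !mulmxA.
  move: H; move: (f *m G *m (f *m K)^T) => x H.
  apply/matrixP => i j; rewrite !ord1 [RHS]mxE.
  have : x 0 0 = - x 0 0 by rewrite {1}H !mxE.
  by move=> /eqP; rewrite -subr_eq0 opprK -mulr2n mulrn_eq0 /= => /eqP.
have -> : e *m G *m (f *m K)^T = 0.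
  rewrite trmx_mul -!mulmxA (mulmxA G) GK mulNmx mulmxN !mulmxA.
  by rewrite -[X in - X]trmxK (gram_tr _ _ Gs) feK trmx0 oppr0.
by rewrite -[RHS]block_mx_const.
Qed.

(** The projection step of the Gram-Schmidt process. The Gram matrix of the
    frame is its own inverse because [D] is. *)
Lemma herm_proj k m (G K : 'M[R]_m) (D : 'M[R]_k) e (v : 'rV[R]_m) :
  herm_pair G K -> herm_orth G K D e -> D *m D = 1%:M ->
  let F := herm_frame K e in
  (v - v *m G *m F^T *m block_mx D 0 0 D *m F) *m G *m F^T = 0.
Proof.
move=> HGK He DD F; rewrite !mulmxBl -!mulmxA.
rewrite [F *m (G *m F^T)]mulmxA (herm_frame_gram HGK He) mulmx_block.
by rewrite !mul0mx !mulmx0 !addr0 !add0r DD -scalar_mx_block mulmx1 subrr.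
Qed.

Lemma sign_mx_pos k a :
  sign_mx R (1 + k) a.+1 = block_mx 1%:M 0 0 (sign_mx R k a).
Proof.
rewrite /sign_mx.
have -> : (\row_(i < 1 + k) (-1) ^+ (a < i)%N : 'rV[R]_(1 + k)) =
    row_mx 1%:M (\row_i (-1) ^+ (a <= i)%N).
  apply/rowP => i; rewrite mxE; case: (splitP i) => j ij.
    have -> : i = lshift k j by apply: val_inj.
    by rewrite row_mxEl !mxE !ord1.
  have -> : i = rshift 1 j by apply: val_inj.
  by rewrite row_mxEr mxE /= add1n.
rewrite diag_mx_row; congr block_mx.
by apply/matrixP => i j; rewrite !ord1 !mxE.
Qed.

Lemma sign_mx_neg k :
  sign_mx R (1 + k) 0 = block_mx (-1)%:M 0 0 (sign_mx R k 0).
Proof.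
rewrite /sign_mx.
have -> : (\row_(i < 1 + k) (-1) ^+ (0 <= i)%N : 'rV[R]_(1 + k)) =
    row_mx (-1)%:M (\row_i (-1) ^+ (0 <= i)%N).
  apply/rowP => i; rewrite mxE; case: (splitP i) => j ij.
    have -> : i = lshift k j by apply: val_inj.
    by rewrite row_mxEl !mxE !ord1.
  have -> : i = rshift 1 j by apply: val_inj.
  by rewrite row_mxEr mxE /=.
rewrite diag_mx_row; congr block_mx.
by apply/matrixP => i j; rewrite !ord1 !mxE.
Qed.

Lemma sign_mx_sqr k a : sign_mx R k a *m sign_mx R k a = 1%:M.
Proof.
rewrite /sign_mx mulmx_diag -[1%:M]diag_const_mx; congr diag_mx.
by apply/rowP => i; rewrite !mxE -expr2 sqrr_sign.
Qed.

(** Some nonzero w is orthogonal to the frame, for dimension reasons. If all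
    vectors orthogonal to the frame were null, then w would be orthogonal to
    all of them by polarisation, hence, by [herm_proj], to the whole space. *)
Lemma exists_anisotropic k m (G K : 'M[R]_m) (D : 'M[R]_k) e :
  herm_pair G K -> G \in unitmx -> herm_orth G K D e -> D *m D = 1%:M ->
  (k + k < m)%N ->
  exists2 z : 'rV[R]_m, z *m G *m (herm_frame K e)^T = 0 &
    (z *m G *m z^T) 0 0 != 0.
Proof.
move=> HGK Gu He DD km; have [Gs KK KGK] := HGK; set F := herm_frame K e.
have [w w0 wF] : exists2 w : 'rV[R]_m, w != 0 & w *m G *m F^T = 0.
  have : kermx (G *m F^T) != 0.
    rewrite kermx_eq0 -row_leq_rank -ltnNge; apply: leq_ltn_trans km.
    exact: rank_leq_col.
  move=> /rowV0Pn[w wk w0]; exists w => //.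
  by rewrite -mulmxA; apply/sub_kermxP.
apply: contrapT => H; move/eqP: w0; apply.
have {}H (z : 'rV[R]_m) : z *m G *m F^T = 0 -> z *m G *m z^T = 0.
  move=> zF; apply/matrixP => i j; rewrite !ord1 [RHS]mxE; apply/eqP.
  by apply: contrapT => nz; apply: H; exists z => //; apply/negP.
have wz (z : 'rV[R]_m) : z *m G *m F^T = 0 -> w *m G *m z^T = 0.
  move=> zF; have := H (w + z); rewrite !mulmxDl wF zF addr0 => /(_ erefl).
  rewrite linearD /= !mulmxDr (H _ wF) (H _ zF) addr0 add0r.
  have -> : z *m G *m w^T = (w *m G *m z^T)^T.
    by rewrite (gram_tr _ _ Gs).
  move: (w *m G *m z^T) => x E; apply/matrixP => i j; rewrite !ord1 [RHS]mxE.
  move/matrixP/(_ 0 0): E; rewrite !mxE.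
  by move/eqP; rewrite -mulr2n mulrn_eq0 /= => /eqP.
have wG : w *m G = 0.
  apply/rowP => i; rewrite [RHS]mxE.
  pose v : 'rV[R]_m := delta_mx 0 i.
  have : w *m G *m v^T = 0.
    have /wz := herm_proj v HGK He DD; rewrite -/F linearB /= mulmxBr.
    rewrite [(_ *m F)^T]trmx_mul !mulmxA wF mul0mx subr0; exact.
  by rewrite /v trmx_delta -colE => /matrixP/(_ 0 0); rewrite [LHS]mxE [RHS]mxE.
by rewrite -[w](mulmxK Gu) wG mul0mx.
Qed.

Lemma normalize_row m (G : 'M[R]_m) (f : 'rV[R]_m) (eps : R) :
  eps * eps = 1 -> 0 < eps * (f *m G *m f^T) 0 0 ->
  let f' := (Num.sqrt (eps * (f *m G *m f^T) 0 0))^-1 *: f in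
  f' *m G *m f'^T = eps%:M.
Proof.
move=> e1 epos f'; set N := (f *m G *m f^T) 0 0 in epos f' *.
rewrite linearZ /= -scalemxAr -!scalemxAl.
have -> : f *m G *m f^T = N%:M by exact: mx11_scalar.
apply/matrixP => i j; rewrite !ord1 !mxE !mulr1n.
set s := Num.sqrt _; have s2 : s ^+ 2 = eps * N by rewrite sqr_sqrtr // ltW.
have s0 : s != 0 by rewrite gt_eqF // sqrtr_gt0.
have -> : N = eps * s ^+ 2 by rewrite s2 mulrA e1 mul1r.
by rewrite expr2; field.
Qed.

(** The choice is greedy: negative vectors are taken as long as there are any.
    As new vectors are put on top, the signs come out in the order prescribed
    by [sign_mx]. *)
Lemma exists_herm_orth k n (G K : 'M[R]_(n + n)) :
  herm_pair G K -> G \in unitmx -> (k <= n)%N ->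
  exists a (e : 'M[R]_(k, n + n)),
    [/\ (a <= k)%N, herm_orth G K (sign_mx R k a) e &
      a = 0%N \/ forall z : 'rV[R]_(n + n),
        z *m G *m (herm_frame K e)^T = 0 -> 0 <= (z *m G *m z^T) 0 0].
Proof.
move=> HGK Gu; elim: k => [|k IH] kn.
  by exists 0%N, 0; split; [|split; rewrite ?mul0mx //; apply/matrixP => -[]|left].
have [a [e [ak He Ha]]] := IH (ltnW kn).
have DD := sign_mx_sqr k a.
have sub (f z : 'rV[R]_(n + n)) :
    z *m G *m (herm_frame K (col_mx f e : 'M[R]_(1 + k, n + n)))^T = 0 ->
    z *m G *m (herm_frame K e)^T = 0.
  rewrite /herm_frame !tr_col_mx !mul_mx_row -[X in _ = X -> _]row_mx0.
  move=> /eq_row_mx[+ +]; rewrite -row_mx0 => /eq_row_mx[_ ->].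
  rewrite mul_col_mx tr_col_mx mul_mx_row -row_mx0 => /eq_row_mx[_ ->].
  by rewrite row_mx0.
have norm (z : 'rV[R]_(n + n)) eps : z *m G *m (herm_frame K e)^T = 0 ->
    eps * eps = 1 -> 0 < eps * (z *m G *m z^T) 0 0 ->
    exists f : 'rV[R]_(n + n), f *m G *m (herm_frame K e)^T = 0 /\ f *m G *m f^T = eps%:M.
  move=> zF e1 ez; exists ((Num.sqrt (eps * (z *m G *m z^T) 0 0))^-1 *: z).
  by split; [rewrite -!scalemxAl zF scaler0|exact: normalize_row].
have [[z [zF zneg]]|noneg] := pselect (exists z : 'rV[R]_(n + n),
    z *m G *m (herm_frame K e)^T = 0 /\ (z *m G *m z^T) 0 0 < 0).
  have a0 : a = 0%N.
    by case: Ha => // /(_ _ zF); rewrite leNgt zneg.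
  have [||f [fF fe]] := norm z (-1) zF; rewrite ?mulrNN ?mulr1 //.
    by rewrite mulN1r oppr_gt0.
  exists 0%N, (col_mx f e : 'M[R]_(1 + k, n + n)); split => //; last by left.
  rewrite -[k.+1]/(1 + k)%N sign_mx_neg; apply: herm_orth_col => //.
  by rewrite -a0.
have km : (k + k < n + n)%N by rewrite -addSn leq_add // ltnW.
have [z zF zne] := exists_anisotropic HGK Gu He DD km.
have [||f [fF fe]] := norm z 1 zF; rewrite ?mulr1 ?mul1r //.
  rewrite lt_neqAle eq_sym zne /= leNgt; apply/negP => zneg.
  by apply: noneg; exists z.
exists a.+1, (col_mx f e : 'M[R]_(1 + k, n + n)); split => //.
  by rewrite -[k.+1]/(1 + k)%N sign_mx_pos; exact: herm_orth_col.
right=> z' /sub zF'; rewrite leNgt; apply/negP => zneg.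
by apply: noneg; exists z'.
Qed.

End HermitianFrames.

(** Sylvester: the negative vectors of the Hermitian basis and the positive
    ones of the real basis in the signature satisfy [inertia_bound], and so do
    those of the opposite signs. The two bounds force the signs to agree. *)
Lemma exists_herm_basis (R : realType) p q (G K : 'M[R]_((p + q) + (p + q))) :
  herm_pair G K -> signature (2 * p) (2 * q) G ->
  exists e : 'M[R]_(p + q, (p + q) + (p + q)),
    herm_orth G K (sign_mx R (p + q) p) e.
Proof.
move=> HGK [_ [A Au HA]].
have SS := sign_mx_sqr R ((p + q) + (p + q)) (2 * p).
have Gu : G \in unitmx.
  have [+ _] := mulmx1_unit SS; rewrite -HA !unitmx_mul => /andP[/andP[_ ->]].
  by [].
have [a [e [an He _]]] := exists_herm_orth HGK Gu (leqnn (p + q)).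
suff pa : p = a by exists e; rewrite [X in sign_mx _ _ X]pa.
have sign_sub m P l (f : 'I_l -> 'I_m) (g : nat -> nat) b :
    (forall i, f i = g i :> nat) -> injective g ->
    (forall i, (P <= f i)%N = b) -> mxsub f f (sign_mx R m P) = ((-1) ^+ b)%:M.
  move=> fg gi fb; apply/matrixP => i j; rewrite !mxE fb.
  by rewrite -(inj_eq val_inj) /= !fg (inj_eq gi).
have sub l (f : 'I_l -> 'I_(p + q)) (g : nat -> nat) b :
    (forall i, f i = g i :> nat) -> injective g ->
    (forall i, (a <= f i)%N = b) ->
    exists U : 'M[R]_(l + l, (p + q) + (p + q)),
      U *m G *m U^T = ((-1) ^+ b)%:M.
  move=> fg gi fb; exists (herm_frame K (rowsub f e)).
  rewrite (herm_frame_gram HGK (herm_orth_rowsub f He)) (sign_sub _ _ _ f g b) //.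
  by rewrite -scalar_mx_block.
have subA l (f : 'I_l -> 'I_((p + q) + (p + q))) (g : nat -> nat) b :
    (forall i, f i = g i :> nat) -> injective g ->
    (forall i, (2 * p <= f i)%N = b) ->
    exists V : 'M[R]_(l, (p + q) + (p + q)), V *m G *m V^T = ((-1) ^+ b)%:M.
  move=> fg gi fb; exists (rowsub f A).
  by rewrite gram_rowsub HA (sign_sub _ _ _ f g b).
have addI k : injective (addn k) by exact: addnI.
apply/eqP; rewrite eqn_leq; apply/andP; split.
  have b1 (i : 'I_(p + q - a)) : (a + i < p + q)%N by have := ltn_ord i; lia.
  have b2 (i : 'I_(2 * p)) : (i < (p + q) + (p + q))%N by have := ltn_ord i; lia.
  have [|V HV] := sub _ (fun i => Ordinal (b1 i)) (addn a) true
    (fun=> erefl) (addI a).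
    by move=> i /=; rewrite leq_addr.
  have [|U HU] := subA _ (fun i => Ordinal (b2 i)) id false (fun=> erefl) (@inj_id nat).
    by move=> i /=; have := ltn_ord i; lia.
  rewrite expr1 raddfN /= in HV; rewrite expr0 in HU.
  by have := inertia_bound HU HV; lia.
have b1 (i : 'I_a) : (i < p + q)%N by have := ltn_ord i; lia.
have b2 (i : 'I_(2 * q)) : (2 * p + i < (p + q) + (p + q))%N.
  by have := ltn_ord i; lia.
have [|U HU] := sub _ (fun i => Ordinal (b1 i)) id false (fun=> erefl) (@inj_id nat).
  by move=> i /=; have := ltn_ord i; lia.
have [|V HV] := subA _ (fun i => Ordinal (b2 i)) (addn (2 * p)) true
  (fun=> erefl) (addI _).
  by move=> i /=; rewrite leq_addr.
rewrite expr1 raddfN /= in HV; rewrite expr0 in HU.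
by have := inertia_bound HU HV; lia.
Qed.

(** Counted over the reals each sign of the Hermitian form occurs twice, for e
    and for i e. *)
Lemma herm_basis_signature (R : realType) p q (G K : 'M[R]_((p + q) + (p + q))) e :
  herm_pair G K -> herm_orth G K (sign_mx R (p + q) p) e ->
  signature (2 * p) (2 * q) G.
Proof.
move=> HGK He; split; first by lia.
set n := (p + q)%N in G K e HGK He *.
(* the frame lists p plus and q minus signs twice; pi exchanges the two
   blocks in the middle *)
pose pi (i : nat) := if (i < p)%N then i else if (i < 2 * p)%N then (n + (i - p))%N
  else if (i < 2 * p + q)%N then (i - p)%N else i.
have pi_lt (i : 'I_(n + n)) : (pi i < n + n)%N.
  move: (ltn_ord i); move: (nat_of_ord i) => a; rewrite /pi /n.
  by case: (ltnP a p); case: (ltnP a (2 * p)); case: (ltnP a (2 * p + q)); lia.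
pose f (i : 'I_(n + n)) := Ordinal (pi_lt i).
have Hf : rowsub f (herm_frame K e) *m G *m (rowsub f (herm_frame K e))^T =
    sign_mx R (n + n) (2 * p).
  rewrite gram_rowsub (herm_frame_gram HGK He) /sign_mx -diag_mx_row.
  apply/matrixP => i j; rewrite !mxE -(inj_eq val_inj) /=.
  have -> : (pi i == pi j) = (i == j).
    rewrite -(inj_eq val_inj) /=; move: (ltn_ord i) (ltn_ord j).
    move: (nat_of_ord i) (nat_of_ord j) => a b; rewrite /pi /n => ha hb.
    apply/eqP/eqP => [|-> //].
    by case: (ltnP a p); case: (ltnP a (2 * p)); case: (ltnP a (2 * p + q));
      case: (ltnP b p); case: (ltnP b (2 * p)); case: (ltnP b (2 * p + q)); lia.
  congr (_ *+ _); move: (ltn_ord i).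
  case: splitP => k /= Hk Hi; rewrite mxE; congr ((-1) ^+ _);
    move: Hk Hi (ltn_ord k); move: (nat_of_ord i) (nat_of_ord k) => a b;
    rewrite /pi /n => Hk Hi Hb; congr nat_of_bool;
    move: Hk;
    by case: (ltnP a p); case: (ltnP a (2 * p)); case: (ltnP a (2 * p + q)); lia.
exists (rowsub f (herm_frame K e)) => //.
have [+ _] := mulmx1_unit (sign_mx_sqr R (n + n) (2 * p)).
by rewrite -Hf !unitmx_mul => /andP[/andP[-> _] _].
Qed.

(** * Smooth Gram-Schmidt process *)

Section SmoothGramSchmidt.
Variables (R : realType) (mdim : nat) (M : manifold R mdim).

Lemma smooth_map_col_mx (U : set M) k l m (f : M -> 'M[R]_(k, m))
    (g : M -> 'M[R]_(l, m)) : open U ->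
  smooth_map U f -> smooth_map U g -> smooth_map U (fun x => col_mx (f x) (g x)).
Proof.
move=> oU Hf Hg.
have -> : (fun x => col_mx (f x) (g x)) = (fun x =>
    col_mx 1%:M 0 *m f x + col_mx 0 1%:M *m g x).
  apply/funext => x; rewrite !mul_col_mx !mul1mx !mul0mx.
  by rewrite add_col_mx addr0 add0r.
by apply: smooth_map_addmx => //; apply: smooth_map_mulmx => //;
  exact: smooth_map_cst.
Qed.

(** Gram-Schmidt applied at each point to the constant rows of [e0]. At x it
    changes nothing, so near x the vectors to be normalised are still not null
    and keep their signs. *)
Lemma smooth_herm_orth (U : set M) m (G K : M -> 'M[R]_m) x :
  open U -> U x -> smooth_map U G -> smooth_map U K ->
  (forall y, U y -> herm_pair (G y) (K y)) ->
  forall n (d : 'rV[R]_n) (e0 : 'M[R]_(n, m)),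
  (forall i, d 0 i * d 0 i = 1) -> herm_orth (G x) (K x) (diag_mx d) e0 ->
  exists (U' : set M) (e : M -> 'M[R]_(n, m)),
    [/\ open U', U' x, U' `<=` U, smooth_map U' e & e x = e0 /\
        forall y, U' y -> herm_orth (G y) (K y) (diag_mx d) (e y)].
Proof.
move=> oU Ux sG sK HGK; elim=> [|n IH] d e0 d1 He0.
  exists U, (fun=> e0); split => //; first exact: smooth_map_cst.
  split=> // y _; split; first by apply/matrixP => -[].
  by apply/matrixP => -[].
rewrite -[n.+1]/(1 + n)%N in d e0 d1 He0 *.
pose dt : R := lsubmx d 0 0; pose d2 : 'rV[R]_n := rsubmx d.
have dE : diag_mx d = block_mx dt%:M 0 0 (diag_mx d2).
  rewrite -[d]hsubmxK diag_mx_row; congr block_mx.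
  by apply/matrixP => i j; rewrite !ord1 [LHS]mxE [RHS]mxE.
pose f0 : 'rV[R]_m := usubmx e0; pose e1 : 'M[R]_(n, m) := dsubmx e0.
have e0E : e0 = col_mx f0 e1 by rewrite vsubmxK.
have [f0f0 f0e1 e1e1 [f0Ke1 e1Ke1]] :
  [/\ f0 *m G x *m f0^T = dt%:M, f0 *m G x *m e1^T = 0,
      e1 *m G x *m e1^T = diag_mx d2 &
      f0 *m G x *m (e1 *m K x)^T = 0 /\ e1 *m G x *m (e1 *m K x)^T = 0].
  move: He0 => [H1 H2]; move: H1 H2;
  rewrite e0E dE (mul_col_mx f0 e1 (K x)) (mul_col_mx f0 e1 (G x)).
  rewrite !tr_col_mx !mul_col_row => /eq_block_mx[-> -> _ ->].
  by rewrite -[in X in X -> _](@block_mx0 R 1 n 1 n) => /eq_block_mx[_ -> _ ->].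
have d2_1 i : d2 0 i * d2 0 i = 1 by rewrite /d2 mxE.
have dt1 : dt * dt = 1 by rewrite /dt mxE.
have DD : diag_mx d2 *m diag_mx d2 = 1%:M.
  rewrite mulmx_diag -[1%:M]diag_const_mx; congr diag_mx.
  by apply/rowP => i; rewrite !mxE -[RHS](d2_1 i) !mxE.
have [U1 [e [oU1 U1x U1U se [ex He]]]] := IH d2 e1 d2_1 (conj e1e1 e1Ke1).
pose F y := herm_frame (K y) (e y).
pose w y := f0 - f0 *m G y *m (F y)^T *m block_mx (diag_mx d2) 0 0 (diag_mx d2) *m F y.
have sG1 : smooth_map U1 G by exact: smooth_map_subset sG.
have sK1 : smooth_map U1 K by exact: smooth_map_subset sK.
have sF : smooth_map U1 F.
  by apply: smooth_map_col_mx => //; exact: smooth_map_mulmx.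
have sw : smooth_map U1 w.
  apply: smooth_map_addmx => //; first exact: smooth_map_cst.
  apply: smooth_map_oppmx => //; do 2 apply: smooth_map_mulmx => //.
    apply: smooth_map_mulmx => //; last exact: smooth_map_trmx.
    by apply: smooth_map_mulmx => //; exact: smooth_map_cst.
  exact: smooth_map_cst.
pose N y := dt * (w y *m G y *m (w y)^T) 0 0.
have sN : smooth_map U1 N.
  apply: (@smooth_mapM _ _ _ _ oU1 (fun=> dt)); first exact: smooth_map_cst.
  apply: (@smooth_map_entry _ _ _ _ oU1 _ _ (fun y => w y *m G y *m (w y)^T)) => //.
  apply: smooth_map_mulmx => //; last exact: smooth_map_trmx.
  exact: smooth_map_mulmx.
have wx : w x = f0.
  rewrite /w /F /herm_frame ex tr_col_mx mul_mx_row f0e1 f0Ke1 row_mx0.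
  by rewrite !mul0mx subr0.
have Nx : 0 < N x by rewrite /N wx f0f0 mxE eqxx mulr1n dt1.
have [U2 [oU2 U2x U2U1 N0]] := smooth_map_pos oU1 sN U1x Nx.
exists U2, (fun y => col_mx ((Num.sqrt (N y))^-1 *: w y) (e y)); split => //.
- by move=> y /U2U1/U1U.
- apply: smooth_map_col_mx => //; last exact: smooth_map_subset se.
  apply: smooth_map_scalemx => //; last exact: smooth_map_subset sw.
  by apply: smooth_map_invsqrt => //; exact: smooth_map_subset sN.
- split; first by rewrite /N wx f0f0 mxE eqxx mulr1n dt1 sqrtr1 invr1 scale1r ex.
  move=> y U2y; rewrite dE; have U1y := U2U1 _ U2y; have Hy := He _ U1y.
  have HGKy := HGK _ (U1U _ U1y).
  apply: herm_orth_col => //.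
    rewrite -!scalemxAl; have := herm_proj f0 HGKy Hy DD.
    by rewrite -/(F y) -/(w y) => ->; rewrite scaler0.
  exact: (normalize_row dt1 (N0 _ U2y)).
Qed.

End SmoothGramSchmidt.

(** * Bilinear forms carried over by frames *)

Section Bilinear.
Variables (R : realType) (m : nat).
Implicit Types (B : 'M[R]_m) (u : 'M[R]_m).

Lemma bilE B (v w : 'rV[R]_m) : (v *m B *m w^T) 0 0 = bil B v w.
Proof. by []. Qed.

Lemma bil_delta B i j : bil B (delta_mx 0 i) (delta_mx 0 j) = B i j.
Proof. by rewrite /bil -rowE trmx_delta -colE !mxE. Qed.

Lemma bil_inj B B' : (forall v w, bil B v w = bil B' v w) -> B = B'.
Proof. by move=> H; apply/matrixP => i j; rewrite -!bil_delta H. Qed.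

Lemma bil_tr B v w : bil B^T v w = bil B w v.
Proof.
have E : (v *m B^T *m w^T) = (w *m B *m v^T)^T.
  by rewrite !trmx_mul trmxK mulmxA.
by rewrite /bil E mxE.
Qed.

Lemma bil_mul k B (A : 'M[R]_(k, m)) (v w : 'rV[R]_k) :
  bil B (v *m A) (w *m A) = (v *m (A *m B *m A^T) *m w^T) 0 0.
Proof. by rewrite /bil trmx_mul !mulmxA. Qed.

Lemma bilZ t B v w : bil (t *: B) v w = t * bil B v w.
Proof. by rewrite /bil -scalemxAr -scalemxAl mxE. Qed.

Lemma symmetric_trP B : Defs.symmetric B <-> B^T = B.
Proof.
split=> [H|H v w]; last by rewrite -{1}H bil_tr.
by apply: bil_inj => v w; rewrite bil_tr H.
Qed.

Lemma skew_trP B : Defs.skew B <-> B^T = - B.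
Proof.
have N v w : bil (- B) v w = - bil B v w.
  by rewrite -scaleN1r bilZ mulN1r.
split=> [H|H v w]; last by rewrite -N -H bil_tr.
by apply: bil_inj => v w; rewrite bil_tr N H.
Qed.

Lemma nondegenerate_unitP B : Defs.nondegenerate B <-> B \in unitmx.
Proof.
split=> [H|Bu v H].
  rewrite -row_free_unit -kermx_eq0; apply/rowV0P => v /sub_kermxP vB.
  by apply: H => w; rewrite /bil vB mul0mx mxE.
have vB : v *m B = 0.
  apply/rowP => j; rewrite [RHS]mxE -(H (delta_mx 0 j)) /bil trmx_delta -colE.
  by rewrite [RHS]mxE.
by rewrite -[v](mulmxK Bu) vB mul0mx.
Qed.

(** The bilinear form with Gram matrix C, carried over by the frame u. *)
Definition push u C : 'M[R]_m := invmx u *m C *m (invmx u)^T.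

Lemma pushK u C : u \in unitmx -> u *m push u C *m u^T = C.
Proof.
by move=> uu; rewrite /push !mulmxA mulmxV // mul1mx -mulmxA -trmx_mul mulmxV //
  trmx1 mulmx1.
Qed.

Lemma push_eq u B C : u \in unitmx -> u *m B *m u^T = C -> B = push u C.
Proof.
move=> uu <-; rewrite /push !mulmxA mulVmx // mul1mx -mulmxA -trmx_mul mulVmx //.
by rewrite trmx1 mulmx1.
Qed.

Lemma pushZ u t C : push u (t *: C) = t *: push u C.
Proof. by rewrite /push -scalemxAr -scalemxAl. Qed.

Lemma pushN u C : push u (- C) = - push u C.
Proof. by rewrite -[- C]scaleN1r pushZ scaleN1r. Qed.

Lemma push_mul A u C : A \in unitmx -> u \in unitmx ->
  push (A *m u) C = push u (push A C).
Proof. by move=> Au uu; rewrite /push invmx_mul // trmx_mul !mulmxA. Qed.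

Lemma push_neq0 u C : u \in unitmx -> C != 0 -> push u C != 0.
Proof.
move=> uu; apply: contra => /eqP E.
by rewrite -(pushK C uu) E mulmx0 mul0mx.
Qed.

Lemma push_unit u C : u \in unitmx -> C \in unitmx -> push u C \in unitmx.
Proof. by move=> uu Cu; rewrite !unitmx_mul unitmx_tr unitmx_inv uu Cu. Qed.

Lemma push_tr u C : (push u C)^T = push u C^T.
Proof. by rewrite /push !trmx_mul trmxK mulmxA. Qed.

Lemma push_invariant A C : A \in unitmx ->
  (exists t, A *m C *m A^T = t *: C) -> exists t, push A C = t *: C.
Proof.
move=> Au [t E]; have {}E : C = t *: push A C by rewrite -pushZ; exact: push_eq.
(* t vanishes only if C does *)
have [t0|t0] := eqVneq t 0; last first.
  by exists t^-1; rewrite {2}E scalerA mulVf // scale1r.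
exists 0; rewrite scale0r; have -> : C = 0 by rewrite E t0 scale0r.
by rewrite /push mulmx0 mul0mx.
Qed.

Definition line C : set 'M[R]_m := [set t *: C | t in [set: R]].

Lemma lineZ t C : t != 0 -> line (t *: C) = line C.
Proof.
move=> t0; apply/seteqP; split=> _ [s _ <-].
  by exists (s * t); rewrite ?scalerA.
by exists (s / t) => //; rewrite scalerA divfK.
Qed.

End Bilinear.

(** * Conformally related closed two-forms *)

Section SymplecticOrthogonal.
Variable R : realType.

(** Otherwise the orthogonal space of u, of dimension at least [m - 1], would
    be isotropic, and so [2 (m - 1) <= m]. *)
Lemma skew_orthogonal_pair m (B : 'M[R]_m) (u : 'rV[R]_m) :
  (2 < m)%N -> B^T = - B -> B \in unitmx ->
  exists v w, [/\ bil B u v = 0, bil B u w = 0 & bil B v w != 0].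
Proof.
move=> m2 Bs Bu; have Bsk := (skew_trP B).2 Bs.
pose N := kermx (B *m u^T).
have rN : (m.-1 <= \rank N)%N.
  rewrite mxrank_ker -subn1 leq_sub2l //.
  by apply: leq_trans (rank_leq_col _) _.
have Nu i : bil B u (row i N) = 0.
  rewrite Bsk /bil -mulmxA -row_mul.
  by rewrite mulmx_ker row0 mxE oppr0.
apply: contrapT => H.
have NBN : N *m B *m N^T = 0.
  apply/matrixP => i j.
  have -> : (N *m B *m N^T) i j = bil B (row i N) (row j N).
    rewrite /bil -row_mul [LHS]mxE [RHS]mxE; apply: eq_bigr => k _.
    by congr (_ * _); rewrite !mxE.
  rewrite [RHS]mxE; apply/eqP; apply: contrapT => /negP nz; apply: H.
  by exists (row i N), (row j N).
have := mulmx0_rank_max NBN.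
rewrite mxrank_tr mxrankMfree ?row_free_unit //.
by move: rN m2; move: (\rank N) => r; lia.
Qed.

End SymplecticOrthogonal.

Section ConformalClosed.
Variables (R : realType) (m : nat).

(** As om is closed, [d (phi om)] is the wedge product of [d phi] and om. On
    u and a pair v, w orthogonal to u, only the term with the derivative along
    u survives. *)
Lemma conformal_closed_derive (O : set 'rV[R]_m) (om om' : 'rV[R]_m -> 'M[R]_m)
    (phi : 'rV[R]_m -> R) : open O -> (2 < m)%N ->
  (forall z, O z -> (om z)^T = - om z /\ om z \in unitmx) ->
  smooth O om -> smooth O phi -> (forall z, O z -> om' z = phi z *: om z) ->
  (forall z, O z -> forall u v w, extd om z u v w = 0) ->
  (forall z, O z -> forall u v w, extd om' z u v w = 0) ->
  forall z, O z -> forall u, 'D_u phi z = 0.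
Proof.
move=> oO m2 Hom som sphi E cl cl' z Oz u.
have sb v w : smooth O (fun z => bil (om z) v w).
  have s1 : smooth O (fun z => v *m om z *m w^T).
    apply: smooth_mulmx => //; last exact: smooth_cst.
    by apply: smooth_mulmx => //; exact: smooth_cst.
  by have /smooth_mxP := s1; apply.
have D u' v w : 'D_u' (fun z => bil (om' z) v w) z =
    phi z * 'D_u' (fun z => bil (om z) v w) z + bil (om z) v w * 'D_u' phi z.
  have d1 := Ck_derivable (sb v w 1%N) (v := u') Oz.
  have d2 := Ck_derivable (sphi 1%N) (v := u') Oz.
  have nE : {near z, (fun z => bil (om' z) v w) =1 (phi * (fun z => bil (om z) v w))}.
    have : nbhs z O by exact: open_nbhs_nbhs.
    by apply: filterS => y Oy; rewrite E // bilZ.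
  exact: etrans (near_eq_derive u' nE) (deriveM d2 d1).
have [oms omu] := Hom _ Oz.
have [v [w [uv uw vw]]] := skew_orthogonal_pair u m2 oms omu.
have := cl' z Oz u v w; rewrite /extd !D uv uw !mul0r !addr0.
have := cl z Oz u v w; rewrite /extd => c0.
move=> H; have : bil (om z) v w * 'D_u phi z = 0.
  rewrite -[RHS]H -[LHS]add0r -(mulr0 (phi z)) -c0; ring.
by move/eqP; rewrite mulf_eq0 (negPf vw) /= => /eqP.
Qed.

Lemma derive0_constant (O : set 'rV[R]_m) (phi : 'rV[R]_m -> R) z r :
  (forall y, `|y - z| < r -> O y) -> smooth O phi ->
  (forall y, O y -> forall u, 'D_u phi y = 0) ->
  forall y, `|y - z| < r -> phi y = phi z.
Proof.
move=> Hr sphi D0 y yr.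
have inO (t : R) : `|t| <= `|1 : R| -> O (t *: (y - z) + z).
  move=> t1; apply: Hr; rewrite addrK normrZ.
  apply: le_lt_trans yr; rewrite ler_piMl //.
  by move: t1; rewrite normr1.
have [|t t1] := @MVT_line R _ phi z (y - z) 1.
  by move=> t t1; exact: Ck_derivable (sphi 1%N) _ _ (inO t t1).
rewrite D0; last exact: inO.
by rewrite mul0r scale1r subrK => /eqP; rewrite subr_eq0 => /eqP.
Qed.

End ConformalClosed.

(** * Structures preserving an endomorphism and a form up to scale *)

Section PacsStructures.
Variables (R : realType) (m : nat) (M : manifold R m).

Definition pacs_group (K0 G0 : 'M[R]_m) : set 'M[R]_m :=
  [set A | [/\ A \in unitmx, K0 *m A = A *m K0 &
              exists t, A *m G0 *m A^T = t *: G0]].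

(** The sign in the last condition makes [K0] an isometry of [G0] when it is a
    complex structure and an anti-isometry when it is a para-complex one. *)
Definition pacs_model (eps : R) (K0 G0 : 'M[R]_m) : Prop :=
  [/\ eps * eps = 1, K0 *m K0 = eps%:M, G0^T = G0, G0 \in unitmx &
      K0 *m G0 *m K0^T = - eps *: G0].

Definition pacs_correspondence (K0 G0 : 'M[R]_m) (P : M -> set 'M[R]_m)
    (K : M -> 'M[R]_m) (c : M -> set 'M[R]_m) : Prop :=
  (forall x u, P x u -> K0 *m u = u *m K x) /\
  (forall x, c x = induced_line P (bil G0) x).

Variables (eps : R) (K0 G0 : 'M[R]_m).
Hypothesis m_gt2 : (2 < m)%N.
Hypothesis model : pacs_model eps K0 G0.

Let B0 := fundamental_form G0 K0.

Let eps_neq0 : eps != 0.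
Proof.
case: model => e1 *; apply/eqP => e0; move/eqP: e1.
by rewrite e0 mul0r eq_sym oner_eq0.
Qed.

Let unit_neq0 (C : 'M[R]_m) : C \in unitmx -> C != 0.
Proof.
move=> Cu; apply/eqP => C0; move: Cu; rewrite C0 unitmxE.
have -> : (0 : 'M[R]_m) = 0%:M by rewrite raddf0.
by rewrite det_scalar expr0n; case: m m_gt2 => //= k _; rewrite unitr0.
Qed.

Let K0_unit : K0 \in unitmx.
Proof.
case: model => _ KK _ _ _.
have : K0 *m K0 \in unitmx by rewrite KK unitmxE det_scalar unitfE expf_neq0.
by rewrite unitmx_mul => /andP[].
Qed.

Let K0_anti : K0 *m G0 = - (G0 *m K0^T).
Proof.
case: model => e1 KK _ _ KGK; have := congr1 (mulmx K0) KGK.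
rewrite !mulmxA KK mul_scalar_mx -!scalemxAl -scalemxAr => /(congr1 (fun X => eps *: X)).
by rewrite !scalerA e1 scale1r mulrN e1 scaleN1r => ->; rewrite opprK.
Qed.

Let B0_unit : B0 \in unitmx.
Proof.
case: model => _ _ _ Gu _.
by rewrite /B0 /fundamental_form -scaleN1r unitmxZ ?unitrN1 // unitmx_mul Gu
  unitmx_tr K0_unit.
Qed.

Let B0_skew : B0^T = - B0.
Proof.
case: model => _ _ Gs _ _.
by rewrite /B0 /fundamental_form linearN /= trmx_mul trmxK Gs K0_anti.
Qed.

(** Since [K0] commutes with A, the action of A on the fundamental form
    [- G0 K0^T] is its action on [G0] followed by the invertible factor
    [- K0^T]. *)
Lemma pacs_group_fundamental (A : 'M[R]_m) : A \in unitmx ->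
  K0 *m A = A *m K0 ->
  (exists t, A *m G0 *m A^T = t *: G0) <->
  (exists t, A *m B0 *m A^T = t *: B0).
Proof.
move=> Au KA.
have E : A *m B0 *m A^T = - (A *m G0 *m A^T *m K0^T).
  rewrite /B0 /fundamental_form mulmxN mulNmx; congr (- _).
  by rewrite -!mulmxA -!trmx_mul KA.
split=> -[t Ht]; exists t.
  by rewrite E Ht /B0 /fundamental_form scalerN -scalemxAl.
have Ktu : K0^T \in unitmx by rewrite unitmx_tr.
rewrite -[LHS](mulmxK Ktu) -[_ *m K0^T]opprK -E Ht /B0 /fundamental_form.
by rewrite scalerN opprK scalemxAl mulmxK.
Qed.

(** All frames at x give the same line, because changes of frame act on C by
    scalars. *)
Lemma induced_lineE (P : M -> set 'M[R]_m) (C : 'M[R]_m) x u :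
  (forall u', P x u' -> exists A, [/\ A \in unitmx, u' = A *m u &
     exists t, A *m C *m A^T = t *: C]) ->
  P x u -> u \in unitmx ->
  induced_line P (bil C) x = line (push u C).
Proof.
move=> HP Pu uu; apply/seteqP; split=> [B [u' [t [Pu' E]]]|_ [t _ <-]].
  have [A [Au uA AC]] := HP _ Pu'.
  have u'u : u' \in unitmx by rewrite uA unitmx_mul Au.
  have {}E : u' *m B *m u'^T = t *: C.
    by apply: bil_inj => v w; rewrite bilZ -E bil_mul.
  have [s Es] := push_invariant Au AC.
  exists (t * s) => //; rewrite (push_eq u'u E) uA push_mul // pushZ Es.
  by rewrite !pushZ scalerA.
exists u, t; split=> // v w.
by rewrite bil_mul -scalemxAr -scalemxAl pushK // bilE bilZ.
Qed.

Section FromStructure.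
Variable P : M -> set 'M[R]_m.
Hypothesis PG : G_structure (pacs_group K0 G0) P.

Lemma pacs_unit x u : P x u -> u \in unitmx.
Proof. by case: PG => H _ _; exact: H. Qed.

Lemma pacs_frame_change x u u' : P x u -> P x u' ->
  exists2 A, pacs_group K0 G0 A & u' = A *m u.
Proof. by case: PG => _ H _ Pu Pu'; exact: (H x u u' Pu).1. Qed.

Lemma pacs_local_frame x : exists (U : set M) (s : M -> 'M[R]_m),
  [/\ open U, U x, smooth_rows U s & forall y, U y -> P y (s y)].
Proof. by case: PG. Qed.

Lemma pacs_inhabited x : exists u, P x u.
Proof. by have [U [s [_ Ux _ Ps]]] := pacs_local_frame x; exists (s x); exact: Ps. Qed.

Lemma pacs_metric_line x u : P x u ->
  induced_line P (bil G0) x = line (push u G0).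
Proof.
move=> Pu; apply: induced_lineE (pacs_unit Pu) => // u' Pu'.
by have [A [Au _ AG] ->] := pacs_frame_change Pu Pu'; exists A.
Qed.

Lemma pacs_fundamental_line x u : P x u ->
  induced_line P (bil B0) x = line (push u B0).
Proof.
move=> Pu; apply: induced_lineE (pacs_unit Pu) => // u' Pu'.
have [A [Au KA AG] ->] := pacs_frame_change Pu Pu'; exists A; split=> //.
exact: (pacs_group_fundamental Au KA).1.
Qed.

Lemma pacs_tensor_unique (K K' : M -> 'M[R]_m) c c' :
  pacs_correspondence K0 G0 P K c -> pacs_correspondence K0 G0 P K' c' ->
  K = K' /\ c = c'.
Proof.
move=> [HK Hc] [HK' Hc']; split; apply/funext => x; last by rewrite Hc Hc'.
have [u Pu] := pacs_inhabited x.
have uu := pacs_unit Pu.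
by rewrite -[LHS](mulKmx uu) -(HK _ _ Pu) (HK' _ _ Pu) mulKmx.
Qed.

Lemma pacs_tensor : exists K : M -> 'M[R]_m,
  forall x u, P x u -> K0 *m u = u *m K x.
Proof.
have /choice[u Pu] := pacs_inhabited.
exists (fun x => invmx (u x) *m K0 *m u x) => x u' Pu'.
have ux := pacs_unit (Pu x).
have [A [Au KA _] ->] := pacs_frame_change (Pu x) Pu'.
by rewrite -!mulmxA (mulmxA (u x)) mulmxV // mul1mx !mulmxA KA.
Qed.

Lemma pacs_tensorE (K : M -> 'M[R]_m) x u :
  (forall x u, P x u -> K0 *m u = u *m K x) -> P x u ->
  K x = invmx u *m K0 *m u.
Proof. by move=> HK Pu; rewrite -mulmxA (HK _ _ Pu) mulKmx // (pacs_unit Pu). Qed.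

Lemma pacs_tensor_smooth (K : M -> 'M[R]_m) :
  (forall x u, P x u -> K0 *m u = u *m K x) -> smooth_endo setT K.
Proof.
move=> HK; apply: smooth_endo_local => x.
have [U [s [oU Ux ss Ps]]] := pacs_local_frame x; exists U => //.
apply: (@smooth_endo_ext _ _ _ _ (fun y => invmx (s y) *m K0 *m s y)) => //.
  by move=> y Uy; rewrite (pacs_tensorE HK (Ps _ Uy)).
by apply: smooth_endo_of_frame => // y Uy; exact: pacs_unit (Ps _ Uy).
Qed.

Lemma pacs_tensor_sqr (K : M -> 'M[R]_m) x :
  (forall x u, P x u -> K0 *m u = u *m K x) -> K x *m K x = eps%:M.
Proof.
move=> HK; have [u Pu] := pacs_inhabited x; have uu := pacs_unit Pu.
have [_ KK _ _ _] := model.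
have E : u *m (K x *m K x) = eps *: u.
  by rewrite mulmxA -(HK _ _ Pu) -mulmxA -(HK _ _ Pu) mulmxA KK mul_scalar_mx.
by rewrite -[LHS](mulKmx uu) E -scalemxAr mulVmx // scalemx1.
Qed.

Lemma pacs_line_subbundle (C : 'M[R]_m) (Q : M -> 'M[R]_m -> Prop) : C != 0 ->
  (forall x u, P x u -> induced_line P (bil C) x = line (push u C)) ->
  (forall x u, P x u -> Q x (push u C)) ->
  line_subbundle_spanned_by Q (induced_line P (bil C)).
Proof.
move=> C0 HC HQ x; have [U [s [oU Ux ss Ps]]] := pacs_local_frame x.
exists U, (fun y => push (s y) C); split => //.
  by apply: smooth_form_of_frame => // y Uy; exact: pacs_unit (Ps _ Uy).
move=> y Uy; have Py := Ps _ Uy; split; first exact: HQ.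
  exact: push_neq0 (pacs_unit Py) C0.
exact: HC.
Qed.

Lemma fundamental_push (K : 'M[R]_m) (u C : 'M[R]_m) : u \in unitmx ->
  K0 *m u = u *m K ->
  fundamental_form (push u C) K = push u (fundamental_form C K0).
Proof.
move=> uu HK; apply: push_eq => //; rewrite /fundamental_form.
rewrite mulmxN mulNmx; congr (- _).
rewrite mulmxA -[_ *m K^T *m u^T]mulmxA -trmx_mul -HK trmx_mul mulmxA.
by rewrite pushK.
Qed.

End FromStructure.

(** Two frames that carry [K0] to [K] and [G0] into the line [c] differ by an
    element of the group, and by no more than that. Hence the set of all such
    frames is a structure, and it is the only one inducing [K] and [c]. *)
Lemma pacs_structure_exists (K : M -> 'M[R]_m) (c : M -> set 'M[R]_m) :
  (forall x, exists (U : set M) (s : M -> 'M[R]_m),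
     [/\ open U, U x, smooth_rows U s & forall y, U y ->
        [/\ s y \in unitmx, K0 *m s y = s y *m K y &
            c y = line (push (s y) G0)]]) ->
  exists! P, G_structure (pacs_group K0 G0) P /\ pacs_correspondence K0 G0 P K c.
Proof.
move=> H; have G0u : G0 \in unitmx by case: model.
have G00 := unit_neq0 G0u.
pose P x : set 'M[R]_m := [set u | [/\ u \in unitmx, K0 *m u = u *m K x &
  c x = line (push u G0)]].
have PG : G_structure (pacs_group K0 G0) P.
  split.
  - by move=> x u [].
  - move=> x u u' [uu Ku cu]; split=> [[u'u Ku' cu']|[A [Au KA AG] ->]].
      have iuu : invmx u \in unitmx by rewrite unitmx_inv.
      exists (u' *m invmx u); last by rewrite mulmxKV.
      split; first by rewrite unitmx_mul u'u.
        rewrite mulmxA Ku' -!mulmxA; congr (_ *m _).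
        by rewrite -[LHS]mul1mx -(mulVmx uu) -!mulmxA (mulmxA u) -Ku mulmxK.
      have : c x (push u G0) by rewrite cu; exists 1; rewrite ?scale1r.
      rewrite cu' => -[t _ E]; exists t.
      rewrite trmx_mul !mulmxA -[u' *m _ *m _]mulmxA -[u' *m _ *m _]mulmxA.
      by rewrite -/(push u G0) -E -scalemxAr -scalemxAl pushK.
    split; first by rewrite unitmx_mul Au.
      by rewrite mulmxA KA -mulmxA Ku mulmxA.
    have [t Et] := push_invariant Au AG.
    rewrite cu push_mul // Et pushZ lineZ //.
    apply/eqP => t0; move: (push_neq0 Au G00).
    by rewrite Et t0 scale0r eqxx.
  - move=> x; have [U [s [oU Ux ss Hs]]] := H x.
    by exists U, s; split.
have Pc : pacs_correspondence K0 G0 P K c.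
  split=> [x u []//|x]; have [u Pu] := pacs_inhabited PG x.
  by rewrite (pacs_metric_line PG Pu); case: Pu.
exists P; split=> // P' [PG' [HK Hc]]; apply/funext => x.
apply/seteqP; split=> u; last first.
  move=> P'u; split; [exact: pacs_unit P'u|exact: HK|].
  by rewrite Hc (pacs_metric_line PG' P'u).
have [u0 P'u0] := pacs_inhabited PG' x.
have Pu0 : P x u0.
  split; [exact: pacs_unit P'u0|exact: HK|].
  by rewrite Hc (pacs_metric_line PG' P'u0).
move=> Pu; case: (PG') => _ /(_ x u0 u P'u0)[_ HA] _; apply: HA.
exact: pacs_frame_change Pu0 Pu.
Qed.

Section Underlying.
Variables (P : M -> set 'M[R]_m) (K : M -> 'M[R]_m) (c : M -> set 'M[R]_m).
Hypothesis PG : G_structure (pacs_group K0 G0) P.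
Hypothesis Pc : pacs_correspondence K0 G0 P K c.

Let l := induced_line P (bil B0).

Let lE x u : P x u -> l x = line (push u B0).
Proof. exact: pacs_fundamental_line. Qed.

Let cE x u : P x u -> c x = line (push u G0).
Proof. by case: Pc => _ ->; exact: pacs_metric_line. Qed.

Let KE x u : P x u -> K0 *m u = u *m K x.
Proof. by case: Pc => HK _; exact: HK. Qed.

Let K_smooth : smooth_endo setT K.
Proof. by case: Pc => HK _; exact: (pacs_tensor_smooth PG HK). Qed.

Let K_sqr x : K x *m K x = eps%:M.
Proof. by case: Pc => HK _; exact: (pacs_tensor_sqr PG x HK). Qed.

Lemma underlying_acs : almost_conformally_symplectic l.
Proof.
split.
  apply: (pacs_line_subbundle PG) => //; exact: unit_neq0.
move=> x B; have [u Pu] := pacs_inhabited PG x; have uu := pacs_unit PG Pu.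
rewrite (lE Pu) => -[t _ <-]; split.
  by apply/skew_trP; rewrite linearZ /= push_tr B0_skew pushN scalerN.
move=> tB0; apply/nondegenerate_unitP.
have t0 : t != 0 by apply: contraNneq tB0 => ->; rewrite scale0r.
by rewrite unitmxZ ?unitfE // push_unit.
Qed.

Lemma section_frame U g x u : nonvanishing_section c U g -> U x -> P x u ->
  exists2 t, t != 0 & g x = t *: push u G0.
Proof.
move=> [[_ _ gc] g0] Ux Pu; have := gc _ Ux; rewrite (cE Pu) => -[t _ E].
exists t; rewrite ?E //; apply: contraNneq (g0 _ Ux) => t0.
by rewrite -E t0 scale0r.
Qed.

Lemma fundamental_section (g : M -> 'M[R]_m) x u t : P x u ->
  g x = t *: push u G0 -> fundamental K g x = t *: push u B0.
Proof.
move=> Pu E; rewrite /fundamental /fundamental_form E -scalemxAl -scalerN.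
by rewrite -(fundamental_push G0 (pacs_unit PG Pu) (KE Pu)).
Qed.

Lemma underlying_spanned : spanned_by_fundamental_forms c K l.
Proof.
move=> U g Hg x Ux; have [u Pu] := pacs_inhabited PG x.
have [t t0 E] := section_frame Hg Ux Pu.
by rewrite (lE Pu) (fundamental_section Pu E) -(lineZ _ t0).
Qed.

(** The entries of B refer to the preferred charts and need not be continuous;
    they have to be compared with a smooth frame first. *)
Lemma nonvanishing_nbhs (U : set M) (B : M -> 'M[R]_m) x : open U -> U x ->
  smooth_form U B -> B x != 0 ->
  exists U', [/\ open U', U' x, U' `<=` U & forall y, U' y -> B y != 0].
Proof.
move=> oU Ux sB Bx; have [U1 [s [oU1 U1x ss su]]] := coordinate_frame x.
have oI : open (U `&` U1) by exact: openI.
have sS : smooth_map (U `&` U1) (fun y => s y *m B y *m (s y)^T).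
  by apply: smooth_pairing => //; [apply: smooth_rows_subset ss|
    apply: smooth_rows_subset ss|apply: smooth_form_subset sB] => y [].
have [i [j nz]] : exists i j, (s x *m B x *m (s x)^T) i j != 0.
  apply: contrapT => H; move/eqP: Bx; apply.
  suff /(push_eq (su _ U1x)) -> : s x *m B x *m (s x)^T = 0.
    by rewrite /push mulmx0 mul0mx.
  apply/matrixP => i j; rewrite [RHS]mxE; apply/eqP; apply: contrapT => /negP nz.
  by apply: H; exists i, j.
pose phi y := (s y *m B y *m (s y)^T) i j * (s y *m B y *m (s y)^T) i j.
have se := smooth_map_entry oI i j sS.
have sphi : smooth_map (U `&` U1) phi by exact: smooth_mapM.
have phix : 0 < phi x by rewrite /phi -expr2 exprn_even_gt0.
have [U' [oU' U'x U'U Hphi]] := smooth_map_pos oI sphi (conj Ux U1x) phix.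
exists U'; split => // [y /U'U[]//|y /Hphi].
by rewrite /phi; apply: contraTneq => ->; rewrite mulmx0 mul0mx mxE mul0r ltxx.
Qed.

Lemma fundamental_smooth U g : smooth_form U g -> open U ->
  smooth_form U (fundamental K g).
Proof.
move=> sg oU; have sK := smooth_endo_subset (@subsetT _ U) K_smooth.
apply: smooth_form_ext (smooth_form_endo oU (-1) sg sK) => // x _.
by rewrite scaleN1r.
Qed.

(** Passing to the fundamental form is inverted by [B |-> - eps B (., K .)],
    so closed sections of l correspond to Kaehler metrics. *)
Lemma underlying_pcs : conformally_symplectic l <-> locally_contains_kahler c K.
Proof.
have [e1 _ _ _ _] := model.
split=> H x.
  have [U [B [[oU sB lB] Ux clB Bx]]] := H x.
  have [U' [oU' U'x U'U B0']] := nonvanishing_nbhs oU Ux sB Bx.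
  pose g y := - eps *: (B y *m (K y)^T).
  have fg y : fundamental K g y = B y.
    rewrite /fundamental /fundamental_form /g -scalemxAl -mulmxA -trmx_mul K_sqr.
    by rewrite tr_scalar_mx mul_mx_scalar scalerA mulNr e1 scaleN1r opprK.
  exists U', g; split => //; split; last first.
    move=> d y ad dy U'y u v w.
    have -> : fundamental K g = B by apply/funext => z; exact: fg.
    by apply: clB => //; exact: U'U.
  split; last first.
    move=> y U'y; apply: contraNneq (B0' _ U'y) => g0.
    by rewrite -fg /fundamental g0 /fundamental_form mul0mx oppr0.
  split=> //.
    apply: smooth_form_endo => //; first exact: smooth_form_subset sB.
    exact: smooth_endo_subset (@subsetT _ _) K_smooth.
  move=> y U'y; have [u Pu] := pacs_inhabited PG y.
  rewrite (cE Pu); have := lB _ (U'U _ U'y); rewrite (lE Pu) => -[t _ E].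
  exists t => //; rewrite /g -E -scalemxAl scalerA mulrC -scalerA; congr (_ *: _).
  rewrite -(fundamental_push G0 (pacs_unit PG Pu) (KE Pu)) /fundamental_form.
  rewrite mulNmx -mulmxA -trmx_mul K_sqr tr_scalar_mx mul_mx_scalar scaleNr scalerN.
  by rewrite opprK scalerA e1 scale1r.
have [U [g [Ux [Hg clg]]]] := H x; have [[oU sg gc] g0] := Hg.
exists U, (fundamental K g); split => //.
  split => //; first exact: fundamental_smooth.
  move=> y Uy; rewrite (underlying_spanned Hg Uy).
  by exists 1 => //; rewrite scale1r.
have [u Pu] := pacs_inhabited PG x.
have [t t0 E] := section_frame Hg Ux Pu.
rewrite (fundamental_section Pu E) scaler_eq0 negb_or t0.
exact: push_neq0 (pacs_unit PG Pu) (unit_neq0 B0_unit).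
Qed.

(** The factor between two Kaehler metrics has derivative 0 in a chart, so it
    is constant on a ball. *)
Lemma underlying_kahler_unique : kahler_locally_unique c K.
Proof.
move=> U g g' [Hg clg] [Hg' clg'] x Ux.
have [[oU sg gc] g0] := Hg; have [[_ sg' gc'] g0'] := Hg'.
pose d := chart_at x; have ad : atlas d := chart_at_atlas x.
have dx : cdom d x := chart_at_dom x.
pose O := cmap d @` (cdom d `&` U); have oO : open O by exact: open_chart_image.
pose om := form_in_chart d (fundamental K g).
pose om' := form_in_chart d (fundamental K g').
have som : smooth O om by exact: fundamental_smooth.
have som' : smooth O om' by exact: fundamental_smooth.
(* the conformal factor between the two forms, read off as a trace *)
pose phi z := m%:R^-1 * \tr (om' z *m invmx (om z)).
have key y : cdom d y -> U y ->
    [/\ (om (cmap d y))^T = - om (cmap d y), om (cmap d y) \in unitmx,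
        om' (cmap d y) = phi (cmap d y) *: om (cmap d y) &
        g' y = phi (cmap d y) *: g y].
  move=> dy Uy; have [u Pu] := pacs_inhabited PG y.
  have uu := pacs_unit PG Pu.
  have [t t0 E] := section_frame Hg Uy Pu.
  have [t' t'0 E'] := section_frame Hg' Uy Pu.
  have Tu := dchart_unit ad dy.
  have omE : om (cmap d y) = t *: push (u *m dchart d y) B0.
    rewrite /om /form_in_chart /= cmapK // (fundamental_section Pu E).
    by rewrite -scalemxAr -scalemxAl /push invmx_mul // trmx_mul !mulmxA.
  have om'E : om' (cmap d y) = t' *: push (u *m dchart d y) B0.
    rewrite /om' /form_in_chart /= cmapK // (fundamental_section Pu E').
    by rewrite -scalemxAr -scalemxAl /push invmx_mul // trmx_mul !mulmxA.
  have uTu : u *m dchart d y \in unitmx by rewrite unitmx_mul uu.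
  have pu := push_unit uTu B0_unit.
  have omu : om (cmap d y) \in unitmx by rewrite omE unitmxZ ?unitfE.
  have phiE : phi (cmap d y) = t' / t.
    have -> : phi (cmap d y) = m%:R^-1 * \tr ((t' / t)%:M : 'M[R]_m).
      rewrite /phi; congr (_ * \tr _).
      have -> : om' (cmap d y) = (t' / t) *: om (cmap d y).
        by rewrite omE om'E scalerA divfK.
      by rewrite -scalemxAl mulmxV // scalemx1.
    rewrite mxtrace_scalar -[_ / _ *+ _]mulr_natl mulKf //.
    by rewrite pnatr_eq0; move: m_gt2; case: (m).
  split => //.
  - by rewrite omE linearZ /= push_tr B0_skew pushN scalerN.
  - by rewrite phiE omE om'E scalerA divfK.
  - by rewrite phiE E E' scalerA divfK.
have sphi : smooth O phi.
  apply: smoothM => //; first exact: smooth_cst.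
  have st : smooth O (fun z => om' z *m invmx (om z)).
    apply: smooth_mulmx => //; apply: smooth_invmx => //.
    by move=> _ [y [dy Uy] <-]; have [] := key y dy Uy.
  by apply: smooth_sum => // i; move/smooth_mxP: st; apply.
have Dphi : forall z, O z -> forall v, 'D_v phi z = 0.
  apply: (conformal_closed_derive (om := om) (om' := om')) => //.
  - by move=> _ [y [dy Uy] <-]; have [] := key y dy Uy.
  - by move=> _ [y [dy Uy] <-]; have [] := key y dy Uy.
  - by move=> _ [y [dy Uy] <-]; exact: clg.
  - by move=> _ [y [dy Uy] <-]; exact: clg'.
have Ox : nbhs (cmap d x) O by apply: open_nbhs_nbhs; split => //; exists x.
have [r /= r0 Hr] := (nbhs_ballP _ _).1 Ox.
have {}Hr z : `|z - cmap d x| < r -> O z.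
  by move=> zr; apply: Hr; rewrite -ball_normE /= /ball_ distrC.
have cphi := derive0_constant Hr sphi Dphi.
have nW : nbhs x ((cdom d `&` cmap d @^-1` [set z | `|z - cmap d x| < r]) `&` U).
  apply: filterI; last by apply: open_nbhs_nbhs.
  apply: nbhs_chart_preimage => //; apply/nbhs_ballP; exists r => //= z.
  by rewrite -ball_normE /= /ball_ distrC.
exists (interior ((cdom d `&` cmap d @^-1` [set z | `|z - cmap d x| < r]) `&` U)).
exists (phi (cmap d x)); split.
- exact: open_interior.
- exact: nW.
- by move=> y /interior_subset[].
- have [_ _ _ E] := key x dx Ux; apply: contraNneq (g0' _ Ux) => p0.
  by rewrite E p0 scale0r.
- move=> y /interior_subset[[dy yr] Uy].
  by have [_ _ _ ->] := key y dy Uy; rewrite (cphi _ yr).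
Qed.

End Underlying.

End PacsStructures.

(** * The Hermitian model *)

Section HermitianModel.
Variables (R : realType) (n : nat).

Lemma Re_mulmx k l p (A : 'M[R[i]]_(k, l)) (B : 'M[R[i]]_(l, p)) :
  map_mx (@complex.Re R) (A *m B) =
  map_mx (@complex.Re R) A *m map_mx (@complex.Re R) B -
  map_mx (@complex.Im R) A *m map_mx (@complex.Im R) B.
Proof.
apply/matrixP => i j; rewrite !mxE (big_morph (@complex.Re R) (id1 := 0) (op1 := +%R)) //.
  rewrite -sumrB; apply: eq_bigr => r _; rewrite !mxE.
  by case: (A i r) (B r j) => [a b] [c d].
by case=> a b [].
Qed.

Lemma Im_mulmx k l p (A : 'M[R[i]]_(k, l)) (B : 'M[R[i]]_(l, p)) :
  map_mx (@complex.Im R) (A *m B) =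
  map_mx (@complex.Re R) A *m map_mx (@complex.Im R) B +
  map_mx (@complex.Im R) A *m map_mx (@complex.Re R) B.
Proof.
apply/matrixP => i j; rewrite !mxE (big_morph (@complex.Im R) (id1 := 0) (op1 := +%R)) //.
  rewrite -big_split; apply: eq_bigr => r _; rewrite !mxE.
  by case: (A i r) (B r j) => [a b] [c d].
by case=> a b [].
Qed.

Lemma Re_conj k l (A : 'M[R[i]]_(k, l)) :
  map_mx (@complex.Re R) (map_mx (@conjc R) A) = map_mx (@complex.Re R) A.
Proof. by apply/matrixP => i j; rewrite !mxE; case: (A i j). Qed.

Lemma Im_conj k l (A : 'M[R[i]]_(k, l)) :
  map_mx (@complex.Im R) (map_mx (@conjc R) A) = - map_mx (@complex.Im R) A.
Proof. by apply/matrixP => i j; rewrite !mxE; case: (A i j). Qed.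

Definition i_mx : 'M[R]_(n + n) := block_mx 0 1%:M (- 1%:M) 0.

Lemma i_mx_tr : i_mx^T = block_mx 0 (- 1%:M) 1%:M 0.
Proof. by rewrite /i_mx tr_block_mx !trmx0 linearN /= trmx1. Qed.

(** Gram matrix of the real part of h: with h = h1 + i h2 and vectors
    x + i y, conjugate linearity in the first argument puts the sign on the
    upper right block. *)
Definition re_mx (h : 'M[R[i]]_n) : 'M[R]_(n + n) :=
  block_mx (map_mx (@complex.Re R) h) (- map_mx (@complex.Im R) h)
           (map_mx (@complex.Im R) h) (map_mx (@complex.Re R) h).

Definition rrows k (A : 'M[R[i]]_(k, n)) : 'M[R]_(k, n + n) :=
  row_mx (map_mx (@complex.Re R) A) (map_mx (@complex.Im R) A).

Lemma im_mxE (h : 'M[R[i]]_n) : fundamental_form (re_mx h) i_mx =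
  block_mx (map_mx (@complex.Im R) h) (map_mx (@complex.Re R) h)
           (- map_mx (@complex.Re R) h) (map_mx (@complex.Im R) h).
Proof.
rewrite /fundamental_form /re_mx i_mx_tr mulmx_block.
rewrite !mulmx0 !mulmxN !mulmx1 !addr0 !add0r.
by rewrite opp_block_mx !opprK.
Qed.

Lemma Re_sesquilinear k l (h : 'M[R[i]]_n) (A : 'M[R[i]]_(k, n))
    (B : 'M[R[i]]_(l, n)) :
  map_mx (@complex.Re R) (map_mx (@conjc R) A *m h *m B^T) =
  rrows A *m re_mx h *m (rrows B)^T.
Proof.
rewrite Re_mulmx Re_mulmx Im_mulmx Re_conj Im_conj /rrows /re_mx.
rewrite mul_row_block tr_row_mx mul_row_col -!map_trmx !mulmxN !mulNmx.
by rewrite opprK; congr (_ + _); rewrite -[LHS]mulNmx opprD opprK.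
Qed.

Lemma Im_sesquilinear k l (h : 'M[R[i]]_n) (A : 'M[R[i]]_(k, n))
    (B : 'M[R[i]]_(l, n)) :
  map_mx (@complex.Im R) (map_mx (@conjc R) A *m h *m B^T) =
  rrows A *m fundamental_form (re_mx h) i_mx *m (rrows B)^T.
Proof.
rewrite im_mxE Im_mulmx Re_mulmx Im_mulmx Re_conj Im_conj /rrows.
rewrite mul_row_block tr_row_mx mul_row_col -!map_trmx !mulmxN !mulNmx opprK.
by rewrite addrC.
Qed.

Lemma rrows_cvec (v : 'rV[R]_(n + n)) : rrows (cvec v) = v.
Proof.
rewrite -[RHS]hsubmxK /rrows; congr row_mx; apply/rowP => i; rewrite !mxE //.
Qed.

Lemma re_formE h v w : re_form h v w = bil (re_mx h) v w.
Proof.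
rewrite /re_form /hform /bil -{2}[v]rrows_cvec -{2}[w]rrows_cvec.
by rewrite -Re_sesquilinear [RHS]mxE.
Qed.

Lemma im_formE h v w :
  im_form h v w = bil (fundamental_form (re_mx h) i_mx) v w.
Proof.
rewrite /im_form /hform /bil -{2}[v]rrows_cvec -{2}[w]rrows_cvec.
by rewrite -Im_sesquilinear [RHS]mxE.
Qed.

Lemma cscaleE (a : R[i]) (v : 'rV[R]_(n + n)) :
  Defs.cscale a v = complex.Re a *: v + complex.Im a *: (v *m i_mx).
Proof.
rewrite -{2 3}[v]hsubmxK /i_mx mul_row_block !mulmx0 mulmxN !mulmx1 add0r addr0.
rewrite !scale_row_mx add_row_mx /Defs.cscale /rvec.
congr row_mx; apply/rowP => j; rewrite !mxE; case: a => a b /=.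
  by rewrite mulrN.
by [].
Qed.

Lemma cscale_i (v : 'rV[R]_(n + n)) : Defs.cscale (Complex 0 1) v = v *m i_mx.
Proof. by rewrite cscaleE scale0r scale1r add0r. Qed.

Lemma mulmx_row_inj k m (A B : 'M[R]_(k, m)) :
  (forall v : 'rV_k, v *m A = v *m B) -> A = B.
Proof. by move=> H; apply/row_matrixP => i; rewrite !rowE H. Qed.

Lemma i_mx_sqr : i_mx *m i_mx = - 1%:M.
Proof.
rewrite /i_mx mulmx_block !mulmx0 !mul0mx mulmxN mulNmx !mulmx1 !addr0 !add0r.
by rewrite [in RHS]scalar_mx_block opp_block_mx !oppr0.
Qed.

Lemma re_mx_herm_pair p q (h : 'M[R[i]]_n) : hermitian_form p q h ->
  herm_pair (re_mx h) i_mx.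
Proof.
case=> hh _ _; split; last 1 first.
- rewrite /re_mx i_mx_tr /i_mx !mulmx_block.
  rewrite !mulmx0 !mul0mx !mulNmx !mul1mx !add0r !addr0 !mulmxN !mulmx1.
  by rewrite !opprK.
- apply/symmetric_trP => v w; rewrite -!re_formE /re_form (hh (cvec v)).
  by case: (hform h _ _).
- exact: i_mx_sqr.
Qed.

(** A unitary basis read over the reals. That e is orthogonal to i e expresses
    that the Hermitian Gram matrix is real. *)
Lemma re_mx_basis p q (h : 'M[R[i]]_n) : hermitian_form p q h ->
  exists e : 'M[R]_(n, n + n), herm_orth (re_mx h) i_mx (sign_mx R n p) e.
Proof.
case=> hh _ [A Au HA]; exists (rrows A).
have signE : sign_mx R[i] n p = map_mx (fun x => (x%:C)%C) (sign_mx R n p).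
  apply/matrixP => i j; rewrite !mxE; case: eqP => // _; rewrite !mulr1n.
  by rewrite rmorphXn rmorphN1.
split.
  rewrite -Re_sesquilinear HA signE -map_mx_comp.
  by apply/matrixP => i j; rewrite !mxE.
have -> : rrows A *m re_mx h *m (rrows A *m i_mx)^T =
    - (rrows A *m fundamental_form (re_mx h) i_mx *m (rrows A)^T).
  by rewrite /fundamental_form mulmxN mulNmx opprK trmx_mul !mulmxA.
rewrite -Im_sesquilinear HA signE -map_mx_comp.
by apply/matrixP => i j; rewrite !mxE oppr0.
Qed.

End HermitianModel.

(** * Structures of Kaehler type *)

Section Kahler.
Variables (R : realType) (p q : nat).
Variable h : 'M[R[i]]_(p + q).
Variable M : manifold R ((p + q) + (p + q)).
Hypothesis pq2 : (2 <= p + q)%N.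
Hypothesis hh : hermitian_form p q h.

Let n := (p + q)%N.
Let G0 := re_mx h.
Let I0 : 'M[R]_(n + n) := i_mx R n.
Let B0 := fundamental_form G0 I0.

Let G0I0 : herm_pair G0 I0. Proof. exact: re_mx_herm_pair hh. Qed.

Let m_gt2 : (2 < n + n)%N. Proof. by rewrite /n; lia. Qed.

Let model : pacs_model (-1) I0 G0.
Proof.
have [Gs II IGI] := G0I0; have [e He] := re_mx_basis hh.
split => //.
- by rewrite mulrNN mulr1.
- by rewrite II -scaleN1r scalemx1.
- have := herm_frame_gram G0I0 He; rewrite -/n.
  set F := herm_frame _ _; set D := block_mx _ _ _ _ => HF.
  have DD : D *m D = 1%:M.
    rewrite /D mulmx_block !mulmx0 !mul0mx !addr0 !add0r sign_mx_sqr.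
    by rewrite -scalar_mx_block.
  have [+ _] := mulmx1_unit DD.
  by rewrite -HF !unitmx_mul => /andP[/andP[_ ->]].
- by rewrite opprK scale1r.
Qed.

Let re_formEf : re_form h = bil G0.
Proof. by apply/funext => v; apply/funext => w; exact: re_formE. Qed.

Let im_formEf : im_form h = bil B0.
Proof. by apply/funext => v; apply/funext => w; exact: im_formE. Qed.

Lemma kahler_groupE : kahler_group h = pacs_group I0 G0.
Proof.
apply/seteqP; split=> A.
  move=> [[Au [t Ht]] HA].
  have IA : I0 *m A = A *m I0.
    apply: mulmx_row_inj => v; rewrite mulmxA -cscale_i HA cscale_i.
    by rewrite mulmxA.
  split=> //; apply/(pacs_group_fundamental model Au IA); exists t.
  by apply: bil_inj => v w; rewrite bilZ -[bil B0 v w]/(bil B0 v w) -im_formEf -Ht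
    im_formEf bil_mul.
move=> [Au IA /(pacs_group_fundamental model Au IA)[t Ht]]; split.
  split=> //; exists t => v w.
  by rewrite im_formEf bil_mul Ht -scalemxAr -scalemxAl mxE.
move=> a v; rewrite !cscaleE mulmxDl -!scalemxAl; congr (_ + _ *: _).
by rewrite -!mulmxA IA.
Qed.

Lemma kahler_correspondenceE (P : M -> set 'M[R]_(n + n)) Jc :
  kahler_correspondence h P Jc <-> pacs_correspondence I0 G0 P Jc.1 Jc.2.
Proof.
rewrite /kahler_correspondence /pacs_correspondence re_formEf.
split=> -[H1 H2]; split=> // x u Pu.
  apply: mulmx_row_inj => v; rewrite mulmxA -cscale_i (H1 _ _ Pu).
  by rewrite mulmxA.
by move=> v; rewrite cscale_i -!mulmxA (H1 _ _ Pu).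
Qed.

Lemma almost_hermitianP (J g : 'M[R]_(n + n)) : J *m J = - 1%:M ->
  almost_hermitian J g <-> herm_pair g J /\ g \in unitmx.
Proof.
move=> JJ; split.
  case=> /symmetric_trP gs /nondegenerate_unitP gu gJ; split=> //; split=> //.
  by apply: bil_inj => v w; rewrite -gJ bil_mul.
case=> -[gs _ gJ] gu; split; first exact/symmetric_trP.
  exact/nondegenerate_unitP.
by move=> v w; rewrite bil_mul gJ.
Qed.

Lemma herm_pair_push (u J : 'M[R]_(n + n)) : u \in unitmx -> I0 *m u = u *m J ->
  herm_pair (push u G0) J.
Proof.
move=> uu HJ; have [Gs II IGI] := G0I0; split.
- by rewrite push_tr Gs.
- have E : u *m (J *m J) = - u.
    by rewrite mulmxA -HJ -mulmxA -HJ mulmxA II mulNmx mul1mx.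
  by rewrite -[LHS](mulKmx uu) E mulmxN mulVmx.
- apply: push_eq => //.
  rewrite !mulmxA -HJ -!mulmxA -trmx_mul -HJ trmx_mul.
  by rewrite -[RHS]IGI -[in RHS](pushK G0 uu) !mulmxA.
Qed.

Lemma herm_orth_push (u J : 'M[R]_(n + n)) k D (e : 'M[R]_(k, n + n)) :
  u \in unitmx -> I0 *m u = u *m J ->
  herm_orth G0 I0 D e -> herm_orth (push u G0) J D (e *m u).
Proof.
move=> uu HJ [eD e0]; split.
  by rewrite -eD -[in RHS](pushK G0 uu) !trmx_mul !mulmxA.
rewrite -[e *m u *m J]mulmxA -HJ -[in RHS]e0 -[in RHS](pushK G0 uu).
by rewrite !trmx_mul !mulmxA.
Qed.

Lemma kahler_class_of_structure P : G_structure (kahler_group h) P ->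
  exists! Jc, conformal_hermitian_class p q Jc.1 Jc.2 /\
              kahler_correspondence (M := M) h P Jc.
Proof.
rewrite kahler_groupE => PG.
have [J HJ] := pacs_tensor PG; pose c := induced_line P (bil G0).
have Hc : pacs_correspondence I0 G0 P J c by split.
have JJ x : J x *m J x = - 1%:M.
  by rewrite (pacs_tensor_sqr model PG x HJ) -[- 1%:M]scaleN1r scalemx1.
exists (J, c); split; last first.
  move=> [J' c'] [_ /kahler_correspondenceE Hc'].
  by have [/= -> ->] := pacs_tensor_unique PG Hc Hc'.
split; last exact/kahler_correspondenceE.
split; first by split=> //; exact: (pacs_tensor_smooth PG HJ).
apply: (pacs_line_subbundle PG).
- case: model => _ _ _ Gu _; apply/eqP => G00; move: Gu; rewrite G00.
  by rewrite -row_free_unit /row_free mxrank0; move: m_gt2; case: (n + n)%N.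
- by move=> x u Pu; exact: (pacs_metric_line PG).
- move=> x u Pu; have uu := pacs_unit PG Pu; split.
    apply/almost_hermitianP => //; split; first exact: herm_pair_push (HJ _ _ Pu).
    by rewrite push_unit //; case: model.
  have [e He] := re_mx_basis hh.
  apply: (herm_basis_signature (herm_pair_push uu (HJ _ _ Pu))).
  exact: herm_orth_push uu (HJ _ _ Pu) He.
Qed.

(** Relative to a coordinate frame s, the metric and J become matrix functions
    G and K. A unitary basis at x extends to a smooth unitary basis e nearby,
    and comparing it with a unitary basis f of the model gives the frame. *)
Lemma kahler_local_frame (J : M -> 'M[R]_(n + n)) (c : M -> set 'M[R]_(n + n)) :
  conformal_hermitian_class p q J c -> forall x,
  exists (U : set M) (s : M -> 'M[R]_(n + n)),
    [/\ open U, U x, smooth_rows U s & forall y, U y ->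
        [/\ s y \in unitmx, I0 *m s y = s y *m J y &
            c y = line (push (s y) G0)]].
Proof.
move=> [[sJ JJ] Hc] x; have [U1 [g [oU1 U1x sg Hg]]] := Hc x.
have [U2 [s [oU2 U2x ss su]]] := coordinate_frame x.
pose U := U1 `&` U2; have oU : open U by exact: openI.
have Ux : U x by split.
have ss' : smooth_rows U s by apply: smooth_rows_subset ss => y [].
have su' y : U y -> s y \in unitmx by move=> [_ /su].
pose G y := s y *m g y *m (s y)^T.
pose K y := s y *m J y *m invmx (s y).
have sG : smooth_map U G.
  by apply: smooth_pairing => //; apply: smooth_form_subset sg => y [].
have sK : smooth_map U K.
  by apply: smooth_endo_in_frame => //; exact: smooth_endo_subset (@subsetT _ _) sJ.
have HgJ y : U y -> herm_pair (g y) (J y).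
  by move=> [/Hg[[/(almost_hermitianP _ (JJ y))[] //]]].
have HGK y : U y -> herm_pair (G y) (K y).
  move=> Uy; have [gs _ gJ] := HgJ _ Uy; have uu := su' _ Uy; split.
  - by rewrite /G !trmx_mul trmxK gs mulmxA.
  - by rewrite /K !mulmxA mulmxKV // -(mulmxA (s y)) JJ mulmxN mulmx1 mulNmx mulmxV.
  - rewrite /K /G !trmx_mul !mulmxA mulmxKV //.
    rewrite -[_ *m (s y)^T *m (invmx (s y))^T]mulmxA -trmx_mul mulVmx // trmx1 mulmx1.
    by rewrite -!mulmxA (mulmxA (J y)) (mulmxA _ (J y)^T) gJ.
have [e0 He0] : exists e : 'M[R]_(n, n + n),
    herm_orth (G x) (K x) (sign_mx R n p) e.
  have [[_ Hs] _ _] := Hg _ U1x.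
  have [e [eS e0]] := exists_herm_basis (HgJ _ Ux) Hs; have uu := su' _ Ux.
  exists (e *m invmx (s x)); split.
    rewrite -eS /G trmx_mul !mulmxA mulmxKV // -[_ *m (s x)^T *m _]mulmxA.
    by rewrite -trmx_mul mulVmx // trmx1 mulmx1.
  rewrite -e0 /G /K !mulmxA !mulmxKV // trmx_mul !mulmxA.
  rewrite -[_ *m (s x)^T *m _]mulmxA -trmx_mul mulVmx // trmx1 mulmx1.
  by rewrite trmx_mul mulmxA.
have d1 i : (\row_(i < n) (-1) ^+ (p <= i)%N : 'rV[R]_n) 0 i *
            (\row_(i < n) (-1) ^+ (p <= i)%N : 'rV[R]_n) 0 i = 1.
  by rewrite !mxE -expr2 sqrr_sign.
have [U' [e [oU' U'x U'U se [_ He]]]] := smooth_herm_orth oU Ux sG sK HGK d1 He0.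
have [f Hf] := re_mx_basis hh.
pose F0 := herm_frame I0 f; pose F y := herm_frame (K y) (e y).
pose D := block_mx (sign_mx R n p) 0 0 (sign_mx R n p).
have Du : D \in unitmx.
  have : D *m D = 1%:M.
    rewrite /D mulmx_block !mulmx0 !mul0mx !addr0 !add0r sign_mx_sqr.
    by rewrite -scalar_mx_block.
  by case/mulmx1_unit.
have F0D : F0 *m G0 *m F0^T = D := herm_frame_gram G0I0 Hf.
have F0u : F0 \in unitmx.
  by move: Du; rewrite -F0D !unitmx_mul => /andP[/andP[]].
have FD y : U' y -> F y *m G y *m (F y)^T = D.
  by move=> U'y; exact: herm_frame_gram (HGK _ (U'U _ U'y)) (He _ U'y).
have Fu y : U' y -> F y \in unitmx.
  by move=> U'y; move: Du; rewrite -(FD _ U'y) !unitmx_mul => /andP[/andP[]].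
(* both frames intertwine multiplication by i with the standard one *)
have FI (L : 'M[R]_(n + n)) (a : 'M[R]_(n, n + n)) : L *m L = - 1%:M ->
    herm_frame L a *m L = I0 *m herm_frame L a.
  move=> LL; rewrite /herm_frame mul_col_mx -mulmxA LL mulmxN mulmx1.
  rewrite /I0 /i_mx mul_block_col !mul0mx mul1mx mulNmx mul1mx.
  by rewrite add0r addr0.
have [Gs II _] := G0I0.
pose A y := invmx F0 *m F y.
have Au y : U' y -> A y \in unitmx.
  by move=> U'y; rewrite unitmx_mul unitmx_inv F0u Fu.
have AK y : U' y -> I0 *m A y = A y *m K y.
  move=> U'y; have [_ KK _] := HGK _ (U'U _ U'y).
  rewrite /A -mulmxA FI // !mulmxA; congr (_ *m _).
  have E : F0 *m I0 = I0 *m F0 := FI I0 f II.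
  by rewrite -[LHS](mulKmx F0u) (mulmxA F0) E -mulmxA mulmxV // mulmx1.
have AG y : U' y -> A y *m G y *m (A y)^T = G0.
  move=> U'y; rewrite [RHS](push_eq F0u F0D) /push -(FD _ U'y) /A trmx_mul.
  by rewrite !mulmxA.
exists U', (fun y => A y *m s y); split => //.
  apply: smooth_rows_mul => //; last by apply: smooth_rows_subset ss'.
  apply: smooth_map_mulmx => //; first exact: smooth_map_cst.
  apply: smooth_map_col_mx => //; apply: smooth_map_mulmx => //.
  exact: smooth_map_subset sK.
move=> y U'y; have uu := su' _ (U'U _ U'y); split.
- by rewrite unitmx_mul Au.
- rewrite mulmxA AK // /K -!mulmxA mulVmx // mulmx1 //.
- have [U1y _] := U'U _ U'y; have [_ _ ->] := Hg _ U1y.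
  rewrite -(push_eq (u := A y *m s y) (B := g y)) //.
    by rewrite unitmx_mul Au.
  by rewrite -[RHS](AG _ U'y) /G trmx_mul !mulmxA.
Qed.

Lemma kahler_structure_of_class Jc : conformal_hermitian_class p q Jc.1 Jc.2 ->
  exists! P, G_structure (kahler_group h) P /\
             kahler_correspondence (M := M) h P Jc.
Proof.
move=> Hc; have [P [[PG Pc] uniqP]] :=
  pacs_structure_exists m_gt2 model (kahler_local_frame Hc).
exists P; split; first by rewrite kahler_groupE; split=> //; exact/kahler_correspondenceE.
move=> P'; rewrite kahler_groupE => -[PG' /kahler_correspondenceE Pc'].
exact: uniqP.
Qed.

Lemma kahler_underlying P J c : G_structure (kahler_group h) P ->
  kahler_correspondence (M := M) h P (J, c) ->
  let l := induced_line P (im_form h) in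
  [/\ almost_conformally_symplectic l,
      spanned_by_fundamental_forms c J l,
      conformally_symplectic l <-> locally_contains_kahler c J &
      kahler_locally_unique c J].
Proof.
rewrite kahler_groupE im_formEf => PG /kahler_correspondenceE Pc l.
split.
- exact: (underlying_acs m_gt2 model PG).
- exact: (underlying_spanned model PG Pc).
- exact: (underlying_pcs m_gt2 model PG Pc).
- exact: (underlying_kahler_unique m_gt2 model PG Pc).
Qed.

End Kahler.

(** * Structures of para-Kaehler type *)

Section Splittings.
Variables (R : realType) (n : nat).
Implicit Types A B : 'M[R]_(n, n + n).

Lemma direct_sum_unit A B :
  direct_sum (row_space A) (row_space B) <-> col_mx A B \in unitmx.
Proof.
split=> [H|Vu v].
  rewrite -row_full_unit -sub1mx; apply/row_subP => i.
  have [[e f] [[/= eA fB ->] _]] := H (row i 1%:M).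
  by rewrite -addsmxE addmx_sub_adds.
pose w := v *m invmx (col_mx A B).
have wE : v = lsubmx w *m A + rsubmx w *m B.
  by rewrite -mul_row_col hsubmxK /w mulmxKV.
exists (lsubmx w *m A, rsubmx w *m B); split.
  by split; rewrite /row_space //= ?submxMl.
move=> [e f] [/= /submxP[a ->] /submxP[b ->] E].
have ab : row_mx a b = w by rewrite /w E -mul_row_col mulmxK.
by rewrite -ab row_mxKl row_mxKr.
Qed.

(** The para-complex structure in a basis adapted to the splitting. *)
Definition para_diag : 'M[R]_(n + n) := block_mx 1%:M 0 0 (- 1%:M).

Lemma para_diag_sqr : para_diag *m para_diag = 1%:M.
Proof.
rewrite /para_diag mulmx_block !mulmx0 !mul0mx mulmxN mulNmx !mulmx1 opprK.
by rewrite !addr0 add0r -scalar_mx_block.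
Qed.

Lemma para_complex_mx A B : col_mx A B \in unitmx ->
  let K := para_complex (row_space A) (row_space B) in
  col_mx A B *m K = para_diag *m col_mx A B.
Proof.
move=> /direct_sum_unit/para_complexP H K; have [HA HB] := H.
rewrite mul_col_mx /para_diag mul_block_col !mul0mx addr0 add0r mul1mx mulNmx.
rewrite mul1mx; congr col_mx; apply/row_matrixP => i; rewrite row_mul.
  by rewrite HA // /row_space /= row_sub.
by rewrite HB ?raddfN // /row_space /= row_sub.
Qed.

Lemma para_mx_split A B K : col_mx A B *m K = para_diag *m col_mx A B ->
  A *m K = A /\ B *m K = - B.
Proof.
rewrite mul_col_mx /para_diag mul_block_col !mul0mx addr0 add0r mul1mx mulNmx.
by rewrite mul1mx => /eq_col_mx.
Qed.

(** A splitting is recovered from its para-complex structure as the pair of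
    eigenspaces. This is how splittings are traded for endomorphisms below. *)
Lemma para_fixed A B K : col_mx A B \in unitmx ->
  col_mx A B *m K = para_diag *m col_mx A B ->
  row_space A = [set v | v *m K = v] /\ row_space B = [set v | v *m K = - v].
Proof.
move=> Vu /para_mx_split[AK BK].
have dec (v : 'rV[R]_(n + n)) : exists a b, v = a *m A + b *m B.
  exists (lsubmx (v *m invmx (col_mx A B))), (rsubmx (v *m invmx (col_mx A B))).
  by rewrite -mul_row_col hsubmxK mulmxKV.
have half (x : 'rV[R]_(n + n)) : x = - x -> x = 0.
  move=> E; have : x *+ 2 = 0 by rewrite mulr2n {1}E addNr.
  by move=> /eqP; rewrite -scaler_nat scaler_eq0 pnatr_eq0 /= => /eqP.
split; apply/seteqP; split=> v.
- by move=> /submxP[a ->] /=; rewrite -mulmxA AK.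
- have [a [b ->]] := dec v; rewrite /= mulmxDl -!mulmxA AK BK => /addrI.
  rewrite mulmxN => /esym/half ->; rewrite addr0; exact: submxMl.
- by move=> /submxP[a ->] /=; rewrite -mulmxA BK mulmxN.
- have [a [b ->]] := dec v; rewrite /= mulmxDl -!mulmxA AK BK mulmxN opprD.
  by move=> /addIr/half ->; rewrite add0r; exact: submxMl.
Qed.

End Splittings.

Lemma isotropic_mx (R : realType) m k (B : 'M[R]_m) (A : 'M[R]_(k, m)) :
  Defs.isotropic B (row_space A) <-> A *m B *m A^T = 0.
Proof.
split=> [H|H v w /submxP[x ->] /submxP[y ->]]; last first.
  have -> : bil B (x *m A) (y *m A) = (x *m (A *m B *m A^T) *m y^T) 0 0.
    by rewrite /bil trmx_mul !mulmxA.
  by rewrite H mulmx0 mul0mx mxE.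
apply/matrixP => i j; rewrite [RHS]mxE.
rewrite -(H (row i A) (row j A)) ?/row_space /= ?row_sub //.
rewrite /bil -row_mul [LHS]mxE [RHS]mxE; apply: eq_bigr => k' _.
by congr (_ * _); rewrite !mxE.
Qed.

Section ParaKahler.
Variables (R : realType) (n : nat) (b : 'M[R]_(n + n)) (VE VF : 'M[R]_(n, n + n)).
Variable M : manifold R (n + n).
Hypothesis n2 : (2 <= n)%N.
Hypothesis Hb : para_kahler_model b VE VF.

Let V := col_mx VE VF.
Let K0 := para_complex (row_space VE) (row_space VF).
Let G0 := fundamental_form b K0.

Let m_gt2 : (2 < n + n)%N. Proof. by lia. Qed.

Let V_unit : V \in unitmx.
Proof. by case: Hb => _ _ _ /direct_sum_unit. Qed.

Let VK0 : V *m K0 = para_diag R n *m V.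
Proof. exact: para_complex_mx. Qed.

Let VEF : VE *m K0 = VE /\ VF *m K0 = - VF.
Proof. exact: para_mx_split. Qed.

Let K0_sqr : K0 *m K0 = 1%:M.
Proof.
have E : V *m (K0 *m K0) = V.
  by rewrite mulmxA VK0 -mulmxA VK0 mulmxA para_diag_sqr mul1mx.
by rewrite -[LHS](mulKmx V_unit) E mulVmx.
Qed.

Let b_tr : b^T = - b.
Proof. by case: Hb => /skew_trP. Qed.

Let b_unit : b \in unitmx.
Proof. by case: Hb => _ /nondegenerate_unitP. Qed.

Let b_isotropic : VE *m b *m VE^T = 0 /\ VF *m b *m VF^T = 0.
Proof. by case: Hb => _ _ _ _ [/isotropic_mx -> /isotropic_mx ->]. Qed.

Let b_anti : b *m K0^T = - (K0 *m b).
Proof.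
have [bE bF] := b_isotropic.
have E : K0 *m b *m K0^T = - b.
  have Vt : V^T \in unitmx by rewrite unitmx_tr.
  apply: (can_inj (mulKmx V_unit)); apply: (can_inj (mulmxK Vt)).
  have -> : V *m (K0 *m b *m K0^T) *m V^T = (V *m K0) *m b *m (V *m K0)^T.
    by rewrite trmx_mul !mulmxA.
  rewrite VK0 trmx_mul.
  have -> : para_diag R n *m V *m b *m (V^T *m (para_diag R n)^T) =
      para_diag R n *m (V *m b *m V^T) *m (para_diag R n)^T by rewrite !mulmxA.
  have -> : V *m - b *m V^T = - (V *m b *m V^T) by rewrite mulmxN mulNmx.
  rewrite /V tr_col_mx (mul_col_mx VE VF b) mul_col_row bE bF /para_diag.
  rewrite tr_block_mx !trmx0 linearN /= !trmx1 !mulmx_block.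
  rewrite !(mulmx0, mul0mx, mul1mx, mulmx1, mulmxN, mulNmx).
  by rewrite opp_block_mx !(addr0, add0r, oppr0, opprK).
have := congr1 (mulmx K0) E; rewrite !mulmxA K0_sqr mul1mx mulmxN => ->.
by [].
Qed.

Let fund_G0 : fundamental_form G0 K0 = b.
Proof.
rewrite /G0 /fundamental_form mulNmx opprK -mulmxA -trmx_mul K0_sqr trmx1.
by rewrite mulmx1.
Qed.

Let K0_unit : K0 \in unitmx.
Proof. by case/mulmx1_unit: K0_sqr. Qed.

Let model : pacs_model 1 K0 G0.
Proof.
split.
- by rewrite mulr1.
- exact: K0_sqr.
- rewrite /G0 /fundamental_form linearN /= trmx_mul trmxK b_tr mulmxN b_anti.
  by rewrite opprK.
- by rewrite /G0 /fundamental_form -scaleN1r unitmxZ ?unitrN1 // unitmx_mul b_unit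
    unitmx_tr.
- rewrite /G0 /fundamental_form scaleN1r mulmxN mulNmx opprK -mulmxA -[b *m _ *m _]mulmxA.
  by rewrite -trmx_mul K0_sqr trmx1 mulmx1 b_anti.
Qed.

Let para_metricE : para_model_metric b VE VF = bil G0.
Proof. by apply/funext => v; apply/funext => w; rewrite fundamental_formE. Qed.

Lemma para_kahler_groupE : para_kahler_group b VE VF = pacs_group K0 G0.
Proof.
have [HE HF] := para_fixed V_unit VK0; have [EK FK] := VEF.
apply/seteqP; split=> A.
  move=> [[Au [t Ht]] /submxP[x xE] /submxP[y yE]].
  have KA : K0 *m A = A *m K0.
    have VA : V *m A = block_mx x 0 0 y *m V.
      by rewrite /V mul_col_mx xE yE mul_block_col !mul0mx addr0 add0r.
    apply: (can_inj (mulKmx V_unit)); rewrite !mulmxA VK0 VA -!mulmxA VA VK0.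
    rewrite !mulmxA; congr (_ *m _); rewrite /para_diag !mulmx_block.
    by rewrite !mulmx0 !mul0mx !mulmxN !mulNmx !mulmx1 !mul1mx !addr0 !add0r.
  split=> //; apply/(pacs_group_fundamental model Au KA); rewrite fund_G0; exists t.
  by apply: bil_inj => v w; rewrite bilZ -Ht bil_mul.
move=> [Au KA /(pacs_group_fundamental model Au KA)]; rewrite fund_G0 => -[t Ht].
split.
- split=> //; exists t => v w.
  by rewrite bil_mul Ht -scalemxAr -scalemxAl mxE.
- apply/row_subP => i; suff : row_space VE (row i (VE *m A)) by [].
  by rewrite HE /= -row_mul -mulmxA -KA mulmxA EK.
- apply/row_subP => i; suff : row_space VF (row i (VF *m A)) by [].
  by rewrite HF /= -row_mul -mulmxA -KA mulmxA FK mulNmx raddfN.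
Qed.

(** A frame maps [V^E] to E and [V^F] to F if and only if it intertwines the
    para-complex structures, since these subspaces are their eigenspaces. *)
Lemma para_correspondenceE (P : M -> set 'M[R]_(n + n)) EFc :
  (forall x u, P x u -> u \in unitmx) ->
  (forall x, exists A B : 'M[R]_(n, n + n), [/\ EFc.1.1 x = row_space A,
     EFc.1.2 x = row_space B & col_mx A B \in unitmx]) ->
  para_kahler_correspondence (M := M) b VE VF P EFc <->
  pacs_correspondence K0 G0 P
    (fun x => para_complex (EFc.1.1 x) (EFc.1.2 x)) EFc.2.
Proof.
move=> Pu HEF; rewrite /para_kahler_correspondence /pacs_correspondence para_metricE.
split=> -[H1 H2]; split=> // x u Pxu; have uu := Pu _ _ Pxu.
  have [-> ->] := H1 _ _ Pxu.
  have Vu : col_mx (VE *m u) (VF *m u) \in unitmx.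
    by rewrite -mul_col_mx unitmx_mul V_unit.
  apply: (can_inj (mulKmx V_unit)).
  rewrite !mulmxA VK0 (mul_col_mx VE VF u : V *m u = _) (para_complex_mx Vu).
  by rewrite -mul_col_mx mulmxA.
have [A [B [EA FB ABu]]] := HEF x; have := H1 _ _ Pxu; rewrite EA FB => HK.
have [AE BF] := para_fixed ABu (para_complex_mx ABu).
have Vu : col_mx (VE *m u) (VF *m u) \in unitmx.
  by rewrite -mul_col_mx unitmx_mul V_unit.
have HVu : col_mx (VE *m u) (VF *m u) *m para_complex (row_space A) (row_space B)
    = para_diag R n *m col_mx (VE *m u) (VF *m u).
  by rewrite -mul_col_mx -mulmxA -HK !mulmxA VK0.
have [EE FF] := para_fixed Vu HVu.
by split; [exact: etrans AE (esym EE)|exact: etrans BF (esym FF)].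
Qed.

Lemma subbundle_unit (E F : M -> set 'rV[R]_(n + n)) x :
  subbundle n E -> subbundle n F -> direct_sum (E x) (F x) ->
  exists A B : 'M[R]_(n, n + n),
    [/\ E x = row_space A, F x = row_space B & col_mx A B \in unitmx].
Proof.
move=> HE HF dEF; have [U [s [_ Ux _ /(_ _ Ux)[_ Es]]]] := HE x.
have [U' [s' [_ Ux' _ /(_ _ Ux')[_ Fs]]]] := HF x.
exists (s x), (s' x); split=> //; apply/direct_sum_unit.
by rewrite Es Fs in dEF.
Qed.

Lemma para_class_of_structure P : G_structure (para_kahler_group b VE VF) P ->
  exists! EFc, conformal_para_hermitian_class n EFc.1.1 EFc.1.2 EFc.2 /\
    para_kahler_correspondence (M := M) b VE VF P EFc.
Proof.
rewrite para_kahler_groupE => PG.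
have [K HK] := pacs_tensor PG.
have EF_ x u : P x u -> [set v | v *m K x = v] = row_space (VE *m u) /\
                       [set v | v *m K x = - v] = row_space (VF *m u).
  move=> Pu; have uu := pacs_unit PG Pu.
  have Vu : col_mx (VE *m u) (VF *m u) \in unitmx.
    by rewrite -mul_col_mx unitmx_mul V_unit.
  have HVu : col_mx (VE *m u) (VF *m u) *m K x
      = para_diag R n *m col_mx (VE *m u) (VF *m u).
    by rewrite -mul_col_mx -mulmxA -(HK _ _ Pu) !mulmxA VK0.
  by have [-> ->] := para_fixed Vu HVu.
pose E x : set 'rV[R]_(n + n) := [set v | v *m K x = v].
pose F x : set 'rV[R]_(n + n) := [set v | v *m K x = - v].
pose c := induced_line P (bil G0).
have [rE rF] : row_free VE /\ row_free VF by case: Hb.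
exists (E, F, c); split; last first.
  move=> [[E' F'] c'] [_ [/= HEF Hc]].
  have -> : E' = E.
    apply/funext => x; have [u Pu] := pacs_inhabited PG x.
    by have [-> _] := HEF _ _ Pu; have [<- _] := EF_ _ _ Pu.
  have -> : F' = F.
    apply/funext => x; have [u Pu] := pacs_inhabited PG x.
    by have [_ ->] := HEF _ _ Pu; have [_ <-] := EF_ _ _ Pu.
  by congr (_, _); apply/funext => x; rewrite Hc /c para_metricE.
split; last first.
  split=> [x u Pu|x]; last by rewrite /c para_metricE.
  by rewrite /= /E /F; have [-> ->] := EF_ _ _ Pu.
have sub (W : 'M[R]_(n, n + n)) (D : M -> set 'rV[R]_(n + n)) : row_free W ->
    (forall x u, P x u -> D x = row_space (W *m u)) -> subbundle n D.
  move=> Wf HD x; have [U [s [oU Ux ss Ps]]] := pacs_local_frame PG x.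
  exists U, (fun y => W *m s y); split=> //.
    by apply: smooth_rows_mul => //; exact: smooth_map_cst.
  move=> y Uy; split; last exact: HD (Ps _ Uy).
  by rewrite /row_free mxrankMfree // row_free_unit (pacs_unit PG (Ps _ Uy)).
have [bE bF] := b_isotropic; have [EK FK] := VEF.
split.
- by apply: (sub VE) => // x u /EF_[].
- by apply: (sub VF) => // x u /EF_[].
- move=> x; have [u Pu] := pacs_inhabited PG x; rewrite /= /E /F.
  have [-> ->] := EF_ _ _ Pu; apply/direct_sum_unit.
  by rewrite -mul_col_mx unitmx_mul V_unit (pacs_unit PG Pu).
have [_ _ Gs Gu _] := model.
apply: (pacs_line_subbundle PG).
- apply/eqP => G00; move: Gu; rewrite G00.
  by rewrite -row_free_unit /row_free mxrank0; move: m_gt2; case: (n + n)%N.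
- by move=> x u Pu; exact: (pacs_metric_line PG).
- move=> x u Pu; have uu := pacs_unit PG Pu; rewrite /= /E /F.
  have [-> ->] := EF_ _ _ Pu; split.
  + by apply/symmetric_trP; rewrite push_tr Gs.
  + by apply/nondegenerate_unitP; rewrite push_unit.
  + apply/isotropic_mx.
    have -> : VE *m u *m push u G0 *m (VE *m u)^T = VE *m G0 *m VE^T.
      by rewrite -[in RHS](pushK G0 uu) trmx_mul !mulmxA.
    rewrite /G0 /fundamental_form mulmxN mulNmx mulmxA -[_ *m K0^T *m _]mulmxA.
    by rewrite -trmx_mul EK bE oppr0.
  + apply/isotropic_mx.
    have -> : VF *m u *m push u G0 *m (VF *m u)^T = VF *m G0 *m VF^T.
      by rewrite -[in RHS](pushK G0 uu) trmx_mul !mulmxA.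
    rewrite /G0 /fundamental_form mulmxN mulNmx mulmxA -[_ *m K0^T *m _]mulmxA.
    by rewrite -trmx_mul FK linearN /= mulmxN bF !oppr0.
Qed.

(** As E and F are isotropic, the metric is determined by its pairing N between
    a frame of E and a frame of F. Multiplying the former by [N0 N^-1] turns
    the pairing into that of the model. *)
Lemma para_local_frame (E F : M -> set 'rV[R]_(n + n)) c :
  conformal_para_hermitian_class n E F c -> forall x,
  exists (U : set M) (s : M -> 'M[R]_(n + n)),
    [/\ open U, U x, smooth_rows U s & forall y, U y ->
        [/\ s y \in unitmx, K0 *m s y = s y *m para_complex (E y) (F y) &
            c y = line (push (s y) G0)]].
Proof.
move=> [HE HF dEF Hc] x; have [U1 [g [oU1 U1x sg Hg]]] := Hc x.
have [U2 [sE [oU2 U2x ssE HsE]]] := HE x.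
have [U3 [sF [oU3 U3x ssF HsF]]] := HF x.
pose U := U1 `&` (U2 `&` U3).
have oU : open U by apply: openI => //; exact: openI.
have ssE' : smooth_rows U sE by apply: smooth_rows_subset ssE => y [_ []].
have ssF' : smooth_rows U sF by apply: smooth_rows_subset ssF => y [_ []].
have sg' : smooth_form U g by apply: smooth_form_subset sg => y [].
have [_ _ Gs Gu _] := model; have [bE bF] := b_isotropic; have [EK FK] := VEF.
have G0E : VE *m G0 *m VE^T = 0.
  rewrite /G0 /fundamental_form mulmxN mulNmx mulmxA -[_ *m K0^T *m _]mulmxA.
  by rewrite -trmx_mul EK bE oppr0.
have G0F : VF *m G0 *m VF^T = 0.
  rewrite /G0 /fundamental_form mulmxN mulNmx mulmxA -[_ *m K0^T *m _]mulmxA.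
  by rewrite -trmx_mul FK linearN /= mulmxN bF !oppr0.
pose N0 := VE *m G0 *m VF^T.
pose N y := sE y *m g y *m (sF y)^T.
have pairing_unit (A B : 'M[R]_(n, n + n)) (G : 'M[R]_(n + n)) :
    G \in unitmx -> col_mx A B \in unitmx -> A *m G *m A^T = 0 ->
    A *m G *m B^T \in unitmx.
  move=> Gu' ABu AA; rewrite -row_free_unit -kermx_eq0; apply/rowV0P => v.
  move=> /sub_kermxP vAB.
  have vA : v *m A = 0.
    have : v *m A *m G *m (col_mx A B)^T = 0.
      rewrite tr_col_mx mul_mx_row -row_mx0; congr row_mx.
        by rewrite -[RHS](mulmx0 _ v) -[in RHS]AA !mulmxA.
      by rewrite -[RHS]vAB !mulmxA.
    have tu : (col_mx A B)^T \in unitmx by rewrite unitmx_tr.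
    move=> H; rewrite -[LHS](mulmxK Gu') -[_ *m G](mulmxK tu) H.
    by rewrite !mul0mx.
  have : row_mx v 0 *m col_mx A B = 0 by rewrite mul_row_col vA mul0mx addr0.
  move=> H; have : row_mx v 0 = 0 :> 'rV[R]_(n + n).
    by rewrite -[LHS](mulmxK ABu) H mul0mx.
  by rewrite -[RHS]row_mx0 => /eq_row_mx[].
have loc y : U y -> [/\ g y \in unitmx, (g y)^T = g y,
    sE y *m g y *m (sE y)^T = 0, sF y *m g y *m (sF y)^T = 0 &
    col_mx (sE y) (sF y) \in unitmx].
  move=> [U1y [U2y U3y]]; have [[]] := Hg _ U1y.
  have [_ ->] := HsE _ U2y; have [_ ->] := HsF _ U3y.
  move=> /symmetric_trP gs /nondegenerate_unitP gu /isotropic_mx gE /isotropic_mx gF _ _.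
  split=> //; apply/direct_sum_unit; move: (dEF y).
  by have [_ ->] := HsE _ U2y; have [_ ->] := HsF _ U3y.
have Nu y : U y -> N y \in unitmx.
  by move=> /loc[gu _ gE _ ABu]; exact: pairing_unit.
have N0u : N0 \in unitmx by exact: pairing_unit.
pose fE y := N0 *m invmx (N y) *m sE y.
pose s y := invmx V *m col_mx (fE y) (sF y).
have Vs y : V *m s y = col_mx (fE y) (sF y) by rewrite /s mulKVmx.
have colu y : U y -> col_mx (fE y) (sF y) \in unitmx.
  move=> Uy; have [_ _ _ _ ABu] := loc _ Uy.
  have -> : col_mx (fE y) (sF y) =
      block_mx (N0 *m invmx (N y)) 0 0 1%:M *m col_mx (sE y) (sF y).
    by rewrite mul_block_col !mul0mx addr0 add0r mul1mx.
  rewrite unitmx_mul ABu andbT unitmxE det_ublock det1 mulr1 -unitmxE unitmx_mul.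
  by rewrite N0u unitmx_inv Nu.
have su y : U y -> s y \in unitmx.
  by move=> Uy; rewrite unitmx_mul unitmx_inv V_unit colu.
have eqE y : U y -> row_space (fE y) = E y.
  move=> Uy; have [_ [U2y _]] := Uy; have [_ ->] := HsE _ U2y.
  have Cu : N0 *m invmx (N y) \in unitmx by rewrite unitmx_mul N0u unitmx_inv Nu.
  apply/seteqP; split=> v; rewrite /row_space /= => /submxP[a ->].
    rewrite /fE mulmxA; exact: submxMl.
  have -> : a *m sE y = a *m invmx (N0 *m invmx (N y)) *m fE y.
    by rewrite /fE -[RHS]mulmxA mulKmx.
  exact: submxMl.
exists U, s; split=> //.
  have sN : smooth_map U N by exact: smooth_pairing.
  have sfE : smooth_rows U fE.
    apply: smooth_rows_mul => //; apply: smooth_map_mulmx => //.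
      exact: smooth_map_cst.
    exact: smooth_map_invmx.
  have -> : s = (fun y => (invmx V *m col_mx 1%:M 0) *m fE y +
                          (invmx V *m col_mx 0 1%:M) *m sF y).
    apply/funext => y; rewrite /s -!mulmxA -mulmxDr; congr (_ *m _).
    by rewrite !mul_col_mx !mul1mx !mul0mx add_col_mx addr0 add0r.
  by apply: smooth_rows_add => //; apply: smooth_rows_mul => //; exact: smooth_map_cst.
move=> y Uy; have [gu gs gE gF ABu] := loc _ Uy; split.
- exact: su.
- apply: (can_inj (mulKmx V_unit)).
  rewrite (mulmxA V K0) VK0 (mulmxA V (s y)) -(mulmxA _ V (s y)) Vs.
  have [_ [_ U3y]] := Uy; have [_ FE] := HsF _ U3y.
  rewrite -(eqE _ Uy) FE; exact/esym/para_complex_mx/colu.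
- have [_ _ ->] : [/\ almost_para_hermitian (E y) (F y) (g y), g y != 0 &
      c y = line (g y)] by case: Uy => /Hg.
  congr (line _); apply: push_eq; first exact: su.
  have Vt : V^T \in unitmx by rewrite unitmx_tr.
  apply: (can_inj (mulKmx V_unit)); apply: (can_inj (mulmxK Vt)).
  have -> : V *m (s y *m g y *m (s y)^T) *m V^T = (V *m s y) *m g y *m (V *m s y)^T.
    by move: (s y) => X; rewrite trmx_mul !mulmxA.
  have fF : fE y *m g y *m (sF y)^T = N0.
    rewrite /fE; have -> : N0 *m invmx (N y) *m sE y *m g y *m (sF y)^T =
      N0 *m invmx (N y) *m N y by rewrite /N !mulmxA.
    by rewrite mulmxKV ?Nu.
  have fEE : fE y *m g y *m (fE y)^T = 0.
    have -> : fE y *m g y *m (fE y)^T = (N0 *m invmx (N y)) *m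
      (sE y *m g y *m (sE y)^T) *m (N0 *m invmx (N y))^T.
      by rewrite [in LHS]/fE trmx_mul !mulmxA.
    by rewrite gE mulmx0 mul0mx.
  rewrite Vs tr_col_mx mul_col_mx mul_col_row fEE fF gF.
  rewrite /V tr_col_mx mul_col_mx mul_col_row G0E G0F -/N0; congr block_mx.
  by rewrite -(gram_tr _ _ gs) fF /N0 (gram_tr _ _ Gs).
Qed.

Lemma para_structure_of_class EFc :
  conformal_para_hermitian_class n EFc.1.1 EFc.1.2 EFc.2 ->
  exists! P, G_structure (para_kahler_group b VE VF) P /\
    para_kahler_correspondence (M := M) b VE VF P EFc.
Proof.
move=> Hc; have [P [[PG Pc] uniqP]] :=
  pacs_structure_exists m_gt2 model (para_local_frame Hc).
have HEF x : exists A B : 'M[R]_(n, n + n), [/\ EFc.1.1 x = row_space A,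
    EFc.1.2 x = row_space B & col_mx A B \in unitmx].
  by case: Hc => HE HF dEF _; exact: subbundle_unit.
exists P; split.
  rewrite para_kahler_groupE; split=> //.
  exact: (para_correspondenceE (pacs_unit PG) HEF).2 Pc.
move=> P'; rewrite para_kahler_groupE => -[PG' Pc']; apply: uniqP; split=> //.
exact: (para_correspondenceE (pacs_unit PG') HEF).1 Pc'.
Qed.

Lemma para_underlying P E F c : G_structure (para_kahler_group b VE VF) P ->
  conformal_para_hermitian_class n E F c ->
  para_kahler_correspondence (M := M) b VE VF P (E, F, c) ->
  let K := fun x => para_complex (E x) (F x) in
  let l := induced_line P (bil b) in
  [/\ almost_conformally_symplectic l,
      spanned_by_fundamental_forms c K l,
      conformally_symplectic l <-> locally_contains_kahler c K &
      kahler_locally_unique c K].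
Proof.
rewrite para_kahler_groupE => PG [HE HF dEF _] Hc K l.
have Pc : pacs_correspondence K0 G0 P K c.
  have HEF x : exists A B : 'M[R]_(n, n + n), [/\ E x = row_space A,
      F x = row_space B & col_mx A B \in unitmx] by exact: subbundle_unit.
  exact: (@para_correspondenceE P (E, F, c) (pacs_unit PG) HEF).1 Hc.
rewrite /l -fund_G0; split.
- exact: (underlying_acs m_gt2 model PG).
- exact: (underlying_spanned model PG Pc).
- exact: (underlying_pcs m_gt2 model PG Pc).
- exact: (underlying_kahler_unique m_gt2 model PG Pc).
Qed.

End ParaKahler.

Local Close Scope ring_scope.
Local Close Scope classical_set_scope.

Theorem proposition3p3 (R : realType) :
  (* (1) *)
  (forall (p q : nat) (h : 'M[R[i]]_(p + q))
      (M : manifold R ((p + q) + (p + q))),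
    (2 <= p + q)%N -> hermitian_form p q h ->
    (forall P, G_structure (kahler_group h) P ->
       exists! Jc, conformal_hermitian_class p q Jc.1 Jc.2 /\
                   kahler_correspondence (M := M) h P Jc) /\
    (forall Jc, conformal_hermitian_class p q Jc.1 Jc.2 ->
       exists! P, G_structure (kahler_group h) P /\
                  kahler_correspondence (M := M) h P Jc)) /\
  (* (2) *)
  (forall (n : nat) (b : 'M[R]_(n + n)) (VE VF : 'M[R]_(n, n + n))
      (M : manifold R (n + n)),
    (2 <= n)%N -> para_kahler_model b VE VF ->
    (forall P, G_structure (para_kahler_group b VE VF) P ->
       exists! EFc,
         conformal_para_hermitian_class n EFc.1.1 EFc.1.2 EFc.2 /\
         para_kahler_correspondence (M := M) b VE VF P EFc) /\
    (forall EFc, conformal_para_hermitian_class n EFc.1.1 EFc.1.2 EFc.2 ->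
       exists! P, G_structure (para_kahler_group b VE VF) P /\
                  para_kahler_correspondence (M := M) b VE VF P EFc)) /\
  (* (3), Kaehler type *)
  (forall (p q : nat) (h : 'M[R[i]]_(p + q))
      (M : manifold R ((p + q) + (p + q)))
      (P : M -> set 'M[R]_((p + q) + (p + q)))
      (J : M -> 'M[R]_((p + q) + (p + q)))
      (c : M -> set 'M[R]_((p + q) + (p + q))),
    (2 <= p + q)%N -> hermitian_form p q h ->
    G_structure (kahler_group h) P ->
    conformal_hermitian_class p q J c ->
    kahler_correspondence h P (J, c) ->
    let l := induced_line P (im_form h) in
    [/\ almost_conformally_symplectic l,
        spanned_by_fundamental_forms c J l,
        conformally_symplectic l <-> locally_contains_kahler c J &
        kahler_locally_unique c J]) /\
  (* (3), para-Kaehler type *)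
  (forall (n : nat) (b : 'M[R]_(n + n)) (VE VF : 'M[R]_(n, n + n))
      (M : manifold R (n + n))
      (P : M -> set 'M[R]_(n + n))
      (E F : M -> set 'rV[R]_(n + n))
      (c : M -> set 'M[R]_(n + n)),
    (2 <= n)%N -> para_kahler_model b VE VF ->
    G_structure (para_kahler_group b VE VF) P ->
    conformal_para_hermitian_class n E F c ->
    para_kahler_correspondence b VE VF P (E, F, c) ->
    let K := fun x => para_complex (E x) (F x) in
    let l := induced_line P (bil b) in
    [/\ almost_conformally_symplectic l,
        spanned_by_fundamental_forms c K l,
        conformally_symplectic l <-> locally_contains_kahler c K &
        kahler_locally_unique c K]).
Proof.
split.
  move=> p q h M pq hh; split=> [P|Jc].
    exact: kahler_class_of_structure.
  exact: kahler_structure_of_class.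
split.
  move=> n b VE VF M n2 Hb; split=> [P|EFc].
    exact: para_class_of_structure.
  exact: para_structure_of_class.
split.
  move=> p q h M P J c pq hh PG _ Pc; exact: (kahler_underlying pq hh PG Pc).
move=> n b VE VF M P E F c n2 Hb PG Hc Pc; exact: (para_underlying n2 Hb PG Hc Pc).
Qed.
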